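(* Let $\mathcal W$ be a real-valued even tempered distribution on $\mathbb R$ with $\widehat{\mathcal W}\in L^\infty(\mathbb R)$. Assume that there exist $\sigma\in(0,1]$ and $\kappa\in[0,1/2]$ such that $\widehat{\mathcal W}(\xi)\ge\sigma-\kappa\xi^2$ for a.e. $\xi\in\mathbb R$. Assume in addition that $\widehat{\mathcal W}$ is weakly differentiable and that there exists $C>0$ such that $$\bigl|(\widehat{\mathcal W})'(\xi)\bigr|\le C(|\xi|+1)\quad\text{for a.e. }\xi\in\mathbb R.$$ Let $c\in[0,\sqrt{2\sigma})$ and let $u\in\mathcal E(\mathbb R)$ be a solution to $$icu'+u''+u\,\bigl(\mathcal W*(1-|u|^2)\bigr)=0\quad\text{in }\mathbb R.$$ Then there exists $r>0$ such that $\eta=1-|u|^2$ and $u$ have analytic extensions to the strip $\{z\in\mathbb C:|\operatorname{Im}z|<r\}$. If $c\in(0,\sqrt{2\sigma})$, then $u$ is real analytic on $\mathbb R$, in the sense that $\operatorname{Re}(u)$ and $\operatorname{Im}(u)$ are real analytic on $\mathbb R$.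
   Context: Fourier transform convention: $\widehat f(\xi)=\int_{\mathbb R}e^{-ix\xi}f(x)\,dx$. For $f\in L^2(\mathbb R)$, $\mathcal W*f\in L^2(\mathbb R)$ is defined by $\widehat{\mathcal W*f}=\widehat{\mathcal W}\,\widehat f$. The energy space is $\mathcal E(\mathbb R)=\{v\in H^1_{\rm loc}(\mathbb R;\mathbb C): 1-|v|^2\in L^2(\mathbb R),\ v'\in L^2(\mathbb R)\}$. The equation is understood in the sense of distributions. *)

(* Defs.v *)
From mathcomp Require Import all_boot all_order all_algebra.
From mathcomp Require Import all_classical all_reals all_analysis.
Import Order.TTheory GRing.Theory Num.Theory.
Import numFieldNormedType.Exports.
From mathcomp Require Import complex.

Set Implicit Arguments.
Unset Strict Implicit.
Unset Printing Implicit Defensive.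

Local Open Scope classical_set_scope.
Local Open Scope ring_scope.
Local Open Scope complex_scope.

(* For K = R this is real analyticity at z, for K = R[i] complex analyticity. *)
Definition analytic_at (K : numFieldType) (f : K -> K) (z : K) : Prop :=
  exists (a : nat -> K) (rho : K), 0 < rho /\
    forall w : K, `|w - z| < rho ->
      series (fun n => a n * (w - z) ^+ n) @ \oo --> f w.

Section ComplexValued.
Context {R : realType}.
Local Notation mu := (@lebesgue_measure R).
Implicit Types f g phi psi u v : R -> R[i].

(* R[i] carries no measurable or normed R-module structure in the library, so
   integration, differentiation and Lebesgue spaces are defined componentwise. *)
Definition Cintegral f : R[i] :=
  (\int[mu]_x Re (f x)) +i* (\int[mu]_x Im (f x)).

Definition CLp (p : \bar R) f : Prop :=
  (fun x => Re (f x)) \in Lfun mu p /\ (fun x => Im (f x)) \in Lfun mu p.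

Definition L2 f : Prop := CLp 2%:E f.

Definition Linfty f : Prop := CLp +oo%E f.

Definition L2loc f : Prop :=
  forall K : set R, compact K -> L2 (fun x => if x \in K then f x else 0).

Definition L1loc f : Prop :=
  locally_integrable [set: R] (fun x => Re (f x)) /\
  locally_integrable [set: R] (fun x => Im (f x)).

Definition Cderive1n (n : nat) f (x : R) : R[i] :=
  derive1n n (fun y => Re (f y)) x +i* derive1n n (fun y => Im (f y)) x.

Definition smooth f : Prop :=
  forall (n : nat) (x : R),
    derivable (derive1n n (fun y => Re (f y))) x 1 /\
    derivable (derive1n n (fun y => Im (f y))) x 1.

Definition test_function phi : Prop :=
  smooth phi /\ compact (closure [set x | phi x != 0]).

(* The norm on Rcomplex R is the modulus, with values in R rather than R[i]. *)
Definition schwartz_term (k n : nat) phi (x : R) : R :=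
  `|x| ^+ k * `|Cderive1n n phi x : Rcomplex R|.

Definition schwartz phi : Prop :=
  smooth phi /\ forall k n : nat, has_ubound (range (schwartz_term k n phi)).

Definition schwartz_seminorm (k n : nat) phi : R :=
  sup (range (schwartz_term k n phi)).

(* Functionals are total; only their values at Schwartz functions matter. *)
Definition functional : Type := (R -> R[i]) -> R[i].

Definition tempered_distribution (T : functional) : Prop :=
  (forall (a : R[i]) phi psi, schwartz phi -> schwartz psi ->
     T (fun x => a * phi x + psi x) = a * T phi + T psi) /\
  exists (C : R) (N : nat), forall phi, schwartz phi ->
    `|T phi : Rcomplex R| <=
      C * \sum_(k < N) \sum_(n < N) schwartz_seminorm k n phi.

Definition real_distribution (T : functional) : Prop :=
  forall phi, schwartz phi -> T (fun x => (phi x)^*) = (T phi)^*.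

Definition even_distribution (T : functional) : Prop :=
  forall phi, schwartz phi -> T (fun x => phi (- x)) = T phi.

Definition distribution_of f : functional :=
  fun phi => Cintegral (fun x => f x * phi x).

Definition fourier phi (xi : R) : R[i] :=
  Cintegral (fun x => (cos (- (x * xi)) +i* sin (- (x * xi))) * phi x).

(* The distributional Fourier transform of T is the function h. For
   T = distribution_of f with f and h in L2, this says that h is the L2
   (Plancherel) Fourier transform of f. *)
Definition has_fourier (T : functional) (h : R -> R[i]) : Prop :=
  forall phi, schwartz phi -> T (fourier phi) = distribution_of h phi.

(* g = W * f for f in L2 and a tempered distribution W with bounded Fourier
   transform; g is determined up to a null set. *)
Definition is_convolution (W : functional) f g : Prop :=
  exists what fhat : R -> R[i],
    [/\ Linfty what /\ has_fourier W what,
        L2 fhat /\ has_fourier (distribution_of f) fhat,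
        L2 g &
        has_fourier (distribution_of g) (fun xi => what xi * fhat xi)].

Definition weak_derivative f g : Prop :=
  [/\ L1loc f, L1loc g &
      forall phi, test_function phi ->
        Cintegral (fun x => f x * Cderive1n 1 phi x) =
        - Cintegral (fun x => g x * phi x)].

Definition H1loc v : Prop :=
  L2loc v /\ exists v', weak_derivative v v' /\ L2loc v'.

Definition eta u : R -> R[i] := fun x => 1 - `|u x| ^+ 2.

Definition energy_space v : Prop :=
  [/\ H1loc v, L2 (eta v) & exists v', weak_derivative v v' /\ L2 v'].

(* i c u' + u'' + u (W * (1 - |u|^2)) = 0 in the sense of distributions *)
Definition solution (W : functional) (c : R) u : Prop :=
  exists g, is_convolution W (eta u) g /\
    forall phi, test_function phi ->
      - ('i * c%:C * Cintegral (fun x => u x * Cderive1n 1 phi x))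
      + Cintegral (fun x => u x * Cderive1n 2 phi x)
      + Cintegral (fun x => u x * g x * phi x) = 0.

(* Elements of L2 and H1loc are classes modulo equality a.e., so the extension
   restricts to f almost everywhere, hence to its continuous representative
   everywhere. *)
Definition analytic_extension (r : R) f : Prop :=
  exists F : R[i] -> R[i],
    (forall z : R[i], `|Im z| < r -> analytic_at F z) /\
    {ae mu, forall x, f x = F x%:C}.

Definition real_analytic f : Prop :=
  exists v, {ae mu, forall x, f x = v x} /\
    forall x : R, analytic_at (fun y => Re (v y)) x /\
                  analytic_at (fun y => Im (v y)) x.

End ComplexValued.

(* Main.v *)
(* Write n for the modulus of the Fourier transform of eta = 1 - |u|^2 and let
   g = W * eta, whose transform is at most a constant times n. Since W is real
   so is g, hence u is C^1, the momentum density of u is a multiple of eta, and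
     eta'' = - c^2 eta + 2 g - 2 (K + eta g),  K' = eta' g,  K = |u'|^2.
   In Fourier variables the first identity makes n integrable, and both together
   give |x|^3 n <= C |x| n + C n * (|x| n), where the last star is convolution.
   The surplus of two powers of x over the quadratic term bounds the k-th moment
   of n by A B^k k!, hence the k-th derivatives of eta and g. The second order
   linear equation with coefficient g passes such bounds on to u, and
   re-expanding Taylor series yields the extension to a strip. *)

Require Import Defs.
From mathcomp Require Import all_boot all_order all_algebra.
From mathcomp Require Import all_classical all_reals all_analysis.
Import Order.TTheory GRing.Theory Num.Theory.
Import numFieldNormedType.Exports.
From mathcomp Require Import complex.
From mathcomp Require Import measurable_realfun ess_sup_inf ring lra.
Local Open Scope classical_set_scope.
Local Open Scope ring_scope.
Local Open Scope complex_scope.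

Set Implicit Arguments.
Unset Strict Implicit.
Unset Printing Implicit Defensive.

(** * Lebesgue integrals of real functions *)

Section integration.
Context {R : realType}.
Notation mu := (@lebesgue_measure R).
Implicit Types f g h : R -> R.

(** Fourier transforms are tested on translated Gaussians only. Their transforms are explicit and
    they separate all functions integrable against every Gaussian, so uniqueness, inversion and the
    rules for derivatives and products reduce to Fubini and differentiation under the integral sign;
    neither Plancherel's theorem nor a density argument for test functions is involved. Complex data
    are carried as pairs of real functions. The obstacle is [K]. From eta' and the momentum
    identity, 4 |u|^2 K = eta'^2 + c^2 eta^2, but u may vanish when c = 0, so [K] cannot be
    eliminated by division and stays an unknown of its own. At first it is only known to be
    integrable, so that its transform is merely bounded and x^2 n <= C n + C'. As n is square
    integrable, this puts n in L^1 and |x| n in L^2. Only then can the transforms of eta g and eta'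
    g be written as convolutions, and a further factor x replaces the transform of [K] by that of
    eta' g. *)

Lemma ae_imp (P Q : R -> Prop) : (forall x, P x -> Q x) ->
  {ae mu, forall x, P x} -> {ae mu, forall x, Q x}.
Proof. by move=> PQ; apply: filterS => //; exact: (ae_filter_ringOfSetsType mu). Qed.

Lemma ae_and (P Q : R -> Prop) : {ae mu, forall x, P x} ->
  {ae mu, forall x, Q x} -> {ae mu, forall x, P x /\ Q x}.
Proof. by apply: filterS2 => //; exact: (ae_filter_ringOfSetsType mu). Qed.

(** Lebesgue measure is determined by its values on half-open intervals, so the preimage condition
    is asked only there. *)
Lemma ge0_integral_measure_preserving (phi : R -> R) (f : R -> \bar R) :
  measurable_fun [set: R] phi ->
  (forall X, ocitv X -> mu X = mu (phi @^-1` X)) ->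
  measurable_fun [set: R] f -> (forall x, 0 <= f x)%E ->
  (\int[mu]_x f (phi x) = \int[mu]_x f x)%E.
Proof.
move=> mphi phiE mf f0.
have := @ge0_integral_pushforward _ _ (measurableTypeR R) (measurableTypeR R) R phi mphi mu setT f measurableT mf.
rewrite preimage_setT => <- //.
apply: eq_measure_integral => A mA _.
exact/esym/lebesgue_measure_unique.
Qed.

Lemma lebesgue_measure_preserved_shift (a : R) (X : set R) :
  ocitv X -> mu X = mu ((fun x => x + a) @^-1` X).
Proof.
move=> /ocitvP[->|[[u v]/= uv ->]]; first by rewrite preimage_set0.
rewrite (_ : _ @^-1` _ = `](u - a), (v - a)]%classic); last first.
  by apply/seteqP; split => x /=; rewrite !in_itv/= => /andP[? ?]; apply/andP; split; lra.
rewrite !lebesgue_measure_itv/= !lte_fin ltrD2r uv -EFinB -EFinB; congr (_%:E); lra.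
Qed.

Lemma lebesgue_measure_preserved_opp (X : set R) :
  ocitv X -> mu X = mu ((fun x => - x) @^-1` X).
Proof.
move=> /ocitvP[->|[[u v]/= uv ->]]; first by rewrite preimage_set0.
rewrite (_ : _ @^-1` _ = `[- v, - u[%classic); last first.
  by apply/seteqP; split => x /=; rewrite !in_itv/= => /andP[? ?]; apply/andP; split; lra.
rewrite !lebesgue_measure_itv/= !lte_fin ltrN2 uv -EFinB -EFinB; congr (_%:E); lra.
Qed.

Lemma ge0_integral_shift (a : R) (f : R -> \bar R) :
  measurable_fun [set: R] f -> (forall x, 0 <= f x)%E ->
  (\int[mu]_x f (x + a)%R = \int[mu]_x f x)%E.
Proof.
apply: ge0_integral_measure_preserving; last exact: lebesgue_measure_preserved_shift.
exact: measurable_funD.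
Qed.

Lemma ge0_integral_opp (f : R -> \bar R) :
  measurable_fun [set: R] f -> (forall x, 0 <= f x)%E ->
  (\int[mu]_x f (- x)%R = \int[mu]_x f x)%E.
Proof.
apply: ge0_integral_measure_preserving; last exact: lebesgue_measure_preserved_opp.
exact: oppr_measurable.
Qed.

Definition L1 f : Prop := mu.-integrable [set: R] (EFin \o f).

Definition Int f : R := \int[mu]_x f x.

Lemma L1_measurable f : L1 f -> measurable_fun [set: R] f.
Proof. by move=> /integrableP[/measurable_EFinP]. Qed.

Lemma L1_le f g : measurable_fun [set: R] f -> (forall x, `|f x| <= g x) ->
  L1 g -> L1 f.
Proof.
move=> mf fg; apply: le_integrable => //=; first exact/measurable_EFinP.
by move=> x _; rewrite lee_fin (le_trans (fg x))// ler_norm.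
Qed.

Lemma L1_leae f g : measurable_fun [set: R] f ->
  {ae mu, forall x, `|f x| <= g x} -> L1 g -> L1 f.
Proof.
move=> mf fg /integrableP[mg ig]; apply/integrableP; split.
  exact/measurable_EFinP.
apply: le_lt_trans ig; apply: ae_ge0_le_integral => //=.
- by apply/measurable_EFinP; exact: measurableT_comp.
- apply/measurable_EFinP; apply: measurableT_comp => //.
  exact/measurable_EFinP.
- apply: ae_imp fg => x fgx _.
  by rewrite lee_fin (le_trans fgx)// ler_norm.
Qed.

Lemma L1_ae f g : measurable_fun [set: R] g -> {ae mu, forall x, f x = g x} ->
  L1 f -> L1 g.
Proof.
move=> mg fg lf; apply: (@L1_leae _ (fun x => `|f x|)) => //.
  by apply: ae_imp fg => x ->.
exact: (integrable_abse lf).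
Qed.

Lemma L1_abs f : L1 f -> L1 (fun x => `|f x|).
Proof. by move=> /integrable_abse. Qed.

Lemma L1D f g : L1 f -> L1 g -> L1 (fun x => f x + g x).
Proof. by move=> lf lg; exact: (integrableD measurableT lf lg). Qed.

Lemma L1B f g : L1 f -> L1 g -> L1 (fun x => f x - g x).
Proof. by move=> lf lg; exact: (integrableB measurableT lf lg). Qed.

Lemma L1Z (c : R) f : L1 f -> L1 (fun x => c * f x).
Proof. by move=> lf; exact: (integrableZl measurableT c lf). Qed.

Lemma L1N f : L1 f -> L1 (fun x => - f x).
Proof. by move=> /(L1Z (-1)); under eq_fun do rewrite mulN1r. Qed.

Lemma L1_bnd c f h : L1 f -> measurable_fun [set: R] h ->
  (forall x, `|h x| <= c) -> L1 (fun x => f x * h x).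
Proof.
move=> lf mh hc; apply: (@L1_le _ (fun x => c * `|f x|)).
- by apply: measurable_funM => //; exact: L1_measurable.
- by move=> x; rewrite normrM mulrC ler_wpM2r.
- exact/L1Z/L1_abs.
Qed.

Lemma IntD f g : L1 f -> L1 g -> Int (fun x => f x + g x) = Int f + Int g.
Proof. by move=> lf lg; rewrite /Int RintegralD. Qed.

Lemma IntB f g : L1 f -> L1 g -> Int (fun x => f x - g x) = Int f - Int g.
Proof. by move=> lf lg; rewrite /Int RintegralB. Qed.

Lemma IntZ (c : R) f : L1 f -> Int (fun x => c * f x) = c * Int f.
Proof. by move=> lf; rewrite /Int RintegralZl. Qed.

Lemma IntN f : L1 f -> Int (fun x => - f x) = - Int f.
Proof. by move=> lf; rewrite -[RHS]mulN1r -IntZ//; congr Int; apply/funext => x; rewrite mulN1r. Qed.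

Lemma Int0 : Int (fun=> 0) = 0.
Proof. by rewrite /Int /Rintegral integral0. Qed.

Lemma L1_0 : L1 (fun=> 0).
Proof. exact: integrable0. Qed.

Lemma Int_ge0 f : (forall x, 0 <= f x) -> 0 <= Int f.
Proof. by move=> f0; exact: Rintegral_ge0. Qed.

Lemma le_Int f g : L1 f -> L1 g -> (forall x, f x <= g x) -> Int f <= Int g.
Proof. by move=> lf lg fg; exact: le_Rintegral. Qed.

Lemma Int_abs f : L1 f -> `|Int f| <= Int (fun x => `|f x|).
Proof. by move=> lf; exact: le_normr_Rintegral. Qed.

Lemma Int_aem f g : measurable_fun [set: R] f -> measurable_fun [set: R] g ->
  {ae mu, forall x, f x = g x} -> Int f = Int g.
Proof.
move=> mf mg fg; congr fine; apply: ae_eq_integral => //.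
- exact/measurable_EFinP.
- exact/measurable_EFinP.
- by apply: ae_imp fg => x -> _.
Qed.

Lemma Int_ae f g : L1 f -> L1 g -> {ae mu, forall x, f x = g x} -> Int f = Int g.
Proof. by move=> /L1_measurable mf /L1_measurable mg; exact: Int_aem. Qed.

Lemma IntE f : L1 f -> (Int f)%:E = (\int[mu]_x (f x)%:E)%E.
Proof. by move=> lf; rewrite /Int /Rintegral fineK//; exact: integrable_fin_num. Qed.

Lemma L1_ge0 f : measurable_fun [set: R] f -> (forall x, 0 <= f x) ->
  (\int[mu]_x (f x)%:E < +oo)%E -> L1 f.
Proof.
move=> mf f0 fi; apply/integrableP; split; first exact/measurable_EFinP.
by under eq_integral do rewrite /= ger0_norm//.
Qed.

Lemma Int_shift a f : measurable_fun [set: R] f -> Int (fun x => f (x + a)) = Int f.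
Proof.
move=> /measurable_EFinP mf; rewrite /Int /Rintegral; congr fine.
rewrite [LHS]integralE [RHS]integralE; congr (_ - _)%E.
- rewrite -[RHS](@ge0_integral_shift a ((EFin \o f)^\+)%E)//; last exact: measurable_funepos.
  by apply: eq_integral => x _; rewrite !funeposE.
- rewrite -[RHS](@ge0_integral_shift a ((EFin \o f)^\-)%E)//; last exact: measurable_funeneg.
  by apply: eq_integral => x _; rewrite !funenegE.
Qed.

Lemma Int_opp f : measurable_fun [set: R] f -> Int (fun x => f (- x)) = Int f.
Proof.
move=> /measurable_EFinP mf; rewrite /Int /Rintegral; congr fine.
rewrite [LHS]integralE [RHS]integralE; congr (_ - _)%E.
- rewrite -[RHS](@ge0_integral_opp ((EFin \o f)^\+)%E)//; last exact: measurable_funepos.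
  by apply: eq_integral => x _; rewrite !funeposE.
- rewrite -[RHS](@ge0_integral_opp ((EFin \o f)^\-)%E)//; last exact: measurable_funeneg.
  by apply: eq_integral => x _; rewrite !funenegE.
Qed.

Lemma L1_shift a f : L1 f -> L1 (fun x => f (x + a)).
Proof.
move=> lf; have mf := L1_measurable lf; have /integrableP[_ fi] := lf.
apply/integrableP; split.
  by apply/measurable_EFinP/(measurableT_comp mf); exact: measurable_funD.
rewrite (@ge0_integral_shift a (fun x => `|(f x)%:E|)%E)//.
by apply/measurable_EFinP; exact: measurableT_comp.
Qed.

Lemma L1_opp f : L1 f -> L1 (fun x => f (- x)).
Proof.
move=> lf; have mf := L1_measurable lf; have /integrableP[_ fi] := lf.
apply/integrableP; split.
  by apply/measurable_EFinP/(measurableT_comp mf); exact: oppr_measurable.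
rewrite (@ge0_integral_opp (fun x => `|(f x)%:E|)%E)//.
by apply/measurable_EFinP; exact: measurableT_comp.
Qed.

Section fubini.
Context (F : R -> R -> R).
Hypothesis mF : measurable_fun [set: R * R] (fun z => F z.1 z.2).
Hypothesis iF : (\int[mu]_x \int[mu]_y `|F x y|%:E < +oo)%E.

Let intF : (mu \x mu)%E.-integrable [set: R * R] (EFin \o (fun z => F z.1 z.2)).
Proof.
apply/(integrable12ltyP mu mu) => //=; exact/measurable_EFinP.
Qed.

Let lF : {ae mu, forall x, L1 (F x)}.
Proof. by have := ae_integrable1 intF; apply: ae_imp. Qed.

Let mintF : measurable_fun [set: R] (fun x => \int[mu]_y (F x y)%:E)%E.
Proof. exact: (measurable_fubini_F intF). Qed.

(** [Int] of a non-integrable section is the default value [0]. Such sections form a null set, so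
    the comparison with the extended real iterated integral is made almost everywhere. *)
Lemma fubini_L1l : L1 (fun x => Int (F x)).
Proof.
have h := integrable_fubini_F intF.
have [mh ih] := integrableP _ _ _ h.
apply/integrableP; split.
  by apply/measurable_EFinP; apply: measurableT_comp mintF.
apply: le_lt_trans ih; apply: ae_ge0_le_integral => //=.
- apply/measurable_EFinP; apply: measurableT_comp => //.
  by apply: measurableT_comp mintF.
- by apply: measurableT_comp => //; exact: mh.
- by apply: ae_imp lF => x lx _; rewrite -abse_EFin IntE.
Qed.

Lemma fubini_IntE : (Int (fun x => Int (F x)))%:E = (\int[mu]_x \int[mu]_y (F x y)%:E)%E.
Proof.
rewrite IntE; last exact: fubini_L1l.
apply: ae_eq_integral => //.
- by apply/measurable_EFinP; apply: measurableT_comp mintF.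
- by apply: ae_imp lF => x lx _; rewrite IntE.
Qed.

End fubini.

Section fubini_swap.
Context (F : R -> R -> R).
Hypothesis mF : measurable_fun [set: R * R] (fun z => F z.1 z.2).
Hypothesis iF : (\int[mu]_x \int[mu]_y `|F x y|%:E < +oo)%E.

Let mF' : measurable_fun [set: R * R] (fun z => F z.2 z.1).
Proof. by have := measurableT_comp mF (@measurable_swap _ _ R R). Qed.

Let iF' : (\int[mu]_x \int[mu]_y `|F y x|%:E < +oo)%E.
Proof.
have /= := (integrable21ltyP mu mu (f := EFin \o (fun z => F z.1 z.2)) _).1; apply.
  exact/measurable_EFinP.
apply/(integrable12ltyP mu mu) => //=; exact/measurable_EFinP.
Qed.

Lemma fubini_L1r : L1 (fun y => Int (F ^~ y)).
Proof. exact: (@fubini_L1l (fun y x => F x y)). Qed.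

Lemma fubini_Int : Int (fun x => Int (F x)) = Int (fun y => Int (F ^~ y)).
Proof.
apply: EFin_inj; rewrite (fubini_IntE mF iF) (@fubini_IntE (fun y x => F x y) mF' iF').
have intF : (mu \x mu)%E.-integrable [set: R * R] (EFin \o (fun z => F z.1 z.2)).
  by apply/(integrable12ltyP mu mu) => //=; exact/measurable_EFinP.
by rewrite (Fubini intF).
Qed.

End fubini_swap.

(** Tonelli: the iterated norm is at most the product of two finite integrals. *)
Lemma fubini_dom (F : R -> R -> R) f g :
  measurable_fun [set: R * R] (fun z => F z.1 z.2) -> L1 f -> L1 g ->
  (forall x y, `|F x y| <= f x * g y) ->
  (\int[mu]_x \int[mu]_y `|F x y|%:E < +oo)%E.
Proof.
move=> mF lf lg Ffg.
have [mf ifo] := integrableP _ _ _ lf; have [mg igo] := integrableP _ _ _ lg.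
have mFx x : measurable_fun [set: R] (fun y => F x y).
  by have := measurableT_comp mF (measurable_pair1 x).
apply: (@le_lt_trans _ _ (\int[mu]_x (`|f x|%:E * \int[mu]_y `|g y|%:E))%E).
  apply: ge0_le_integral => //=.
  - by move=> x _; apply: integral_ge0 => y _; rewrite lee_fin.
  - have /= := @measurable_fun_fubini_tonelli_F _ _ _ _ R mu (fun z => `|F z.1 z.2|%:E)%E _.
    by apply => //; apply/measurable_EFinP; exact: measurableT_comp.
  - apply: emeasurable_funM => //; apply/measurable_EFinP.
    by apply: measurableT_comp => //; exact/measurable_EFinP.
  - move=> x _; rewrite -ge0_integralZl//.
    + apply: ge0_le_integral => //=.
      * by apply/measurable_EFinP; apply: measurableT_comp => //; exact: mFx.
      * apply/measurable_EFinP/measurable_funM => //.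
        by apply: measurableT_comp => //; exact/measurable_EFinP.
      * by move=> y _; rewrite lee_fin (le_trans (Ffg x y))// -normrM ler_norm.
    + by apply/measurable_EFinP; apply: measurableT_comp => //; exact/measurable_EFinP.
rewrite ge0_integralZr//.
- by rewrite lte_mul_pinfty// ?integral_ge0// ge0_fin_numE// integral_ge0.
- by apply/measurable_EFinP; apply: measurableT_comp => //; exact/measurable_EFinP.
- by apply: integral_ge0.
Qed.

End integration.

(** * Derivatives and bump functions *)

Section derivatives.
Context {R : realType}.
Implicit Types f g : R -> R.

Lemma der_eq f (x a b : R) : is_derive x 1 f a -> a = b -> is_derive x 1 f b.
Proof. by move=> ? <-. Qed.

Lemma der_cst (x c : R) : is_derive x 1 (fun=> c) 0.
Proof. exact: is_derive_cst. Qed.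

Lemma der_id (x : R) : is_derive x 1 (fun y => y) 1.
Proof. exact: is_derive_id. Qed.

Lemma derD f g (x a b : R) : is_derive x 1 f a -> is_derive x 1 g b ->
  is_derive x 1 (fun y => f y + g y) (a + b).
Proof. by move=> *; exact: is_deriveD. Qed.

Lemma derN f (x a : R) : is_derive x 1 f a -> is_derive x 1 (fun y => - f y) (- a).
Proof. by move=> *; exact: is_deriveN. Qed.

Lemma derB f g (x a b : R) : is_derive x 1 f a -> is_derive x 1 g b ->
  is_derive x 1 (fun y => f y - g y) (a - b).
Proof. by move=> *; exact: is_deriveB. Qed.

Lemma derM f g (x a b : R) : is_derive x 1 f a -> is_derive x 1 g b ->
  is_derive x 1 (fun y => f y * g y) (a * g x + f x * b).
Proof.
move=> df dg.
have h : is_derive x 1 (fun y => f y * g y) (f x *: b + g x *: a) := is_deriveM df dg.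
by apply: der_eq h _; rewrite /GRing.scale/=; ring.
Qed.

Lemma derZ (c : R) f (x a : R) : is_derive x 1 f a ->
  is_derive x 1 (fun y => c * f y) (c * a).
Proof. by move=> df; exact: is_deriveZ. Qed.

Lemma der_comp f g (x a b : R) : is_derive (g x) 1 f a -> is_derive x 1 g b ->
  is_derive x 1 (fun y => f (g y)) (a * b).
Proof. by move=> *; exact: is_derive1_comp. Qed.

Lemma der_aff f (c d x a : R) : is_derive (c * x + d) 1 f a ->
  is_derive x 1 (fun y => f (c * y + d)) (a * c).
Proof.
move=> df.
apply: (der_eq (@der_comp f (fun y => c * y + d) x _ _ df
  (derD (derZ c (der_id x)) (der_cst x d)))).
by rewrite mulr1 addr0.
Qed.

Lemma der_horner (p : {poly R}) (x : R) : is_derive x 1 (horner p) (p^`()).[x].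
Proof.
elim/poly_ind: p x => [|p c ih] x.
  apply: (@near_eq_is_derive _ _ _ (fun=> 0)); first by near=> y; rewrite horner0.
  by rewrite deriv0 horner0; exact: der_cst.
apply: (@near_eq_is_derive _ _ _ (fun y => p.[y] * y + c)).
  by near=> y; rewrite hornerMXaddC.
apply: (der_eq (derD (derM (ih x) (der_id x)) (der_cst x c))).
by rewrite derivD derivC derivM derivX mulr1 !hornerE.
Unshelve. all: by end_near. Qed.

Lemma der_derivable f (x a : R) : is_derive x 1 f a -> derivable f x 1.
Proof. by case. Qed.

Lemma der_val f (x a : R) : is_derive x 1 f a -> f^`()%classic x = a.
Proof. by move=> h; rewrite derive1E; exact: derive_val. Qed.

Lemma derivative_continuous f (df : R -> R) :
  (forall x : R, is_derive x 1 f (df x)) -> continuous f.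
Proof.
by move=> h x; apply/differentiable_continuous/derivable1_diffP; have [] := h x.
Qed.

Lemma continuous_measurable f : continuous f -> measurable_fun [set: R] f.
Proof. by move=> cf; exact: continuous_measurable_fun. Qed.

(** Handles the gluing point of [flat P], where the rules of calculus on either side say nothing. *)
Lemma der0_quadratic f (C : R) : (forall x, `|f x| <= C * x ^+ 2) ->
  is_derive (0 : R) 1 f 0.
Proof.
move=> fC; have f0 : f 0 = 0.
  by apply/eqP; rewrite -normr_le0 (le_trans (fC 0))// expr0n/= mulr0.
have lim0 : h^-1 *: (f (h *: 1 + 0) - f 0) @[h --> 0^'] --> (0 : R).
  apply/cvgrPdist_le => e e0.
  have C0 : 0 <= C.
    by have := le_trans (normr_ge0 _) (fC 1); rewrite expr1n mulr1.
  near=> h; rewrite f0 subr0 sub0r normrN addr0 /GRing.scale/= mulr1 normrM.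
  have h0 : h != 0 by near: h; exact: nbhs_dnbhs_neq.
  rewrite normfV ler_pdivrMl ?normr_gt0//.
  apply: (le_trans (fC h)); rewrite -real_normK ?num_real// expr2 mulrCA.
  rewrite ler_wpM2l//.
  apply: (@le_trans _ _ ((C + 1) * `|h|)); first by rewrite ler_wpM2r// lerDl.
  rewrite mulrC -ler_pdivlMr ?ltr_wpDl//.
  by near: h; apply: dnbhs0_le; rewrite divr_gt0// ltr_wpDl.
apply: DeriveDef; first by apply/cvg_ex; exists 0.
by rewrite /derive; apply/cvg_lim.
Unshelve. all: by end_near. Qed.

End derivatives.

Section bump.
Context {R : realType}.
Implicit Types (P : {poly R}) (f g : R -> R).

(** These functions form a family closed under differentiation, so that a single computation makes
    all of them infinitely derivable. *)
Definition flat P (x : R) : R :=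
  if 0 < x then P.[x^-1] * expR (- x^-1) else 0.

Lemma exprn_le_expR n (t : R) : 0 <= t -> t ^+ n <= n`!%:R * expR t.
Proof.
move=> t0; case: n => [|n].
  by rewrite expr0 fact0 mul1r -expR0 ler_expR.
rewrite -ler_pdivrMl ?ltr0n ?fact_gt0//; apply: le_trans (expR_ge1Dxn n t0).
by rewrite mulrC lerDr.
Qed.

Lemma exp_dominates_poly P :
  exists2 C : R, 0 <= C & forall t, 0 <= t -> `|P.[t]| <= C * expR t.
Proof.
exists (\sum_(i < size P) `|P`_i| * i`!%:R).
  by apply: sumr_ge0 => i _; rewrite mulr_ge0.
move=> t t0; rewrite horner_coef mulr_suml.
apply: (le_trans (ler_norm_sum _ _ _)); apply: ler_sum => i _.
by rewrite normrM -mulrA ler_wpM2l// ger0_norm ?exprn_ge0// exprn_le_expR.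
Qed.

(** With t = 1/x this is the domination of the polynomial t^2 P(t) by e^t. *)
Lemma flat_quadratic P : exists C : R, forall x, `|flat P x| <= C * x ^+ 2.
Proof.
have [C C0 hC] := exp_dominates_poly ('X^2 * P); exists C => x; rewrite /flat.
case: ifPn => x0; last by rewrite normr0 mulr_ge0// sqr_ge0.
have := hC x^-1; rewrite invr_ge0 (ltW x0) => /(_ isT).
rewrite hornerM hornerXn normrM (ger0_norm (sqr_ge0 _)) exprVn => h.
rewrite normrM (ger0_norm (expR_ge0 _)) expRN ler_pdivrMr ?expR_gt0//.
by rewrite mulrAC mulrC -ler_pdivrMl ?exprn_gt0.
Qed.

Lemma flat_der P (x : R) :
  is_derive x 1 (flat P) (flat ('X^2 * (P - P^`())) x).
Proof.
have [x0|x0|->] := ltgtP x 0.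
- rewrite {2}/flat ltNge (ltW x0)/=.
  apply: (near_eq_is_derive _ (der_cst x 0)).
  near=> y; rewrite /flat ltNge ltW//.
  by near: y; exact: lt_nbhsl.
- have dV : is_derive x 1 (fun y : R => y^-1) (- x ^- 2).
    have h : is_derive x 1 (fun y : R => y^-1) (- x ^- 2 *: 1).
      by apply: (@is_deriveV _ id); rewrite gt_eqF.
    by apply: (der_eq h); rewrite /GRing.scale/= mulr1.
  have h := derM (@der_comp _ (horner P) (fun y => y^-1) x _ _ (der_horner P x^-1) dV)
      (@der_comp _ expR (fun y => - y^-1) x _ _ (is_derive_expR (- x^-1)) (derN dV)).
  apply: (der_eq (near_eq_is_derive _ h)).
    near=> y; rewrite /flat ifT//.
    by near: y; exact: lt_nbhsr.
  rewrite /flat x0 !hornerE/=; field.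
  by rewrite gt_eqF.
- have [C hC] := flat_quadratic P.
  by rewrite {2}/flat ltxx; exact: der0_quadratic hC.
Unshelve. all: by end_near. Qed.

(* Just rich enough to contain e^(-1/x), the bumps built from it and their
   primitives, while being stable under differentiation. *)
Inductive infinitely_derivable : (R -> R) -> Prop :=
| infder_flat P : infinitely_derivable (flat P)
| infder_cst c : infinitely_derivable (fun=> c)
| infder_sub f g : infinitely_derivable f -> infinitely_derivable g ->
    infinitely_derivable (fun x => f x - g x)
| infder_mul f g : infinitely_derivable f -> infinitely_derivable g ->
    infinitely_derivable (fun x => f x * g x)
| infder_aff f c d : infinitely_derivable f ->
    infinitely_derivable (fun x => f (c * x + d))
| infder_prim F f : infinitely_derivable f ->
    (forall x : R, is_derive x 1 F (f x)) -> infinitely_derivable F.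

Lemma infder_der f : infinitely_derivable f ->
  exists2 g, infinitely_derivable g & forall x : R, is_derive x 1 f (g x).
Proof.
elim=> {f}.
- by move=> P; exists (flat ('X^2 * (P - P^`()))); [exact: infder_flat|exact: flat_der].
- by move=> c; exists (fun=> 0); [exact: infder_cst|move=> x; exact: der_cst].
- move=> f g _ [f' If' df] _ [g' Ig' dg]; exists (fun x => f' x - g' x).
    exact: infder_sub.
  by move=> x; exact: derB.
- move=> f g If [f' If' df] Ig [g' Ig' dg].
  (* The family has differences but no sums, hence the double sign in Leibniz's rule. *)
  exists (fun x => f' x * g x - (0 - f x) * g' x).
    apply: infder_sub; apply: infder_mul => //.
    by apply: infder_sub => //; exact: infder_cst.
  by move=> x; apply: (der_eq (derM (df x) (dg x))); ring.
- move=> f c d If [f' If' df]; exists (fun x => f' (c * x + d) * c).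
    by apply: infder_mul; [exact: infder_aff|exact: infder_cst].
  by move=> x; exact: der_aff.
- by move=> F f If _ dF; exists f.
Qed.

Lemma infder_derive1n n f : infinitely_derivable f ->
  infinitely_derivable (derive1n n f).
Proof.
move=> If; elim: n => [|n /infder_der[g Ig dg]]; first by rewrite derive1n0.
rewrite derive1nS (_ : derive1 _ = g)//.
by apply/funext => x; exact: der_val.
Qed.

Lemma infder_continuous f : infinitely_derivable f -> continuous f.
Proof. by move=> /infder_der[g _ dg]; exact: derivative_continuous dg. Qed.

Lemma infder_derivable f x : infinitely_derivable f -> derivable f x 1.
Proof. by move=> /infder_der[g _ dg]; exact: der_derivable. Qed.

Lemma infder_test f (a b : R) : infinitely_derivable f ->
  (forall x, f x != 0 -> a <= x <= b) ->
  test_function (fun x => (f x)%:C).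
Proof.
move=> If fab; split.
  move=> n x; split.
    exact/infder_derivable/infder_derive1n.
  by apply/infder_derivable/infder_derive1n; exact: infder_cst.
apply: (@subclosed_compact _ _ `[a, b]%classic).
- exact: closed_closure.
- exact: segment_compact.
- rewrite [X in _ `<=` X](closure_id _).1; last exact: itv_closed.
  apply: closure_subset => x /= fx; rewrite in_itv/=; apply: fab.
  by apply: contra_neq fx => ->.
Qed.

End bump.

(** * Absolutely continuous functions *)

Section local_integrability.
Context {R : realType}.
Notation mu := (@lebesgue_measure R).
Implicit Types f g h : R -> R.

(** The indicator is kept inside the integrand so that every integral is over the whole line;
    half-open intervals make adjacent integrals add up exactly. *)
Definition Lloc f : Prop := measurable_fun [set: R] f /\
  forall a b, L1 (fun x => f x * \1_(`]a, b]%classic : set R) x).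

Definition II (a b : R) f : R := Int (fun x => f x * \1_(`]a, b]%classic : set R) x).

Lemma indic_itv_le1 (a b x : R) : `|\1_(`]a, b]%classic : set R) x| <= 1 :> R.
Proof. by rewrite indicE; case: (_ \in _); rewrite ?normr1 ?normr0. Qed.

Lemma indic_itvE (a b x : R) :
  \1_(`]a, b]%classic : set R) x = (a < x <= b)%R%:R :> R.
Proof. by rewrite indicE; congr (nat_of_bool _)%:R; apply/idP/idP; rewrite inE/= in_itv/=. Qed.

Lemma L1_indic_itv (a b : R) : L1 (\1_(`]a, b]%classic : set R)).
Proof.
apply: L1_ge0 => //.
rewrite integral_indic//= setIT lebesgue_measure_itv/=.
by case: ifP => // _; rewrite -EFinB ltry.
Qed.

Lemma Int_indic_itv (a b : R) : a <= b -> Int (\1_(`]a, b]%classic : set R)) = b - a.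
Proof.
move=> ab; rewrite /Int /Rintegral integral_indic//= setIT lebesgue_measure_itv/= lte_fin.
case: ltP => //= ba; have -> : a = b by apply/le_anti; rewrite ab.
by rewrite subrr.
Qed.

Lemma L1_Lloc f : L1 f -> Lloc f.
Proof.
move=> lf; split; first exact: L1_measurable.
by move=> a b; apply: (@L1_bnd _ 1) => // x; exact: indic_itv_le1.
Qed.

Lemma Lloc_dom f g : measurable_fun [set: R] f -> Lloc g ->
  (forall x, `|f x| <= g x) -> Lloc f.
Proof.
move=> mf [mg lg] fg; split => // a b.
apply: (L1_le _ _ (lg a b)); first by apply: measurable_funM.
move=> x; rewrite normrM [leLHS]mulrC [leRHS]mulrC.
by rewrite ger0_norm ?indicE// ler_wpM2l.
Qed.

Lemma LlocD f g : Lloc f -> Lloc g -> Lloc (fun x => f x + g x).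
Proof.
move=> [mf lf] [mg lg]; split; first exact: measurable_funD.
by move=> a b; under eq_fun do rewrite mulrDl; exact: L1D.
Qed.

Lemma LlocB f g : Lloc f -> Lloc g -> Lloc (fun x => f x - g x).
Proof.
move=> [mf lf] [mg lg]; split; first exact: measurable_funB.
by move=> a b; under eq_fun do rewrite mulrBl; exact: L1B.
Qed.

Lemma LlocZ (c : R) f : Lloc f -> Lloc (fun x => c * f x).
Proof.
move=> [mf lf]; split; first exact: measurable_funM.
by move=> a b; under eq_fun do rewrite -mulrA; exact: L1Z.
Qed.

Lemma Lloc_abs f : Lloc f -> Lloc (fun x => `|f x|).
Proof.
move=> [mf lf]; split; first exact: measurableT_comp.
move=> a b; have := L1_abs (lf a b); congr L1; apply/funext => x.
by rewrite normrM; congr (_ * _); rewrite ger0_norm// indicE.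
Qed.

Lemma Lloc_cst (c : R) : Lloc (fun=> c).
Proof. by split => // a b; exact/L1Z/L1_indic_itv. Qed.

Lemma Lloc_continuous f : continuous f -> Lloc f.
Proof.
move=> cf; have mf := continuous_measurable cf; split => // a b.
have : mu.-integrable (`[a, b]%classic : set R) (EFin \o f).
  apply: continuous_compact_integrable; first exact: segment_compact.
  exact: continuous_subspaceT.
move=> ih; have : mu.-integrable (`]a, b]%classic : set R) (EFin \o f).
  by apply: integrableS ih => //; exact: subset_itv_oc_cc.
move=> /integrable_mkcond; rewrite restrict_EFin => /(_ (measurable_itv _)).
suff -> : (fun x => f x * \1_(`]a, b]%classic : set R) x) = f \_ `]a, b]%classic by [].
by apply/funext => x; rewrite patchE indicE; case: ifPn => _; rewrite ?mulr1 ?mulr0.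
Qed.

Lemma locally_integrable_Lloc f : locally_integrable [set: R] f -> Lloc f.
Proof.
move=> [mf _ fK]; split => // a b.
apply: (@L1_leae _ _ (fun x => `|f x * \1_(`[a, b]%classic : set R) x|)).
- exact: measurable_funM.
- apply: aeW => x; rewrite !normrM ler_wpM2l// !indicE.
  case: (x \in `]a, b]%classic) / boolP => [|_]; last by rewrite normr0.
  by rewrite !inE => /= /subset_itv_oc_cc xab; rewrite mem_set.
- apply: L1_abs; apply/integrableP; split.
    by apply/measurable_EFinP; exact: measurable_funM.
  have := fK `[a, b]%classic (@subsetT _ _) (@segment_compact _ _ _).
  rewrite integral_mkcond; congr (_ < _)%E; apply: eq_integral => x _.
  rewrite patchE/= normrM indicE.
  by case: (x \in _); rewrite ?normr1 ?normr0 ?mulr1 ?mulr0.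
Qed.

Lemma Lloc_locally_integrable f : Lloc f -> locally_integrable [set: R] f.
Proof.
move=> [mf fab]; split => //; first exact: openT.
move=> K _ cK; have [M [_ KM]] := compact_bounded cK.
have /integrableP[_] := fab (- (M + 1) - 1) (M + 1).
apply: le_lt_trans; rewrite [leLHS]integral_mkcond.
apply: ge0_le_integral => //.
- by move=> x _; rewrite patchE; case: ifP.
- apply: (measurable_restrictT _ _).1 => //.
    exact: compact_measurable.
  by apply/measurable_EFinP; apply: measurable_funTS; exact: measurableT_comp.
- apply/measurable_EFinP; apply: measurableT_comp => //; exact: measurable_funM.
move=> x _; rewrite patchE; case: ifPn => [/set_mem Kx|_]; last exact: abse_ge0.
rewrite /= lee_fin normrM indic_itvE.
have /= := KM (M + 1) _ x Kx; rewrite ltrDl ltr01 => /(_ isT).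
rewrite ler_norml => /andP[h1 h2].
by rewrite (_ : _ < _ <= _) ?normr1 ?mulr1//; apply/andP; split; lra.
Qed.

Lemma dominated_convergence_Int_ae (f_ : nat -> R -> R) f g :
  (forall n, measurable_fun [set: R] (f_ n)) -> measurable_fun [set: R] f -> L1 g ->
  (forall n x, `|f_ n x| <= g x) ->
  {ae mu, forall x, f_ n x @[n --> \oo] --> f x} ->
  L1 f /\ Int (f_ n) @[n --> \oo] --> Int f.
Proof.
move=> mf_ mf lg fg cf.
have mf' : measurable_fun [set: R] (EFin \o f) by exact/measurable_EFinP.
have mf_' n : measurable_fun [set: R] (EFin \o f_ n).
  by apply/measurable_EFinP; exact: (mf_ n).
have cf' : {ae mu, forall x, setT x -> (EFin \o f_ n) x @[n --> \oo] --> (EFin \o f) x}.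
  by apply: ae_imp cf => x cfx _; apply: cvg_EFin; [exact: nearW|exact: cfx].
have fg' : {ae mu, forall x, forall n, setT x -> (`|(EFin \o f_ n) x| <= (EFin \o g) x)%E}.
  by apply: aeW => x n _; rewrite lee_fin.
have [] := @dominated_convergence _ (measurableTypeR R) R mu setT measurableT (fun n => EFin \o f_ n) _ _ mf_' mf' cf' lg fg'.
move=> lf _ cI; split => //; rewrite /Int /Rintegral.
by apply: fine_cvg; rewrite fineK//; exact: integrable_fin_num.
Qed.

Lemma dominated_convergence_Int (f_ : nat -> R -> R) f g :
  (forall n, measurable_fun [set: R] (f_ n)) -> L1 g ->
  (forall n x, `|f_ n x| <= g x) ->
  (forall x, f_ n x @[n --> \oo] --> f x) ->
  L1 f /\ Int (f_ n) @[n --> \oo] --> Int f.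
Proof.
move=> mf_ lg fg cf; apply: (dominated_convergence_Int_ae (g := g)) => //; last exact: aeW.
by apply: (measurable_fun_cvg (h := f_)) => // x _; exact: cf.
Qed.

End local_integrability.

(** * Approximate identities at Lebesgue points *)

Section lebesgue_points.
Context {R : realType}.
Notation mu := (@lebesgue_measure R).
Implicit Types f g h : R -> R.

Lemma lebesgue_pt_ball f (x e : R) : lebesgue_pt f x -> 0 < e ->
  exists2 d, 0 < d & forall r, 0 < r -> r < d ->
    (\int[mu]_(y in ball x r) `|f y - f x|%:E <= (e * (2 * r))%:E)%E.
Proof.
move=> fx e0.
have : \forall r \near (0:R)^'+, (davg f x r < e%:E)%E.
  apply: (fx [set y | (y < e%:E)%E]).
  by have := @nbhs_open_ereal_lt R 0 (fun z => z + e); rewrite add0r => /(_ e0).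
move=> [d /= d0 dd]; exists d => // r r0 rd.
have := dd r; rewrite /= sub0r normrN gtr0_norm// => /(_ rd r0).
rewrite /davg /iavg (lebesgue_measure_ball _ (ltW r0)) => /ltW.
rewrite inver mulrn_eq0/= gt_eqF// muleC lee_pdivrMr ?mulrn_wgt0//.
by rewrite -EFinM -[r *+ 2]mulr_natl.
Qed.

(** The kernels need not be positive or symmetric: by unit mass, height and support, the error is at
    most M (n + 1) times the integral of |f - f x| over the ball of radius 1/(n + 1), which is small
    at a Lebesgue point. *)
Lemma lebesgue_pt_kernel f (x M : R) (k_ : nat -> R -> R) :
  lebesgue_pt f x -> Lloc f -> 0 <= M ->
  (forall n, measurable_fun [set: R] (k_ n)) ->
  (forall n y, `|k_ n y| <= M * n.+1%:R) ->
  (forall n y, k_ n y != 0 -> `|y - x| < n.+1%:R^-1) ->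
  (forall n, Int (k_ n) = 1) ->
  Int (fun y => f y * k_ n y) @[n --> \oo] --> f x.
Proof.
move=> fx lf M0 mk kM kx k1.
have supp n y : k_ n y = k_ n y * \1_(`](x - n.+1%:R^-1), (x + n.+1%:R^-1)]%classic : set R) y.
  rewrite indic_itvE; have [->|/kx] := eqVneq (k_ n y) 0; first by rewrite mul0r.
  move: (n.+1%:R^-1) => r; rewrite ltr_norml => /andP[h1 h2].
  by rewrite (_ : _ < _ <= _) ?mulr1//; apply/andP; split; lra.
have lk n : L1 (k_ n).
  apply: (L1_le (mk n) _ (L1Z (M * n.+1%:R) (L1_indic_itv (x - n.+1%:R^-1) (x + n.+1%:R^-1)))).
  by move=> y; rewrite supp normrM [leLHS]mulrC [leRHS]mulrC ger0_norm ?indicE// ler_wpM2l.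
have [mf lfab] := lf.
have lfk n : L1 (fun y => f y * k_ n y).
  have := L1Z (M * n.+1%:R) (L1_abs (lfab (x - n.+1%:R^-1) (x + n.+1%:R^-1))).
  apply: L1_le; first by apply: measurable_funM; [|exact: mk].
  move=> y; rewrite supp mulrA mulrAC normrM mulrC; exact: ler_wpM2r.
apply/cvgrPdist_le => e e0.
(* A ball of radius r = 1/(n + 1) has length 2 r and the kernel has height M / r, so the error is
   multiplied by 2 M; the added 1 covers M = 0. *)
have e'0 : 0 < e / (2 * M + 1) by rewrite divr_gt0// ltr_wpDl// mulr_ge0.
have [d d0 hd] := lebesgue_pt_ball fx e'0.
suff key n : n.+1%:R^-1 < d -> `|f x - Int (fun y => f y * k_ n y)| <= e.
  by have := near_infty_natSinv_lt (PosNum d0); apply: filterS => n; exact: key.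
move=> rd; have r0 : 0 < n.+1%:R^-1 :> R by rewrite invr_gt0.
rewrite distrC -[f x]mulr1 -(k1 n) -IntZ// -IntB//; last exact: L1Z.
have fxkE : (fun y => f y * k_ n y - f x * k_ n y) = (fun y => (f y - f x) * k_ n y).
  by apply/funext => y; rewrite mulrBl.
have lfxk : L1 (fun y => (f y - f x) * k_ n y).
  by rewrite -fxkE; apply: L1B => //; exact: L1Z.
rewrite fxkE.
apply: (le_trans (Int_abs lfxk)); rewrite -lee_fin IntE; last exact: L1_abs.
apply: (@le_trans _ _ (\int[mu]_(y in ball x n.+1%:R^-1) (`|f y - f x|%:E * (M * n.+1%:R)%:E))%E).
  rewrite [leRHS]integral_mkcond; apply: ge0_le_integral => //.
  - have m1 : measurable_fun [set: R] (fun y => (f y - f x) * k_ n y) by exact: L1_measurable.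
    by apply/measurable_EFinP; apply: measurableT_comp.
  - apply: (measurable_restrictT _ _).1 => //; first exact: measurable_ball.
    apply/measurable_EFinP; apply: measurable_funTS; apply: measurable_funM => //.
    by apply: measurableT_comp => //; exact: measurable_funB.
  - move=> y _; rewrite patchE; case: ifPn => [_|/negP h].
      by rewrite -EFinM lee_fin normrM ler_wpM2l.
    have [->|/kx kn] := eqVneq (k_ n y) 0; first by rewrite mulr0 normr0.
    by exfalso; apply: h; rewrite inE /ball/= distrC.
rewrite ge0_integralZr//=; last 2 first.
- apply/measurable_EFinP; apply: measurable_funTS.
  by apply: measurableT_comp => //; exact: measurable_funB.
- by rewrite lee_fin mulr_ge0.
apply: le_trans.
  by apply: lee_wpmul2r; [rewrite lee_fin mulr_ge0|exact: hd].
rewrite -EFinM lee_fin.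
have N0 : n.+1%:R != 0 :> R by rewrite pnatr_eq0.
have M1 : 2 * M + 1 != 0 by rewrite gt_eqF// ltr_wpDl// mulr_ge0.
have -> : e / (2 * M + 1) * (2 * n.+1%:R^-1) * (M * n.+1%:R) = e * (2 * M) / (2 * M + 1).
  by move: (n.+1%:R : R) N0 => N N0; field; rewrite N0 M1.
rewrite ler_pdivrMr; last by rewrite ltr_wpDl// mulr_ge0.
by rewrite ler_pM2l// lerDl.
Unshelve. exact: measurable_ball.
Qed.

(** Normalized indicators of intervals shrinking to a Lebesgue point form an admissible kernel, and
    all their integrals against [f] vanish. *)
Lemma ae0_of_itv f : Lloc f -> (forall a b, a <= b -> II a b f = 0) ->
  {ae mu, forall x, f x = 0}.
Proof.
move=> lf f0; have := lebesgue_differentiation (Lloc_locally_integrable lf).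
apply: ae_imp => x fx.
pose k (n : nat) (y : R) : R := n.+1%:R * \1_(`](x - (n.+1%:R^-1) / 2), (x + n.+1%:R^-1 / 2)]%classic : set R) y.
have r0 n : 0 < n.+1%:R^-1 :> R by rewrite invr_gt0.
have : Int (fun y => f y * k n y) @[n --> \oo] --> f x.
  apply: (lebesgue_pt_kernel (M := 1)) => //.
  - by move=> n; apply: measurable_funM.
  - move=> n y; rewrite /k normrM mul1r normr_nat; apply: ler_piMr => //.
    exact: indic_itv_le1.
  - move=> n y; rewrite /k indic_itvE; case: (boolP (_ < _ <= _)) => [|_]; last by rewrite mulr0 eqxx.
    move: (n.+1%:R^-1) (r0 n) => r r_gt0.
    by move=> /andP[h1 h2] _; rewrite ltr_norml; apply/andP; split; lra.
  - move=> n; rewrite IntZ; last exact: L1_indic_itv.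
    rewrite Int_indic_itv; last by move: (r0 n); move: (n.+1%:R^-1) => r; lra.
    have N0 : n.+1%:R != 0 :> R by rewrite pnatr_eq0.
    by move: (n.+1%:R : R) N0 => N N0; field; rewrite N0.
rewrite (_ : (fun n => _) = (fun=> 0)).
  by move=> h; apply/esym; apply: (cvg_unique _ _ h); [exact: Rhausdorff|exact: cvg_cst].
apply/funext => n; rewrite /k.
under eq_fun do rewrite mulrCA.
rewrite IntZ; last by have [_] := lf; exact.
rewrite [Int _]f0 ?mulr0//; by move: (r0 n); move: (n.+1%:R^-1) => r; lra.
Qed.

End lebesgue_points.

(** * A smooth step with compactly supported derivative *)

Section smooth_step.
Context {R : realType}.
Notation mu := (@lebesgue_measure R).
Implicit Types f g h : R -> R.

Lemma flat1E (x : R) : flat 1 x = if 0 < x then expR (- x^-1) else 0.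
Proof. by rewrite /flat; case: ifP => // _; rewrite hornerC mul1r. Qed.

Lemma flat1_ge0 (x : R) : 0 <= flat 1 x.
Proof. by rewrite flat1E; case: ifP => // _; exact: expR_ge0. Qed.

Lemma flat1_le1 (x : R) : flat 1 x <= 1.
Proof.
rewrite flat1E; case: ifP => // x0.
by rewrite -expR0 ler_expR oppr_le0 invr_ge0 ltW.
Qed.

(** Rescaled, [b] becomes an approximate identity sitting just to the right of a point and [theta]
    an approximation of the indicator of a half-line; together they produce the test functions of
    the du Bois-Reymond lemma. *)
Lemma smooth_step : exists (b theta : R -> R) (M : R),
  [/\ infinitely_derivable b, infinitely_derivable theta,
      forall x : R, is_derive x 1 theta (b x), 0 <= M &
   [/\ forall x, `|b x| <= M, forall x, b x != 0 -> 0 < x < 1 & Int b = 1] /\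
   [/\ forall x, x <= 0 -> theta x = 0, forall x, 1 <= x -> theta x = 1 &
       forall x, 0 <= theta x <= 1]].
Proof.
pose b0 (x : R) := flat 1 x * flat 1 (- 1 * x + 1).
have b0_inf : infinitely_derivable b0.
  apply: infder_mul; first exact: infder_flat.
  by apply: infder_aff; exact: infder_flat.
have b0_ge0 x : 0 <= b0 x by rewrite mulr_ge0// flat1_ge0.
have b0_le1 x : b0 x <= 1 by rewrite mulr_ile1 ?flat1_ge0 ?flat1_le1.
have b0_supp x : b0 x != 0 -> 0 < x < 1.
  rewrite /b0 !flat1E; case: ifPn => [x0|_]; last by rewrite mul0r eqxx.
  case: ifPn => [x1 _|_]; last by rewrite mulr0 eqxx.
  by have -> : x < 1 by lra.
have mb0 : measurable_fun [set: R] b0.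
  exact: (continuous_measurable (infder_continuous b0_inf)).
have lb0 : L1 b0.
  apply: (L1_le mb0 _ (L1_indic_itv 0 1)) => x; rewrite ger0_norm// indic_itvE.
  have [->|/b0_supp /andP[x0 /ltW x1]] := eqVneq (b0 x) 0; first by rewrite ler0n.
  by rewrite x0 x1/=.
have I0 : 0 < Int b0.
  (* On ]1/4, 3/4] both x and 1 - x are at least 1/4, so each factor of [b0] is at least e^(-4). *)
  pose c : R := expR (- 4) * expR (- 4).
  apply: (@lt_le_trans _ _ (Int (fun x => c * \1_(`](4^-1), (3 / 4)]%classic : set R) x))).
    rewrite IntZ; last exact: L1_indic_itv.
    rewrite Int_indic_itv; last lra.
    by rewrite mulr_gt0// ?mulr_gt0 ?expR_gt0//; lra.
  apply: le_Int => //; first exact/L1Z/L1_indic_itv.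
  move=> x; rewrite indic_itvE; case: (boolP (_ < _ <= _)) => [/andP[x1 x2]|_]; last first.
    by rewrite mulr0.
  rewrite mulr1 /b0 !flat1E; have -> : 0 < x by lra.
  have -> : 0 < - 1 * x + 1 by lra.
  apply: ler_pM; rewrite ?expR_ge0// ler_expR lerN2.
    rewrite -[leRHS]invrK lef_pV2 ?posrE ?invr_gt0//; lra.
  rewrite -[leRHS]invrK lef_pV2 ?posrE ?invr_gt0//; lra.
pose b x := (Int b0)^-1 * b0 x.
have b_inf : infinitely_derivable b.
  by apply: infder_mul => //; exact: infder_cst.
have lb : L1 b by exact: L1Z.
have b_ge0 x : 0 <= b x by rewrite mulr_ge0// invr_ge0 ltW.
have b_supp x : b x != 0 -> 0 < x < 1.
  by move=> bx; apply: b0_supp; apply: contra_neq bx; rewrite /b => ->; rewrite mulr0.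
have Ib : Int b = 1 by rewrite IntZ// mulVf// gt_eqF.
pose theta (x : R) := \int[mu]_(t in `]-oo, x]) b t.
have thetaE x : theta x = Int (b \_ `]-oo, x]) by rewrite /theta Rintegral_mkcond.
have lbr x : L1 (b \_ `]-oo, x]).
  rewrite /L1 -restrict_EFin; apply: (@integrable_mkcond _ _ _ mu `]-oo, x]%classic (EFin \o b) _).1 => //.
  exact: (@integrableS _ _ _ mu setT _ (EFin \o b)).
have dtheta (x : R) : is_derive x 1 theta (b x).
  have ib : mu.-integrable `]-oo, (x + 1)] (EFin \o b).
    exact: (@integrableS _ _ _ mu setT _ (EFin \o b)).
  have xx1 : x < x + 1 by rewrite ltrDl.
  have [dt <-] := continuous_FTC1 xx1 ib (ltNyr x) (@infder_continuous _ _ b_inf x).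
  by rewrite derive1E; exact: DeriveDef.
exists b, theta, (Int b0)^-1; split => //.
- exact: infder_prim dtheta.
- by rewrite invr_ge0 ltW.
- split; split => //.
  + by move=> x; rewrite ger0_norm// ler_piMr// invr_ge0 ltW.
  + move=> x x0; rewrite thetaE (_ : _ \_ _ = fun=> 0) ?Int0//.
    apply/funext => t; rewrite patchE; case: ifPn => // /set_mem/=.
    rewrite in_itv/= => tx; apply/eqP; apply/negPn/negP => /b_supp/andP[t0 _]; lra.
  + move=> x x1; rewrite thetaE (_ : _ \_ _ = b)//.
    apply/funext => t; rewrite patchE; case: ifPn => // /negP h.
    apply/esym/eqP; apply/negPn/negP => /b_supp/andP[_ t1]; apply: h; rewrite inE/= in_itv/=.
    by lra.
  + move=> x; rewrite thetaE; apply/andP; split.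
      by apply: Int_ge0 => t; rewrite patchE; case: ifP.
    by rewrite -Ib; apply: le_Int => // t; rewrite patchE; case: ifP.
Qed.

End smooth_step.

(** * Primitives and the du Bois-Reymond lemma *)

Section primitives.
Context {R : realType}.
Notation mu := (@lebesgue_measure R).
Implicit Types f g h F G : R -> R.

(** Integral form of F' = f. The density [f] matters only up to null sets, whereas [F] is a genuine
    pointwise function; this is how weak derivatives are handled from here on. *)
Definition AC F f : Prop := Lloc f /\ forall a b, a <= b -> F b - F a = II a b f.

Lemma II_add a b c f : Lloc f -> a <= b -> b <= c -> II a c f = II a b f + II b c f.
Proof.
move=> [_ lf] ab bc; rewrite /II -IntD//; congr Int; apply/funext => x.
rewrite -mulrDr; congr (_ * _); rewrite !indic_itvE.
have [xb|bx] := leP x b.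
  by rewrite (le_trans xb bc) !andbT addr0.
by rewrite (le_lt_trans ab bx)/= add0r.
Qed.

Lemma II_diag a f : II a a f = 0.
Proof.
rewrite /II (_ : (fun _ => _) = fun=> 0) ?Int0//; apply/funext => x.
by rewrite indic_itvE; case: (boolP (_ < _ <= _)) => [/andP[h1 h2]|]; [lra|rewrite mulr0].
Qed.

Lemma AC_exists h (x0 y0 : R) : Lloc h -> exists2 F, AC F h & F x0 = y0.
Proof.
move=> lh; exists (fun x => y0 + (if x0 <= x then II x0 x h else - II x x0 h)); last first.
  by rewrite lexx II_diag addr0.
split=> // a b ab; rewrite opprD addrACA subrr add0r.
have [xb|bx] := leP x0 b; have [xa|ax] := leP x0 a.
- by rewrite (II_add lh xa ab) addrC addKr.
- by rewrite opprK (II_add lh (ltW ax) xb) addrC.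
- by have := lt_le_trans bx (le_trans xa ab); rewrite ltxx.
- by rewrite opprK (II_add lh ab (ltW bx)); ring.
Qed.

Lemma AC_der F f : (forall x : R, is_derive x 1 F (f x)) -> continuous f -> AC F f.
Proof.
move=> dF cf; split; first exact: Lloc_continuous.
move=> a b; rewrite le_eqVlt => /predU1P[->|ab]; first by rewrite subrr II_diag.
have cF := derivative_continuous dF.
rewrite /II (_ : Int _ = \int[mu]_(x in `]a, b]) f x); last first.
  rewrite [RHS]Rintegral_mkcond; congr Int; apply/funext => x.
  by rewrite patchE indicE; case: ifP; rewrite ?mulr1 ?mulr0.
rewrite /Rintegral integral_itv_obnd_cbnd; last first.
  by apply/measurable_EFinP; apply: measurable_funTS; exact: continuous_measurable.
rewrite (continuous_FTC2 ab (F := F))//.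
- exact: continuous_subspaceT.
- split.
  + by move=> x _; exact: der_derivable (dF x).
  + exact/cvg_at_right_filter/cF.
  + exact/cvg_at_left_filter/cF.
- by move=> x _; exact: der_val.
Qed.

Lemma II_supp a b f : (forall x, f x != 0 -> a < x <= b) -> II a b f = Int f.
Proof.
move=> sf; congr Int; apply/funext => x; rewrite indic_itvE.
by have [->|/sf ->] := eqVneq (f x) 0; rewrite ?mul0r ?mulr1.
Qed.

(** Testing with smoothed indicators of [al, be] for Lebesgue points al < be of [f] gives f be - f
    al as the integral of [h]; almost every point is a Lebesgue point. *)
Lemma du_bois_reymond f h : Lloc f -> Lloc h ->
  (forall phi psi a b, infinitely_derivable phi ->
     (forall x : R, is_derive x 1 phi (psi x)) ->
     (forall x, phi x != 0 -> a <= x <= b) ->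
     Int (fun x => f x * psi x) = - Int (fun x => h x * phi x)) ->
  exists2 F, AC F h & {ae mu, forall x, f x = F x}.
Proof.
move=> lf lh fh; have [mf lfab] := lf; have [mh lhab] := lh.
have [b [theta [M [b_inf th_inf dth M0 [[bM bsupp Ib] [th0 th1 th01]]]]]] := @smooth_step R.
(* [k z n] is a one-sided approximate identity at z, and [t z n] its primitive, rising from 0 at z
   to 1 at z + 1/(n + 1). *)
pose k (z : R) (n : nat) (x : R) : R := b (n.+1%:R * x + (- (n.+1%:R * z))) * n.+1%:R.
pose t (z : R) (n : nat) (x : R) : R := theta (n.+1%:R * x + (- (n.+1%:R * z))).
have k_inf z n : infinitely_derivable (k z n).
  by apply: infder_mul; [exact: infder_aff|exact: infder_cst].
have t_inf z n : infinitely_derivable (t z n) by exact: infder_aff.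
have mk z n : measurable_fun [set: R] (k z n).
  exact: (continuous_measurable (infder_continuous (k_inf z n))).
have mt z n : measurable_fun [set: R] (t z n).
  exact: (continuous_measurable (infder_continuous (t_inf z n))).
have dt z n (x : R) : is_derive x 1 (t z n) (k z n x) by exact: der_aff.
have N0 n : 0 < n.+1%:R :> R by rewrite ltr0n.
have N1 n : 1 <= n.+1%:R :> R by rewrite ler1n.
have ksupp z n x : k z n x != 0 -> z < x /\ n.+1%:R * (x - z) < 1.
  rewrite /k => kx; have /bsupp/andP[h1 h2] : b (n.+1%:R * x + (- (n.+1%:R * z))) != 0.
    by apply: contra_neq kx => ->; rewrite mul0r.
  rewrite -mulrN -mulrDr in h1 h2; split => //.
  by rewrite -subr_gt0 -(pmulr_rgt0 _ (N0 n)).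
have t0 z n x : x <= z -> t z n x = 0.
  by move=> xz; apply: th0; rewrite -mulrN -mulrDr pmulr_rle0// subr_le0.
have t1 z n x : 1 <= n.+1%:R * (x - z) -> t z n x = 1.
  by move=> xz; apply: th1; rewrite -mulrN -mulrDr.
have kM z n x : `|k z n x| <= M * n.+1%:R.
  by rewrite /k normrM normr_nat ler_wpM2r.
have Ik z n : Int (k z n) = 1.
  have ct : continuous (k z n) by exact: infder_continuous.
  have [_ /(_ (z - 1) (z + 1))] := AC_der (dt z n) ct.
  rewrite II_supp => [<-|x /ksupp[zx xz]].
  - rewrite (t0 _ _ (z - 1)) ?subr0 ?t1//; last lra.
    by rewrite (_ : z + 1 - z = 1) ?mulr1//; ring.
  - lra.
  have : x - z < 1 by rewrite (le_lt_trans _ xz)// ler_peMl//; lra.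
  by move=> h1; apply/andP; split; lra.
have cvk z : lebesgue_pt f z -> Int (fun y => f y * k z n y) @[n --> \oo] --> f z.
  move=> fz; apply: (lebesgue_pt_kernel (M := M)) => //.
  move=> n y /ksupp[zy yz]; rewrite gtr0_norm ?subr_gt0//.
  by rewrite -(ltr_pM2l (N0 n)) divff// gt_eqF.
have lfk z n : L1 (fun y => f y * k z n y).
  have := L1Z (M * n.+1%:R) (L1_abs (lfab z (z + 1))).
  apply: L1_le; first by apply: measurable_funM; [|exact: mk].
  move=> x; rewrite indic_itvE; have [->|kx] := eqVneq (k z n x) 0.
    by rewrite mulr0 normr0 mulr_ge0// mulr_ge0.
  have [zx xz] := ksupp _ _ _ kx.
  have : x - z < 1 by rewrite (le_lt_trans _ xz)// ler_peMl//; lra.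
  move=> h1; have -> : z < x <= z + 1 by apply/andP; split; lra.
  by rewrite mulr1 normrM mulrC ler_wpM2r.
(* The difference of the steps at al and be is a plateau: its derivative picks out f al - f be in
   the limit, while the plateau itself tends to the indicator of ]al, be]. *)
have key al be : al < be -> lebesgue_pt f al -> lebesgue_pt f be ->
    f be - f al = II al be h.
  move=> ab fal fbe.
  have lim1 : Int (fun y => f y * (k al n y - k be n y)) @[n --> \oo] --> f al - f be.
    under eq_fun do under [X in Int X]eq_fun do rewrite mulrBr.
    under eq_fun do rewrite IntB//.
    by apply: cvgB; exact: cvk.
  have [_ lim2] : L1 (fun x => h x * \1_(`]al, be]%classic : set R) x) /\
      Int (fun y => h y * (t al n y - t be n y)) @[n --> \oo] --> II al be h.
    apply: (dominated_convergence_Int (g := fun x => `|h x * \1_(`]al, (be + 1)]%classic : set R) x|)).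
    - by move=> n; apply: measurable_funM => //; exact: measurable_funB.
    - exact: L1_abs.
    - move=> n x; rewrite !normrM ler_wpM2l// indic_itvE.
      have [xal|alx] := leP x al.
        by rewrite (t0 al)// (t0 be) ?subrr ?normr0//; lra.
      have [xbe|bex] := leP x (be + 1).
        rewrite /= normr1; have /andP[? ?] := th01 (n.+1%:R * x + (- (n.+1%:R * al))).
        have /andP[? ?] := th01 (n.+1%:R * x + (- (n.+1%:R * be))).
        by rewrite /t ler_norml; apply/andP; split; lra.
      rewrite (t1 al) ?(t1 be) ?subrr ?normr0//.
        by rewrite -[leLHS]mulr1 ler_pM//; lra.
      by rewrite -[leLHS]mulr1 ler_pM//; lra.
    - move=> x; apply: cvgMr.
      have [xal|alx] := leP x al.
        rewrite (_ : (fun n => _) = fun=> 0).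
          rewrite indic_itvE (_ : _ < _ <= _ = false)/=; first exact: cvg_cst.
          by apply/negbTE; rewrite negb_and -leNgt xal.
        by apply/funext => n; rewrite (t0 al)// (t0 be) ?subrr//; lra.
      have large z : z < x -> \forall n \near \oo, t z n x = 1.
        move=> zx; have xz0 : 0 < x - z by rewrite subr_gt0.
        have := near_infty_natSinv_lt (PosNum xz0); apply: filterS => n /= hn.
        by apply: t1; rewrite -ler_pdivrMl// mulr1 ltW.
      have [xbe|bex] := leP x be.
        rewrite indic_itvE alx xbe/=; apply: cvg_near_cst.
        by apply: filterS (large _ alx) => n ->; rewrite t0// subr0.
      rewrite indic_itvE leNgt bex andbF/=; apply: cvg_near_cst.
      by apply: filterS2 (large _ alx) (large _ bex) => n -> ->; rewrite subrr.
  have : f al - f be = - II al be h; last by move=> E; rewrite -[RHS]opprK -E opprB.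
  apply: (cvg_unique _ lim1); first exact: Rhausdorff.
  rewrite (_ : (fun n => _) = fun n => - Int (fun y => h y * (t al n y - t be n y))).
    exact: cvgN.
  apply/funext => n; apply: (fh (fun y => t al n y - t be n y) (fun y => k al n y - k be n y) al (be + 1)).
  - exact: infder_sub.
  - move=> x; apply: contraR; rewrite negb_and -!ltNge => /orP[xal|bex].
      by rewrite (t0 al) ?ltW// (t0 be) ?subrr//; lra.
    rewrite (t1 al) ?(t1 be) ?subrr//.
      by rewrite -[leLHS]mulr1 ler_pM//; lra.
    by rewrite -[leLHS]mulr1 ler_pM//; lra.
have aef := lebesgue_differentiation (Lloc_locally_integrable lf).
(* Without any Lebesgue point the whole line would be negligible. The point found fixes the constant
   of integration. *)
have [x0 fx0] : exists x0, lebesgue_pt f x0.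
  apply: contrapT => /forallNP nl.
  have : mu.-negligible [set: R].
    by have := aef; congr negligible; apply/seteqP; split => // x _; exact: nl.
  move=> /negligibleP => /(_ measurableT) muT.
  by have := @lebesgue_measure_itv R `]-oo, +oo[; rewrite set_itvNyy muT/=; discriminate.
have [F ACF F0] := AC_exists x0 (f x0) lh.
exists F => //; apply: ae_imp aef => x fx.
have [_ Fab] := ACF.
have [xx0|xx0|->] := ltgtP x x0; last by rewrite F0.
- by have := Fab _ _ (ltW xx0); rewrite -(key x x0)// F0 => h1; lra.
- by have := Fab _ _ (ltW xx0); rewrite -(key x0 x)// F0 => h1; lra.
Qed.

End primitives.

(** * Calculus of absolutely continuous functions *)

Section primitives_calculus.
Context {R : realType}.
Notation mu := (@lebesgue_measure R).
Implicit Types f g h F G : R -> R.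

Lemma cvg_ext_seq (u v : nat -> R) (l : R) : (forall n, u n = v n) ->
  u n @[n --> \oo] --> l -> v n @[n --> \oo] --> l.
Proof. by move=> /funext ->. Qed.

Lemma Lloc_L1 f a b : Lloc f -> L1 (fun x => f x * \1_(`]a, b]%classic : set R) x).
Proof. by case. Qed.

Lemma continuous_bounded_itv F (a b : R) : continuous F ->
  exists2 M, 0 <= M & forall x, a <= x <= b -> `|F x| <= M.
Proof.
move=> cF; have [ab|ba] := leP a b; last first.
  by exists 0 => // x /andP[h1 h2]; lra.
have cF' : {within `[a, b], continuous (fun x => `|F x|)}.
  by apply: continuous_subspaceT => x; apply: cvg_norm; exact: cF.
by have [c _ hc] := EVT_max ab cF'; exists `|F c|.
Qed.

Lemma Lloc_mul_continuous f G : Lloc f -> continuous G -> Lloc (fun x => f x * G x).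
Proof.
move=> [mf lf] cG; have mG := continuous_measurable cG; split; first exact: measurable_funM.
move=> a b; have [M M0 hM] := continuous_bounded_itv a b cG.
apply: (L1_le _ _ (L1Z M (L1_abs (lf a b)))).
  by apply: measurable_funM => //; exact: measurable_funM.
move=> x; rewrite indic_itvE.
case: (boolP (_ < _ <= _)) => [/andP[ax xb]|_]; last by rewrite !mulr0 normr0 mulr0.
by rewrite !mulr1 normrM mulrC ler_wpM2r// hM// (ltW ax).
Qed.

Lemma II_itvcc a b f : Lloc f -> II a b f = \int[mu]_(x in `[a, b]) f x.
Proof.
move=> [mf lf]; rewrite /II [RHS]/Rintegral -integral_itv_obnd_cbnd; last first.
  by apply/measurable_EFinP; exact: measurable_funTS.
rewrite -/(Rintegral mu _ f) Rintegral_mkcond; congr Int; apply/funext => x.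
by rewrite patchE indicE; case: ifP; rewrite ?mulr1 ?mulr0.
Qed.

Lemma Lloc_integrable_itvcc a b f : Lloc f -> mu.-integrable `[a, b] (EFin \o f).
Proof.
move=> /Lloc_locally_integrable[mf _ fK]; apply/integrableP; split.
  by apply/measurable_EFinP; exact: measurable_funTS.
by apply: fK => //; exact: segment_compact.
Qed.

Lemma AC_continuous F f : AC F f -> continuous F.
Proof.
move=> [lf Fab] x.
have x1 : x - 1 < x + 1 by lra.
have ci := parameterized_integral_continuous (ltW x1) (Lloc_integrable_itvcc (x - 1) (x + 1) lf).
have xin : x \in `](x - 1), (x + 1)[ by rewrite in_itv/=; apply/andP; split; lra.
have h : (fun y => F (x - 1) + parameterized_integral mu (x - 1) y f) y @[y --> x] -->
    F (x - 1) + parameterized_integral mu (x - 1) x f.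
  by apply: cvgD; [exact: cvg_cst|exact: (within_continuous_continuous x1 ci xin)].
have E y : x - 1 < y -> F (x - 1) + parameterized_integral mu (x - 1) y f = F y.
  by move=> xy; rewrite /parameterized_integral -II_itvcc// -Fab ?ltW//; ring.
rewrite E in h; last lra.
apply: cvg_trans h; apply: near_eq_cvg.
near=> y; rewrite E//; near: y; apply: lt_nbhsr; lra.
Unshelve. all: by end_near. Qed.

Lemma AC_measurable F f : AC F f -> measurable_fun [set: R] F.
Proof. by move=> /AC_continuous; exact: continuous_measurable. Qed.

Lemma IID a b f g : Lloc f -> Lloc g -> II a b (fun x => f x + g x) = II a b f + II a b g.
Proof.
by move=> [_ lf] [_ lg]; rewrite /II -IntD//; congr Int; apply/funext => x; rewrite mulrDl.
Qed.

Lemma IIZ a b c f : Lloc f -> II a b (fun x => c * f x) = c * II a b f.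
Proof.
by move=> [_ lf]; rewrite /II -IntZ//; congr Int; apply/funext => x; rewrite mulrA.
Qed.

Lemma ACD F f G g : AC F f -> AC G g -> AC (fun x => F x + G x) (fun x => f x + g x).
Proof.
move=> [lf Ff] [lg Gg]; split; first exact: LlocD.
by move=> a b ab; rewrite IID// -Ff// -Gg//; ring.
Qed.

Lemma ACZ c F f : AC F f -> AC (fun x => c * F x) (fun x => c * f x).
Proof.
move=> [lf Ff]; split; first exact: LlocZ.
by move=> a b ab; rewrite IIZ// -Ff// mulrBr.
Qed.

Lemma AC_cst (c : R) : AC (fun=> c) (fun=> 0).
Proof.
split; first exact: Lloc_cst.
by move=> a b _; rewrite subrr /II; under eq_fun do rewrite mul0r; rewrite Int0.
Qed.

Lemma II_ae a b f g : measurable_fun [set: R] g -> Lloc f ->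
  {ae mu, forall x, f x = g x} -> II a b f = II a b g.
Proof.
move=> mg [mf lf] fg.
have fg' : {ae mu, forall x, f x * \1_(`]a, b]%classic : set R) x =
                             g x * \1_(`]a, b]%classic : set R) x}.
  by apply: ae_imp fg => x ->.
apply: Int_ae => //; apply: (L1_ae _ fg') => //; exact: measurable_funM.
Qed.

Lemma Lloc_ae f g : measurable_fun [set: R] g ->
  {ae mu, forall x, f x = g x} -> Lloc f -> Lloc g.
Proof.
move=> mg fg [mf lf]; split => // a b.
apply: (@L1_ae _ (fun x => f x * \1_(`]a, b]%classic : set R) x)) => //.
  exact: measurable_funM.
by apply: ae_imp fg => x ->.
Qed.

Lemma AC_ae F f g : measurable_fun [set: R] g ->
  {ae mu, forall x, f x = g x} -> AC F f -> AC F g.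
Proof.
move=> mg fg [lf Ff]; split; first exact: Lloc_ae fg lf.
by move=> a b ab; rewrite Ff// (II_ae _ _ mg lf fg).
Qed.

Lemma ae_neq (a : R) : {ae mu, forall x, x != a}.
Proof.
exists [set a]; split => //; first exact: lebesgue_measure_set1.
by move=> x /= /negP; rewrite negbK => /eqP.
Qed.

(** Fubini on a square cut along its diagonal: after inserting the integral formulas for [F] and
    [G], the terms f G and F g range over complementary triangles. *)
Lemma AC_mul F f G g : AC F f -> AC G g ->
  AC (fun x => F x * G x) (fun x => f x * G x + F x * g x).
Proof.
move=> ACF ACG; have cF := AC_continuous ACF; have cG := AC_continuous ACG.
have [lf Ff] := ACF; have [lg Gg] := ACG.
have lfG : Lloc (fun x => f x * G x) by exact: Lloc_mul_continuous.
have lFg : Lloc (fun x => F x * g x).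
  by under eq_fun do rewrite mulrC; exact: Lloc_mul_continuous.
split; first exact: LlocD.
move=> a b ab; rewrite IID//.
pose f1 x := f x * \1_(`]a, b]%classic : set R) x.
pose g1 x := g x * \1_(`]a, b]%classic : set R) x.
have lf1 : L1 f1 by exact: Lloc_L1. have lg1 : L1 g1 by exact: Lloc_L1.
have mf1 := L1_measurable lf1; have mg1 := L1_measurable lg1.
(* The triangle t <= s, which is the part of the square seen by f G. The term F g sees the rest,
   that is, the full integral minus this one. *)
pose K (s t : R) := if t <= s then f1 s * g1 t else 0.
have mK : measurable_fun [set: R * R] (fun z => K z.1 z.2).
  apply: measurable_fun_ifT => //.
    by apply: measurable_fun_ler; [exact: measurable_snd|exact: measurable_fst].
  apply: measurable_funM; [exact: (measurableT_comp mf1 measurable_fst)|exact: (measurableT_comp mg1 measurable_snd)].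
have iK : (\int[mu]_s \int[mu]_t `|K s t|%:E < +oo)%E.
  apply: (fubini_dom mK (L1_abs lf1) (L1_abs lg1)) => s t.
  by rewrite /K; case: ifP => _; rewrite ?normr0 ?normrM ?mulr_ge0.
have e1 s : f1 s * G s = f1 s * G a + Int (K s).
  rewrite /K /f1 indic_itvE; case: (boolP (_ < _ <= _)) => [/andP[sa sb]|_]; last first.
    rewrite !mulr0 !mul0r add0r (_ : (fun _ => _) = fun=> 0) ?Int0//.
    by apply/funext => t; rewrite mul0r; case: ifP.
  rewrite !mulr1; have -> : G s = G a + II a s g by rewrite -Gg ?ltW//; ring.
  rewrite mulrDr; congr (_ + _); rewrite /II -IntZ; last exact: Lloc_L1.
  congr Int; apply/funext => t; rewrite /g1 !indic_itvE.
  have [ts|st] := leP t s; last by rewrite andbF !mulr0.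
  by rewrite andbT (le_trans ts sb) andbT.
have e2 t : F t * g1 t = F a * g1 t + (Int f1 * g1 t - Int (K ^~ t)).
  rewrite /g1 indic_itvE; case: (boolP (_ < _ <= _)) => [/andP[ta tb]|tn]; last first.
    rewrite !mulr0 add0r /K /g1 indic_itvE (negbTE tn) (_ : (fun _ => _) = fun=> 0) ?Int0 ?subr0//.
    by apply/funext => s; rewrite !mulr0; case: ifP.
  rewrite !mulr1; have -> : F t = F a + II a t f by rewrite -Ff ?ltW//; ring.
  rewrite mulrDl; congr (_ + _).
  have lK : L1 (K ^~ t).
    apply: (L1_le _ _ (L1Z `|g1 t| (L1_abs lf1))).
      by have := measurableT_comp mK (measurable_pair2 t).
    move=> s; rewrite /K; case: ifP => _; rewrite ?normr0 ?mulr_ge0//.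
    by rewrite normrM mulrC.
  rewrite [in LHS]mulrC [X in X - _]mulrC /II -IntZ; last exact: Lloc_L1.
  rewrite -(IntZ (g t) lf1) -IntB//; last exact: L1Z.
  apply: Int_ae.
  - exact/L1Z/Lloc_L1.
  - by apply: L1B => //; exact: L1Z.
  (* Both triangles contain the diagonal; for fixed t it is the single point s = t. *)
  apply: ae_imp (ae_neq t) => s st.
  rewrite /K /f1 /g1 !indic_itvE ta tb/= !mulr1.
  have [ts|lt_st] := leP t s; last first.
    by rewrite (ltW lt_st) andbT (le_trans (ltW lt_st) tb) andbT subr0.
  by rewrite (_ : s <= t = false) ?andbF ?mulr0; [rewrite mulrC subrr|apply/negbTE; rewrite -ltNge lt_neqAle eq_sym st].
have -> : II a b (fun x => f x * G x) = Int f1 * G a + Int (fun s => Int (K s)).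
  have E : (fun x => f x * G x * \1_(`]a, b]%classic : set R) x) = (fun s => G a * f1 s + Int (K s)).
    by apply/funext => s; rewrite mulrAC -/(f1 s) e1 mulrC.
  by rewrite /II E IntD ?IntZ 1?mulrC//; [exact: L1Z|exact: fubini_L1l].
have -> : II a b (fun x => F x * g x) = F a * Int g1 + (Int f1 * Int g1 - Int (fun t => Int (K ^~ t))).
  have E : (fun x => F x * g x * \1_(`]a, b]%classic : set R) x) =
      (fun t => F a * g1 t + (Int f1 * g1 t - Int (K ^~ t))).
    by apply/funext => t; rewrite -mulrA -/(g1 t) e2.
  have lKt := fubini_L1r mK iK.
  by rewrite /II E IntD ?IntB ?IntZ//; [exact: L1Z|exact: L1Z|apply: L1B => //; exact: L1Z].
rewrite (fubini_Int mK iK).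
have -> : Int f1 = F b - F a by rewrite Ff.
have -> : Int g1 = G b - G a by rewrite Gg.
ring.
Qed.

Lemma indic_itv_shift (a b c x : R) :
  \1_(`]a, b]%classic : set R) (x + c) = \1_(`](a - c), (b - c)]%classic : set R) x :> R.
Proof. by rewrite !indic_itvE ltrBlDr lerBrDr. Qed.

(** An integrable function need not decay pointwise, but its means over receding unit intervals do;
    the sign [s] covers both ends of the line. *)
Lemma cvg_II_far F (s : R) : s = 1 \/ s = -1 -> L1 F ->
  Int (fun x => F (x + s * n%:R) * \1_(`]0, 1]%classic : set R) x) @[n --> \oo] --> 0.
Proof.
move=> s1 lF; have mF := L1_measurable lF.
have [_] : L1 (fun x => F x * 0) /\
   Int (fun x => F x * \1_(`](s * n%:R : R), (1 + s * n%:R)]%classic : set R) x) @[n --> \oo] --> Int (fun x => F x * 0).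
  apply: (dominated_convergence_Int (g := fun x => `|F x|)).
  - by move=> n; apply: measurable_funM.
  - exact: L1_abs.
  - by move=> n x; rewrite normrM ler_piMr// indic_itv_le1.
  - move=> x; apply: cvgMr; apply: cvg_near_cst; near=> n.
    have hn : `|x| + 1 < n%:R by near: n; exact: nbhs_infty_gtr.
    rewrite indic_itvE (_ : _ < x <= _ = false)//; apply/negbTE.
    have := ler_norm x; have := ler_norm (- x); rewrite normrN => h1 h2.
    by case: s1 => ->; apply/negP => /andP[h3 h4]; lra.
under [fun x => F x * 0]eq_fun do rewrite mulr0.
rewrite Int0; apply: cvg_ext_seq => n.
rewrite -(Int_shift (s * n%:R)); last exact: measurable_funM.
by congr Int; apply/funext => x; rewrite indic_itv_shift subrr addrK.
Unshelve. all: by end_near. Qed.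

(** F (x + n) - F (x - n) tends to [Int f] for every x, whereas its mean over x in ]0, 1] tends to 0
    because [F] is integrable. *)
Lemma AC_Int0 F f : AC F f -> L1 F -> L1 f -> Int f = 0.
Proof.
move=> ACF lF lf; have [llf Fab] := ACF; have mf := L1_measurable lf.
have mF := L1_measurable lF.
have ptw x : F (x + 1 * n%:R) - F (x + (-1) * n%:R) @[n --> \oo] --> Int f.
  have [_] : L1 f /\ Int (fun y => f y * \1_(`](x - n%:R), (x + n%:R)]%classic : set R) y) @[n --> \oo] --> Int f.
    apply: (dominated_convergence_Int (g := fun x => `|f x|)).
    - by move=> n; apply: measurable_funM.
    - exact: L1_abs.
    - by move=> n y; rewrite normrM ler_piMr// indic_itv_le1.
    - move=> y; rewrite -[X in _ --> X]mulr1; apply: cvgMr; apply: cvg_near_cst; near=> n.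
      have hn : `|y - x| + 1 < n%:R by near: n; exact: nbhs_infty_gtr.
      rewrite indic_itvE (_ : _ < y <= _ = true)//.
      have := ler_norm (y - x); have := ler_norm (x - y); rewrite distrC => h1 h2.
      by apply/andP; split; lra.
  apply: cvg_ext_seq => n.
  by rewrite mul1r mulN1r Fab// lerD2l; have := ler0n R n; lra.
have bnd x n : `|F (x + 1 * n%:R) - F (x + (-1) * n%:R)| <= Int (fun x => `|f x|).
  rewrite Fab; last by rewrite lerD2l; have := ler0n R n; lra.
  rewrite /II; apply: (le_trans (Int_abs (Lloc_L1 _ _ llf))).
  apply: le_Int; [exact: L1_abs (Lloc_L1 _ _ llf)|exact: L1_abs|].
  by move=> y; rewrite normrM ler_piMr// indic_itv_le1.
have mFs c : measurable_fun [set: R] (fun x => F (x + c)).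
  exact: L1_measurable (L1_shift c lF).
have lFs c : L1 (fun x => F (x + c) * \1_(`]0, 1]%classic : set R) x).
  by apply: (@L1_bnd _ 1) => //; [exact: L1_shift|move=> y; exact: indic_itv_le1].
have [_ lim1] : L1 (fun x => Int f * \1_(`]0, 1]%classic : set R) x) /\
   Int (fun x => (F (x + 1 * n%:R) - F (x + (-1) * n%:R)) * \1_(`]0, 1]%classic : set R) x) @[n --> \oo] -->
   Int (fun x => Int f * \1_(`]0, 1]%classic : set R) x).
  apply: (dominated_convergence_Int (g := fun x => Int (fun x => `|f x|) * \1_(`]0, 1]%classic : set R) x)).
  - by move=> n; apply: measurable_funM => //; exact: measurable_funB.
  - exact/L1Z/L1_indic_itv.
  - move=> n x; rewrite normrM (ger0_norm (_ : 0 <= \1_ _ _)) ?indicE//.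
    exact: ler_wpM2r.
  - by move=> x; apply: cvgMl; exact: ptw.
rewrite IntZ ?Int_indic_itv ?subr0 ?mulr1 in lim1; [|exact: ler01|exact: L1_indic_itv].
have lim2 : (Int (fun x => F (x + 1 * n%:R) * \1_(`]0, 1]%classic : set R) x) -
    Int (fun x => F (x + (-1) * n%:R) * \1_(`]0, 1]%classic : set R) x)) @[n --> \oo] --> 0 - 0.
  by apply: cvgB; apply: cvg_II_far => //; [left|right].
rewrite subr0 in lim2.
apply: (cvg_unique _ lim1); first exact: Rhausdorff.
apply: (cvg_ext_seq _ lim2) => n.
by rewrite /= -IntB//; congr Int; apply/funext => x; rewrite mulrBl.
Unshelve. all: by end_near. Qed.

Lemma AC_parts F f G g : AC F f -> AC G g -> L1 (fun x => F x * G x) ->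
  L1 (fun x => f x * G x) -> L1 (fun x => F x * g x) ->
  Int (fun x => f x * G x) = - Int (fun x => F x * g x).
Proof.
move=> ACF ACG lFG lfG lFg; apply/eqP; rewrite -addr_eq0 -IntD//.
by rewrite (AC_Int0 (AC_mul ACF ACG))//; exact: L1D.
Qed.

(** A crude substitute for the Cauchy-Schwarz inequality wherever only the finiteness of a constant
    matters. *)
Lemma le_1Dsqr (x : R) : `|x| <= 1 + x ^+ 2.
Proof.
have := sqr_ge0 (`|x| - 2^-1); rewrite -(real_normK (num_real x)) => h; nra.
Qed.

(** For y in the unit interval to the right of x, |F x| is at most |F y| + 1 + Int f^2; averaging
    over y bounds the first term by 1 + C. *)
Lemma AC_bounded F f (C : R) : AC F f -> L1 (fun x => f x ^+ 2) ->
  (forall x, II x (x + 1) (fun y => F y ^+ 2) <= C) ->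
  exists M, forall x, `|F x| <= M.
Proof.
move=> ACF lf2 hC; have [lf Fab] := ACF; have cF := AC_continuous ACF.
have lF2 : Lloc (fun y => F y ^+ 2).
  apply: Lloc_continuous => x; exact: cvgM (cF x) (cF x).
exists (1 + C + (1 + Int (fun x => f x ^+ 2))) => x.
have l1 : L1 (\1_(`]x, (x + 1)]%classic : set R)) by exact: L1_indic_itv.
have xx1 : x <= x + 1 by lra.
have hf : II x (x + 1) (fun y => `|f y|) <= 1 + Int (fun x => f x ^+ 2).
  have I1 : 1 = Int (\1_(`]x, (x + 1)]%classic : set R)).
    by rewrite Int_indic_itv//; ring.
  rewrite [X in _ <= X + _]I1.
  rewrite -IntD//; apply: le_Int; [exact: Lloc_L1 (Lloc_abs lf)|exact: L1D|].
  move=> y; rewrite indicE; case: (_ \in _); rewrite ?mulr1 ?mulr0 ?add0r ?sqr_ge0//.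
  exact: le_1Dsqr.
have : Int (fun y => `|F x| * \1_(`]x, (x + 1)]%classic : set R) y) <=
  Int (fun y => \1_(`]x, (x + 1)]%classic : set R) y + F y ^+ 2 * \1_(`]x, (x + 1)]%classic : set R) y
     + (1 + Int (fun x => f x ^+ 2)) * \1_(`]x, (x + 1)]%classic : set R) y).
  apply: le_Int; first exact: L1Z.
    by apply: L1D; [apply: L1D => //; exact: Lloc_L1|exact: L1Z].
  move=> y; rewrite indic_itvE; case: (boolP (_ < _ <= _)) => [/andP[xy yx]|_]; last by rewrite !mulr0 !addr0.
  rewrite !mulr1.
  have : `|F y - F x| <= II x (x + 1) (fun y => `|f y|).
    rewrite (Fab _ _ (ltW xy)) /II; apply: (le_trans (Int_abs (Lloc_L1 _ _ lf))).
    apply: le_Int; [exact: L1_abs (Lloc_L1 _ _ lf)|exact: Lloc_L1 (Lloc_abs lf)|].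
    move=> z; rewrite normrM !indic_itvE; case: (boolP (x < z <= y)) => [/andP[xz zy]|_].
      by rewrite xz (le_trans zy yx) normr1.
    by rewrite normr0 mulr0 mulr_ge0.
  move=> /le_trans/(_ hf) h3; have := le_1Dsqr (F y).
  have : `|F x| <= `|F y| + `|F y - F x|.
    by rewrite -[in X in X <= _](subKr (F y) (F x)) (le_trans (ler_normB _ _)).
  move: (F y ^+ 2) (Int (fun x => f x ^+ 2)) h3 => z I h3 h1 h2; rewrite mulr1n; lra.
rewrite IntZ// IntD ?IntD ?IntZ//; [|exact: Lloc_L1|by apply: L1D => //; exact: Lloc_L1|exact: L1Z].
rewrite !Int_indic_itv//.
have := hC x; rewrite /II; lra.
Qed.

Lemma L1_sqr_cst0 (c : R) : L1 (fun=> c ^+ 2) -> c = 0.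
Proof.
move=> lc; apply/eqP; rewrite -sqrf_eq0; apply/eqP.
have [_] : L1 (fun x : R => c ^+ 2 * 0) /\
   Int (fun x => c ^+ 2 * \1_(`](n%:R : R), (1 + n%:R)]%classic : set R) x) @[n --> \oo] --> Int (fun x : R => c ^+ 2 * 0).
  apply: (dominated_convergence_Int (g := fun x : R => c ^+ 2)) => //.
  - by move=> n; apply: measurable_funM.
  - by move=> n x; rewrite normrM ger0_norm ?sqr_ge0// ler_piMr ?sqr_ge0// indic_itv_le1.
  - move=> x; apply: cvgMr; apply: cvg_near_cst; near=> n.
    have hn : `|x| + 1 < n%:R by near: n; exact: nbhs_infty_gtr.
    rewrite indic_itvE (_ : _ < x <= _ = false)//; apply/negbTE.
    have := ler_norm x; move=> h2; apply/negP => /andP[h3 h4]; lra.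
rewrite (_ : Int (fun=> c ^+ 2 * 0) = 0); last first.
  by rewrite -[RHS]Int0; congr Int; apply/funext => x; rewrite mulr0.
rewrite (_ : (fun n => _) = fun=> c ^+ 2).
  by move=> h; apply: (cvg_unique _ _ h); [exact: Rhausdorff|exact: cvg_cst].
apply/funext => n; rewrite IntZ ?Int_indic_itv ?addrK ?mulr1//; last exact: L1_indic_itv.
by rewrite lerDr.
Unshelve. all: by end_near. Qed.

End primitives_calculus.

(** * Fourier pairs tested on Gaussians *)

Section gaussians.
Context {R : realType}.
Notation mu := (@lebesgue_measure R).
Implicit Types f g h p F G : R -> R.

Lemma L1_oneDsqrV : L1 (fun x : R => (1 + x ^+ 2)^-1).
Proof.
have p0 (x : R) : 0 < 1 + x ^+ 2 by rewrite ltr_wpDr// sqr_ge0.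
have c : continuous (fun x : R => (1 + x ^+ 2)^-1) by exact: continuous_oneDsqrV.
apply: L1_ge0; first exact: continuous_measurable.
  by move=> x; rewrite invr_ge0 ltW.
rewrite (ge0_symfun_integralT (f := fun x : R => (1 + x ^+ 2)^-1))//.
- rewrite (_ : [set x : R | (0 <= x)%R] = `[0, +oo[%classic); last first.
    by apply/seteqP; split=> x /=; rewrite in_itv/= andbT.
  by rewrite [X in (_ * X)%E](integral0y_oneDsqr R) -EFinM ltry.
- by move=> x; rewrite invr_ge0 ltW.
- by move=> x; rewrite /= sqrrN.
Qed.

Definition gau (s x : R) : R := expR (- (s * x ^+ 2)).

Lemma gau_gt0 s x : 0 < gau s x. Proof. exact: expR_gt0. Qed.

Lemma gau_ge0 s x : 0 <= gau s x. Proof. exact: expR_ge0. Qed.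

Lemma gau_le1 s x : 0 <= s -> gau s x <= 1.
Proof. by move=> s0; rewrite -expR0 ler_expR oppr_le0 mulr_ge0// sqr_ge0. Qed.

Lemma gauN s x : gau s (- x) = gau s x. Proof. by rewrite /gau sqrrN. Qed.

Lemma gauD s t x : gau (s + t) x = gau s x * gau t x.
Proof. by rewrite /gau mulrDl opprD expRD. Qed.

Lemma gau_half s x : gau s x = gau (s / 2) x * gau (s / 2) x.
Proof. by rewrite -gauD -splitr. Qed.

Lemma gau_der (s z x : R) :
  is_derive x 1 (fun y => gau s (y - z)) (- (2 * s * (x - z)) * gau s (x - z)).
Proof.
have d1 : is_derive x 1 (fun y => y - z) (1 - 0) := derB (der_id x) (der_cst x z).
have d2 := derN (derZ s (derM d1 d1)).
have := @der_comp _ expR (fun y => - (s * ((y - z) * (y - z)))) x _ _ (is_derive_expR _) d2.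
move=> h; apply: (der_eq h).
by rewrite /gau expr2 subr0 mul1r mulr1 mulrC; congr (_ * _); ring.
Qed.

Lemma gau_continuous s : continuous (gau s).
Proof.
apply: (@derivative_continuous _ _ (fun x => - (2 * s * x) * gau s x)) => x.
have := gau_der s 0 x; rewrite subr0.
by congr is_derive; apply/funext => y; rewrite subr0.
Qed.

Lemma gau_measurable s : measurable_fun [set: R] (gau s).
Proof. exact: (continuous_measurable (@gau_continuous s)). Qed.

Lemma L1_gau s : 0 < s -> L1 (gau s).
Proof.
move=> s0; pose c := Num.max 1 s^-1.
have c1 : 1 <= c by rewrite le_max lexx.
have cs : s^-1 <= c by rewrite le_max lexx orbT.
apply: (L1_le (gau_measurable s) _ (L1Z c L1_oneDsqrV)) => x.
have c0 : 0 < c by rewrite (lt_le_trans ltr01).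
have x0 : 0 < 1 + x ^+ 2 by rewrite ltr_wpDr// sqr_ge0.
rewrite ger0_norm ?gau_ge0// /gau expRN -[c]invrK -invfM lef_pV2 ?posrE ?expR_gt0 ?mulr_gt0 ?invr_gt0//.
apply: (@le_trans _ _ (1 + s * x ^+ 2)); last exact: expR_ge1Dx.
rewrite mulrDr mulr1 lerD ?invf_le1// ler_wpM2r ?sqr_ge0// -[leRHS]invrK.
by rewrite lef_pV2 ?posrE ?invr_gt0.
Qed.

(** [tame] functions are those that can be paired with every Gaussian, and [slow] functions are
    their multipliers. All s > 0 are allowed because a Gaussian is shared between two factors by
    halving its parameter. *)
Definition slow p := measurable_fun [set: R] p /\
  forall s, 0 < s -> exists2 C, 0 <= C & forall x, `|p x| * gau s x <= C.

Definition tame f := measurable_fun [set: R] f /\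
  forall s, 0 < s -> L1 (fun x => f x * gau s x).

Lemma slow_bounded p (M : R) : measurable_fun [set: R] p ->
  (forall x, `|p x| <= M) -> slow p.
Proof.
move=> mp pM; split => // s s0; exists `|M| => // x.
rewrite -[leRHS]mulr1; apply: ler_pM; rewrite ?gau_ge0 ?(gau_le1 _ (ltW s0))//.
by rewrite (le_trans (pM x))// ler_norm.
Qed.

Lemma slow_id : slow (fun x => x).
Proof.
split => // s s0; exists (1 + s^-1); first by rewrite addr_ge0// invr_ge0 ltW.
move=> x; rewrite /gau expRN ler_pdivrMr ?expR_gt0//.
apply: (@le_trans _ _ ((1 + s^-1) * (1 + s * x ^+ 2))); last first.
  by rewrite ler_wpM2l ?expR_ge1Dx// addr_ge0// invr_ge0 ltW.
apply: (le_trans (le_1Dsqr x)).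
have -> : (1 + s^-1) * (1 + s * x ^+ 2) = 1 + x ^+ 2 + (s^-1 + s * x ^+ 2).
  by field; rewrite gt_eqF.
rewrite lerDl; apply: addr_ge0; first by rewrite invr_ge0 ltW.
exact: mulr_ge0 (ltW s0) (sqr_ge0 x).
Qed.

Lemma slowM p q : slow p -> slow q -> slow (fun x => p x * q x).
Proof.
move=> [mp hp] [mq hq]; split; first exact: measurable_funM.
move=> s s0; have s20 : 0 < s / 2 by rewrite divr_gt0.
have [C C0 hC] := hp _ s20; have [D D0 hD] := hq _ s20.
exists (C * D); first exact: mulr_ge0.
by move=> x; rewrite normrM gau_half mulrACA ler_pM ?mulr_ge0 ?gau_ge0.
Qed.

Lemma slowD p q : slow p -> slow q -> slow (fun x => p x + q x).
Proof.
move=> [mp hp] [mq hq]; split; first exact: measurable_funD.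
move=> s s0; have [C C0 hC] := hp _ s0; have [D D0 hD] := hq _ s0.
exists (C + D); first exact: addr_ge0.
move=> x; apply: (@le_trans _ _ ((`|p x| + `|q x|) * gau s x)).
  by rewrite ler_wpM2r ?gau_ge0 ?ler_normD.
by rewrite mulrDl lerD.
Qed.

Lemma slow_cst (c : R) : slow (fun=> c).
Proof. exact: (@slow_bounded _ `|c|). Qed.

Lemma slowX k : slow (fun x => x ^+ k).
Proof.
elim: k => [|k ih]; first exact: slow_cst.
by under eq_fun do rewrite exprS; exact: slowM slow_id ih.
Qed.

Lemma tame_slow f p : tame f -> slow p -> tame (fun x => f x * p x).
Proof.
move=> [mf hf] [mp hp]; split; first exact: measurable_funM.
move=> s s0; have s20 : 0 < s / 2 by rewrite divr_gt0.
have [C C0 hC] := hp _ s20.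
apply: (L1_le _ _ (L1Z C (L1_abs (hf _ s20)))).
  by apply: measurable_funM; [exact: measurable_funM|exact: gau_measurable].
move=> x; rewrite gau_half mulrACA normrM mulrC ler_wpM2r//.
by rewrite normrM (ger0_norm (gau_ge0 _ _)).
Qed.

Lemma tameD f g : tame f -> tame g -> tame (fun x => f x + g x).
Proof.
move=> [mf hf] [mg hg]; split; first exact: measurable_funD.
by move=> s s0; under eq_fun do rewrite mulrDl; apply: L1D; [exact: hf|exact: hg].
Qed.

Lemma tameZ c f : tame f -> tame (fun x => c * f x).
Proof.
move=> [mf hf]; split; first exact: measurable_funM.
by move=> s s0; under eq_fun do rewrite -mulrA; apply: L1Z; exact: hf.
Qed.

Lemma tameB f g : tame f -> tame g -> tame (fun x => f x - g x).
Proof.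
move=> tf /(tameZ (-1)) tg; have := tameD tf tg.
by congr tame; apply/funext => x; rewrite mulN1r.
Qed.

Lemma L1_tame f : L1 f -> tame f.
Proof.
move=> lf; split; first exact: L1_measurable.
move=> s s0; apply: (@L1_bnd _ 1) => //; first exact: gau_measurable.
by move=> x; rewrite ger0_norm ?gau_ge0// (gau_le1 _ (ltW s0)).
Qed.

Lemma sqr_tame f : measurable_fun [set: R] f -> L1 (fun x => f x ^+ 2) -> tame f.
Proof.
move=> mf lf; split=> // s s0.
apply: (L1_le _ _ (L1D (L1_gau s0) lf)).
  by apply: measurable_funM => //; exact: gau_measurable.
move=> x; rewrite normrM (ger0_norm (gau_ge0 _ _)).
apply: (@le_trans _ _ ((1 + f x ^+ 2) * gau s x)).
  by rewrite ler_wpM2r ?gau_ge0// le_1Dsqr.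
by rewrite mulrDl mul1r lerD2l ler_piMr ?sqr_ge0 ?(gau_le1 _ (ltW s0)).
Qed.

Lemma slow_tame p : slow p -> tame p.
Proof.
move=> sp; have := tame_slow (f := fun=> 1) _ sp.
rewrite (_ : (fun x => 1 * p x) = p); last by apply/funext => x; rewrite mul1r.
apply; split => // s s0.
have -> : (fun x : R => 1 * gau s x) = gau s by apply/funext => x; rewrite mul1r.
exact: L1_gau.
Qed.

(** The exponents differ by s/2 (x - 2 z)^2. Thanks to this bound, [tame] need only mention
    Gaussians centred at the origin. *)
Lemma gau_center s z x : 0 < s -> gau s (x - z) <= expR (s * z ^+ 2) * gau (s / 2) x.
Proof.
move=> s0; rewrite /gau -expRD ler_expR -subr_ge0.
have -> : s * z ^+ 2 - s / 2 * x ^+ 2 - - (s * (x - z) ^+ 2) = s / 2 * (x - 2 * z) ^+ 2 by field.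
by rewrite mulr_ge0 ?sqr_ge0 ?divr_ge0 ?(ltW s0).
Qed.

Lemma gau_center_measurable s z : measurable_fun [set: R] (fun x => gau s (x - z)).
Proof.
by apply: (measurableT_comp (gau_measurable s)); exact: measurable_funB.
Qed.

Lemma tame_gau_center f s z : tame f -> 0 < s -> L1 (fun x => f x * gau s (x - z)).
Proof.
move=> [mf hf] s0; have s20 : 0 < s / 2 by rewrite divr_gt0.
apply: (L1_le _ _ (L1Z (expR (s * z ^+ 2)) (L1_abs (hf _ s20)))).
  by apply: measurable_funM => //; exact: gau_center_measurable.
move=> x; rewrite !normrM mulrCA ler_wpM2l// !ger0_norm ?gau_ge0//.
exact: gau_center.
Qed.

Definition Kg s : R := Int (gau s).

(** On ]0, 1/s] one has s x^2 <= 1. A polynomial lower bound in s is enough, since it competes with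
    exponentially small tails. *)
Lemma Kg_ge s : 1 <= s -> expR (- 1) / s <= Kg s.
Proof.
move=> s1; have s0 : 0 < s by rewrite (lt_le_trans ltr01).
have li := L1_indic_itv (0 : R) s^-1.
have -> : expR (- 1) / s = Int (fun x => expR (- 1) * \1_(`]0, s^-1]%classic : set R) x).
  by rewrite IntZ// Int_indic_itv ?subr0// invr_ge0 ltW.
apply: le_Int; [exact: L1Z|exact: L1_gau|] => x; rewrite indic_itvE.
case: (boolP (_ < _ <= _)) => [/andP[x0 xs]|_]; last by rewrite mulr0 gau_ge0.
have sx : s * x <= 1 by rewrite -ler_pdivlMl// mulr1.
have x1 : x <= 1 by rewrite (le_trans xs)// invf_le1.
rewrite mulr1 ler_expR lerN2 expr2 mulrA mulr_ile1 ?(ltW x0)//.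
by rewrite mulr_ge0 ?(ltW s0) ?(ltW x0).
Qed.

Lemma Kg_gt0 s : 0 < s -> 0 < Kg s.
Proof.
move=> s0; pose c := Num.max 1 s.
have c1 : 1 <= c by rewrite le_max lexx.
apply: (@lt_le_trans _ _ (Kg c)).
  by apply: lt_le_trans (Kg_ge c1); rewrite divr_gt0 ?expR_gt0// (lt_le_trans ltr01).
apply: le_Int; [apply: L1_gau; exact: lt_le_trans c1|exact: L1_gau|].
move=> x; rewrite ler_expR lerN2 ler_wpM2r ?sqr_ge0// le_max lexx orbT//.
Qed.

End gaussians.

(** * Transforms of Gaussians, and Gaussians as a separating family *)

Section gaussian_transform.
Context {R : realType}.
Notation mu := (@lebesgue_measure R).
Implicit Types f g h p F G : R -> R.

(** The dominating function is asked for only at parameters within distance 1 of [a], so it may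
    depend on [a]. *)
Lemma der_Int (f df : R -> R -> R) (G : R -> R) (a : R) :
  (forall t, L1 (f t)) ->
  (forall t x : R, is_derive t 1 (f ^~ x) (df t x)) ->
  L1 G -> (forall t x, a - 1 < t < a + 1 -> `|df t x| <= G x) ->
  is_derive a 1 (fun t => Int (f t)) (Int (df a)).
Proof.
move=> lf dff lG dG.
have lG' : mu.-integrable setT (EFin \o (fun x => `|G x|)) by exact: L1_abs.
have Ia : `]a - 1, a + 1[%classic a by rewrite /= in_itv/=; apply/andP; split; lra.
have lf' x : `]a - 1, a + 1[%classic x -> mu.-integrable setT (EFin \o f x) by move=> _; exact: lf.
have df' x y : `]a - 1, a + 1[%classic x -> setT y -> derivable (f ^~ y) x 1.
  by move=> _ _; exact: der_derivable (dff x y).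
have G0 y : 0 <= `|G y| by [].
have dG' x y : `]a - 1, a + 1[%classic x -> setT y -> `|partial1of2 f x y| <= `|G y|.
  rewrite /= in_itv/= => xa _; rewrite /partial1of2 (der_val (dff x y)).
  by rewrite (le_trans (dG _ _ xa))// ler_norm.
have E := differentiation_under_integral measurableT Ia lf' df' G0 lG' dG'.
have D := derivable_under_integral measurableT Ia lf' df' G0 lG' dG'.
apply: DeriveDef => //; rewrite -derive1E E; congr Int; apply/funext => y.
by rewrite /partial1of2 (der_val (dff a y)).
Qed.

Lemma Int_gau_center (s z : R) : 0 < s -> Int (fun x => gau s (x - z)) = Kg s.
Proof. by move=> s0; rewrite (Int_shift (- z))//; exact: gau_measurable. Qed.

Lemma cosM_der (t x : R) : is_derive t 1 (fun t => cos (t * x)) (- sin (t * x) * x).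
Proof.
have d : is_derive t 1 (fun t => t * x) (1 * x + t * 0) := derM (der_id t) (der_cst t x).
by apply: (der_eq (@der_comp _ cos (fun t => t * x) t _ _ (is_derive_cos _) d)); ring.
Qed.

Lemma sinM_der (t x : R) : is_derive t 1 (fun t => sin (t * x)) (cos (t * x) * x).
Proof.
have d : is_derive t 1 (fun t => t * x) (1 * x + t * 0) := derM (der_id t) (der_cst t x).
by apply: (der_eq (@der_comp _ sin (fun t => t * x) t _ _ (is_derive_sin _) d)); ring.
Qed.

Lemma norm_cos_le1 (x : R) : `|cos x| <= 1.
Proof. by rewrite ler_norml cos_geN1 cos_le1. Qed.

Lemma norm_sin_le1 (x : R) : `|sin x| <= 1.
Proof. by rewrite ler_norml sin_geN1 sin_le1. Qed.

Lemma cosM_measurable (t : R) : measurable_fun [set: R] (fun x => cos (t * x)).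
Proof.
by apply: continuous_measurable; apply: derivative_continuous.
Qed.

Lemma sinM_measurable (t : R) : measurable_fun [set: R] (fun x => sin (t * x)).
Proof.
by apply: continuous_measurable; apply: derivative_continuous.
Qed.

Lemma slow_cosM (t : R) : slow (fun x => cos (t * x)).
Proof. by apply: (slow_bounded (M := 1)) => [|x]; [exact: cosM_measurable|exact: norm_cos_le1]. Qed.

Lemma slow_sinM (t : R) : slow (fun x => sin (t * x)).
Proof. by apply: (slow_bounded (M := 1)) => [|x]; [exact: sinM_measurable|exact: norm_sin_le1]. Qed.

Lemma L1_slow_gau p s : slow p -> 0 < s -> L1 (fun x => p x * gau s x).
Proof. by move=> /slow_tame[_ h] s0; exact: h. Qed.

(** The transform of [gau s] is a multiple of [gau (dual s)]. *)
Definition dual (s : R) : R := (4 * s)^-1.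

Lemma dual_gt0 (s : R) : 0 < s -> 0 < dual s.
Proof. by move=> s0; rewrite invr_gt0 mulr_gt0. Qed.

Lemma gau_der0 (s x : R) : is_derive x 1 (gau s) (- (2 * s * x) * gau s x).
Proof.
have := gau_der s 0 x; rewrite subr0.
by congr is_derive; apply/funext => y; rewrite subr0.
Qed.

Lemma gau_der0_continuous (s : R) : continuous (fun x => - (2 * s * x) * gau s x).
Proof.
have dl (x : R) := derN (derM (der_cst x (2 * s)) (der_id x)).
exact: (derivative_continuous (fun x => derM (dl x) (gau_der0 s x))).
Qed.

Lemma AC_gau (s : R) : AC (gau s) (fun x => - (2 * s * x) * gau s x).
Proof. exact: (AC_der (gau_der0 s) (@gau_der0_continuous s)). Qed.

Lemma AC_cosM (t : R) : AC (fun x => cos (t * x)) (fun x => - (t * sin (t * x))).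
Proof.
have d (x : R) : is_derive x 1 (fun x => cos (t * x)) (- (t * sin (t * x))).
  have -> : (fun x => cos (t * x)) = (fun x => cos (x * t)) by apply/funext => y; rewrite mulrC.
  by apply: (der_eq (cosM_der x t)); rewrite mulNr mulrC [x * t]mulrC.
have d' (x : R) : is_derive x 1 (fun x => - (t * sin (t * x))) (- (t * (t * cos (t * x)))).
  have -> : (fun x => - (t * sin (t * x))) = (fun x => - (t * sin (x * t))).
    by apply/funext => y; rewrite [y * t]mulrC.
  by apply: (der_eq (derN (derZ t (sinM_der x t)))); rewrite [x * t]mulrC [cos _ * t]mulrC.
exact: (AC_der d (derivative_continuous d')).
Qed.

Lemma AC_sinM (t : R) : AC (fun x => sin (t * x)) (fun x => t * cos (t * x)).
Proof.
have d (x : R) : is_derive x 1 (fun x => sin (t * x)) (t * cos (t * x)).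
  have -> : (fun x => sin (t * x)) = (fun x => sin (x * t)) by apply/funext => y; rewrite mulrC.
  by apply: (der_eq (sinM_der x t)); rewrite mulrC [x * t]mulrC.
have d' (x : R) : is_derive x 1 (fun x => t * cos (t * x)) (t * (- (t * sin (t * x)))).
  have -> : (fun x => t * cos (t * x)) = (fun x => t * cos (x * t)).
    by apply/funext => y; rewrite [y * t]mulrC.
  by apply: (der_eq (derZ t (cosM_der x t))); rewrite mulNr [sin _ * t]mulrC [x * t]mulrC.
exact: (AC_der d (derivative_continuous d')).
Qed.

Lemma Int_sin_gau (s t : R) : 0 < s -> Int (fun x => sin (t * x) * gau s x) = 0.
Proof.
move=> s0; have lu := L1_slow_gau (slow_sinM t) s0.
have := Int_opp (L1_measurable lu).
rewrite (_ : (fun x => _) = fun x => - (sin (t * x) * gau s x)); last first.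
  by apply/funext => x; rewrite mulrN sinN gauN mulNr.
rewrite IntN// => h; lra.
Qed.

(** As a function J of t, the integral satisfies J' = - t J / (2 s), by differentiation under the
    integral and integration by parts; hence J e^(t^2 / (4 s)) is constant. *)
Lemma Int_cos_gau (s t : R) : 0 < s ->
  Int (fun x => cos (t * x) * gau s x) = Kg s * gau (dual s) t.
Proof.
move=> s0; pose J (t : R) := Int (fun x => cos (t * x) * gau s x).
have lc t' : L1 (fun x => cos (t' * x) * gau s x) by exact: L1_slow_gau (slow_cosM t') s0.
have lsx t' : L1 (fun x => x * sin (t' * x) * gau s x).
  by apply: L1_slow_gau => //; exact: slowM slow_id (slow_sinM t').
have dJ (t' : R) : is_derive t' 1 J (- (2 * s)^-1 * t' * J t').
  have h : is_derive t' 1 J (Int (fun x => - sin (t' * x) * x * gau s x)).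
    apply: (@der_Int (fun t x => cos (t * x) * gau s x)
             (fun t x => - sin (t * x) * x * gau s x) (fun x => `|x * gau s x|)).
    - exact: lc.
    - move=> t'' x; apply: (der_eq (derM (cosM_der t'' x) (der_cst t'' (gau s x)))).
      by rewrite mulr0 addr0.
    - exact/L1_abs/L1_slow_gau/s0/slow_id.
    - move=> t'' x _; rewrite -mulrA normrM ler_piMl// normrN; exact: norm_sin_le1.
  apply: (der_eq h).
  have lsg : L1 (fun x => sin (t' * x) * gau s x) by exact: L1_slow_gau (slow_sinM t') s0.
  have E1 : (fun x => sin (t' * x) * (- (2 * s * x) * gau s x)) =
            (fun x => - (2 * s) * (x * sin (t' * x) * gau s x)).
    by apply/funext => x; ring.
  have E2 : (fun x => t' * cos (t' * x) * gau s x) = (fun x => t' * (cos (t' * x) * gau s x)).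
    by apply/funext => x; rewrite mulrA.
  have := AC_parts (AC_sinM t') (AC_gau s) lsg.
  rewrite E1 E2 => /(_ (L1Z _ (lc t')) (L1Z _ (lsx t'))).
  rewrite !IntZ// -/(J t') => E3.
  have -> : (fun x => - sin (t' * x) * x * gau s x) = (fun x => (-1) * (x * sin (t' * x) * gau s x)).
    by apply/funext => x; ring.
  rewrite IntZ//.
  have -> : - (2 * s)^-1 * t' * J t' = - (2 * s)^-1 * (t' * J t') by ring.
  by rewrite E3; field; rewrite gt_eqF.
have dE (t' : R) : is_derive t' 1 (fun t => J t * expR (dual s * t ^+ 2)) 0.
  have d2 : is_derive t' 1 (fun t => expR (dual s * (t * t))) (expR (dual s * (t' * t')) * (dual s * (1 * t' + t' * 1))).
    exact: (@der_comp _ expR (fun t => dual s * (t * t)) t' _ _ (is_derive_expR _) (derZ _ (derM (der_id t') (der_id t')))).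
  apply: (der_eq (derM (dJ t') d2)); rewrite /dual; move: (expR _) (J t') => E J'.
  by field; rewrite gt_eqF.
have := is_derive_0_is_cst t 0 dE.
rewrite expr0n/= mulr0 expR0 mulr1 -/(J t).
have -> : J 0 = Kg s.
  by congr Int; apply/funext => x; rewrite mul0r cos0 mul1r.
by move=> <-; rewrite /gau -mulrA -expRD subrr expR0 mulr1.
Qed.

Lemma Int_cos_gau_center (s z t : R) : 0 < s ->
  Int (fun x => cos (t * x) * gau s (x - z)) = cos (t * z) * (Kg s * gau (dual s) t).
Proof.
move=> s0; have l1 := L1_slow_gau (slow_cosM t) s0.
have l2 := L1_slow_gau (slow_sinM t) s0.
have l3 : L1 (fun x => cos (t * x) * gau s (x - z)).
  by apply: tame_gau_center => //; exact: slow_tame (slow_cosM t).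
rewrite -(Int_shift z (L1_measurable l3)) -Int_cos_gau//.
have -> : (fun x => cos (t * (x + z)) * gau s (x + z - z)) =
   (fun x => cos (t * z) * (cos (t * x) * gau s x) - sin (t * z) * (sin (t * x) * gau s x)).
  by apply/funext => x; rewrite addrK mulrDr cosD; ring.
by rewrite IntB ?IntZ//; [rewrite Int_sin_gau// mulr0 subr0|exact: L1Z|exact: L1Z].
Qed.

Lemma Int_sin_gau_center (s z t : R) : 0 < s ->
  Int (fun x => sin (t * x) * gau s (x - z)) = sin (t * z) * (Kg s * gau (dual s) t).
Proof.
move=> s0; have l1 := L1_slow_gau (slow_cosM t) s0.
have l2 := L1_slow_gau (slow_sinM t) s0.
have l3 : L1 (fun x => sin (t * x) * gau s (x - z)).
  by apply: tame_gau_center => //; exact: slow_tame (slow_sinM t).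
rewrite -(Int_shift z (L1_measurable l3)) -Int_cos_gau//.
have -> : (fun x => sin (t * (x + z)) * gau s (x + z - z)) =
   (fun x => sin (t * z) * (cos (t * x) * gau s x) + cos (t * z) * (sin (t * x) * gau s x)).
  by apply/funext => x; rewrite addrK mulrDr sinD; ring.
by rewrite IntD ?IntZ//; [rewrite Int_sin_gau// mulr0 addr0|exact: L1Z|exact: L1Z].
Qed.

Lemma Kg_le (s t : R) : 0 < s -> s <= t -> Kg t <= Kg s.
Proof.
move=> s0 st; apply: le_Int; [apply: L1_gau; exact: lt_le_trans st|exact: L1_gau|].
by move=> x; rewrite ler_expR lerN2 ler_wpM2r ?sqr_ge0.
Qed.

Section smoothing.
Context (a b : R).
Hypothesis ab : a <= b.

(** The convolution of an indicator with the normalized Gaussian of parameter n + 1. It converges to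
    the indicator off the endpoints, and Fubini reduces its pairing with a function to Gaussian
    pairings. *)
Definition smoothed_indic (n : nat) (y : R) : R :=
  Int (fun t => \1_(`]a, b]%classic : set R) t * gau n.+1%:R (t - y)) / Kg n.+1%:R.

Let N0 n : 0 < n.+1%:R :> R. Proof. by rewrite ltr0n. Qed.

Let lig n y : L1 (fun t => \1_(`]a, b]%classic : set R) t * gau n.+1%:R (t - y)).
Proof. by apply: tame_gau_center => //; exact: L1_tame (L1_indic_itv a b). Qed.

Let lg n y : L1 (fun t : R => gau n.+1%:R (t - y)).
Proof. exact: (L1_shift (- y) (L1_gau (N0 n))). Qed.

Lemma smoothed_indic_bound n y : `|smoothed_indic n y| <= 1.
Proof.
rewrite /smoothed_indic ger0_norm; last first.
  rewrite divr_ge0 ?(ltW (Kg_gt0 _))//; apply: Int_ge0 => t.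
  by rewrite mulr_ge0 ?gau_ge0.
rewrite ler_pdivrMr ?Kg_gt0// mul1r -(Int_gau_center y (N0 n)); apply: le_Int => // t.
by rewrite ler_piMl ?gau_ge0// (le_trans (ler_norm _))// indic_itv_le1.
Qed.

(** Only |t - y| >= d contributes. There one half of the exponent gives e^(-N d^2 / 2), the other
    half keeps a mass of at most [Kg 2^-1], and dividing by [Kg N], which is at least e^(-1) / N,
    costs the factor N e. *)
Lemma smoothed_indic_near n (y d : R) : 0 < d ->
  (forall t, `|t - y| < d -> \1_(`]a, b]%classic : set R) t = \1_(`]a, b]%classic : set R) y :> R) ->
  `|smoothed_indic n y - \1_(`]a, b]%classic : set R) y| <=
   n.+1%:R * expR 1 * Kg 2^-1 * expR (- (n.+1%:R * (d ^+ 2 / 2))).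
Proof.
move=> d0 hd; set N : R := n.+1%:R; set I := \1__.
have N1 : 1 <= N by rewrite ler1n.
have K0 : 0 < Kg N by exact: Kg_gt0.
have -> : smoothed_indic n y - I y = Int (fun t => (I t - I y) * gau N (t - y)) / Kg N.
  have -> : (fun t => (I t - I y) * gau N (t - y)) = (fun t => I t * gau N (t - y) - I y * gau N (t - y)).
    by apply/funext => t; rewrite mulrBl.
  rewrite IntB//; [|exact: lig|exact/L1Z/lg].
  by rewrite IntZ; [rewrite Int_gau_center// mulrBl mulfK// gt_eqF|exact: lg].
have lI : L1 (fun t => (I t - I y) * gau N (t - y)).
  have -> : (fun t => (I t - I y) * gau N (t - y)) = (fun t => I t * gau N (t - y) - I y * gau N (t - y)).
    by apply/funext => t; rewrite mulrBl.
  by apply: L1B; [exact: lig|exact/L1Z/lg].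
have N20 : 0 < N / 2 by rewrite divr_gt0.
rewrite normrM normfV (gtr0_norm K0) ler_pdivrMr//.
apply: (le_trans (Int_abs lI)).
apply: (@le_trans _ _ (expR (- (N * (d ^+ 2 / 2))) * Kg (N / 2))).
  rewrite -(Int_gau_center y N20) -IntZ; last exact: (L1_shift (- y) (L1_gau N20)).
  apply: le_Int; [exact: L1_abs|exact/L1Z/(L1_shift (- y) (L1_gau N20))|] => t.
  have [td|dt] := ltP `|t - y| d.
    by rewrite /I (hd _ td) subrr mul0r normr0; apply: mulr_ge0; exact: expR_ge0.
  rewrite normrM (ger0_norm (gau_ge0 _ _)) [gau N _]gau_half. rewrite [leLHS]mulrA ler_wpM2r ?gau_ge0//.
  rewrite -[leRHS]mul1r; apply: ler_pM; rewrite ?gau_ge0//.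
    rewrite /I !indicE; case: (_ \in _); case: (_ \in _); rewrite ?subrr ?subr0 ?sub0r ?normr0 ?normrN ?normr1//.
  rewrite ler_expR lerN2 (_ : N * (d ^+ 2 / 2) = N / 2 * d ^+ 2) ?ler_wpM2l ?(ltW N20)//; last by ring.
  by rewrite -[(t - y) ^+ 2]real_normK ?num_real// ler_sqr ?nnegrE ?(ltW d0).
have Kh : Kg (N / 2) <= Kg 2^-1 by apply: Kg_le => //; lra.
have KN : 1 <= N * expR 1 * Kg N.
  have E : N * expR 1 * (expR (- 1) / N) = 1.
    by rewrite expRN; field; rewrite !gt_eqF ?expR_gt0// (lt_le_trans ltr01).
  by rewrite -[leLHS]E ler_wpM2l ?Kg_ge// mulr_ge0 ?expR_ge0// (le_trans ler01).
set E := expR _.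
have -> : N * expR 1 * Kg 2^-1 * E * Kg N = (N * expR 1 * Kg N) * (E * Kg 2^-1) by ring.
rewrite -[leLHS]mul1r; apply: ler_pM.
- exact: ler01.
- exact: mulr_ge0 (expR_ge0 _) (ltW (Kg_gt0 N20)).
- exact: KN.
- exact: ler_wpM2l (expR_ge0 _) _ _ Kh.
Qed.

Lemma smoothed_indic_cvg (y : R) : y != a -> y != b ->
  smoothed_indic n y @[n --> \oo] --> (\1_(`]a, b]%classic : set R) y : R).
Proof.
move=> ya yb; pose d := Num.min `|y - a| `|y - b|.
have d0 : 0 < d by rewrite lt_min !normr_gt0 !subr_eq0 ya yb.
have hd t : `|t - y| < d ->
    \1_(`]a, b]%classic : set R) t = \1_(`]a, b]%classic : set R) y :> R.
  rewrite lt_min => /andP[]; rewrite !indic_itvE => h1 h2.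
  have E c : y != c -> `|t - y| < `|y - c| -> (t < c) = (y < c).
    move=> yc; have := ler_norm (t - y); have := ler_norm (y - t); rewrite distrC.
    have [yc'|yc'|/eqP] := ltgtP y c; last by rewrite (negbTE yc).
      have -> : `|y - c| = c - y by rewrite ltr0_norm ?subr_lt0// opprB.
      by move=> k1 k2 k3; apply/idP; lra.
    have -> : `|y - c| = y - c by rewrite gtr0_norm ?subr_gt0.
    by move=> k1 k2 k3; apply/negbTE; rewrite -leNgt; lra.
  have tb : t != b by apply: contraTneq h2 => ->; rewrite distrC ltxx.
  have ta : t != a by apply: contraTneq h1 => ->; rewrite distrC ltxx.
  by rewrite !le_eqVlt (negbTE tb) (negbTE yb)/= (E _ yb h2) !ltNge !le_eqVlt (negbTE ta) (negbTE ya)/= (E _ ya h1).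
apply/cvgrPdist_le => e e0.
pose A := expR 1 * Kg (2^-1 : R); pose q := d ^+ 2 / 2.
have A0 : 0 < A by rewrite mulr_gt0 ?expR_gt0// Kg_gt0// invr_gt0.
have q0 : 0 < q by rewrite divr_gt0 ?exprn_gt0.
have aux (N q' A' : R) : N != 0 -> q' != 0 -> A' * 2 / q' ^+ 2 / N * ((N * q') ^+ 2 / 2) = N * A'.
  by move=> Nn0 qn0; field; rewrite qn0 Nn0.
near=> n.
have hn : e^-1 * (A * 2 / q ^+ 2) <= n%:R by near: n; exact: nbhs_infty_ger.
rewrite distrC; apply: (le_trans (smoothed_indic_near n d0 hd)).
set N : R := n.+1%:R.
have Nq : 0 < N * q by rewrite mulr_gt0.
(* The quadratic lower bound on the exponential, against the single factor N in front, leaves an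
   error of order 1/N. *)
have E2 : (N * q) ^+ 2 / 2 <= expR (N * q).
  by rewrite ler_pdivrMr// [leRHS]mulrC; have := exprn_le_expR 2 (ltW Nq).
apply: (@le_trans _ _ (A * 2 / q ^+ 2 / N)).
  rewrite expRN (_ : N * expR 1 * Kg 2^-1 = N * A); last by rewrite /A mulrA.
  rewrite ler_pdivrMr ?expR_gt0//; apply: (@le_trans _ _ (A * 2 / q ^+ 2 / N * ((N * q) ^+ 2 / 2))).
    have -> : A * 2 / q ^+ 2 / N * ((N * q) ^+ 2 / 2) = N * A.
      exact: (aux _ _ _ (lt0r_neq0 (N0 n)) (lt0r_neq0 q0)).
    exact: lexx.
  apply: ler_wpM2l E2; apply: divr_ge0; last exact: ltW.
  by apply: divr_ge0; [exact: mulr_ge0 (ltW A0) _|exact: exprn_ge0 (ltW q0)].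
rewrite ler_pdivrMr// -ler_pdivrMl//.
by apply: (le_trans hn); rewrite ler_nat.
Unshelve. all: by end_near. Qed.

End smoothing.

(** Fubini moves the smoothing from the indicator to [h], where it gives zero; sharpening the
    smoothing then kills every interval integral of [h]. *)
Lemma gaussian_uniqueness_L1 h : L1 h ->
  (forall s z, 0 < s -> Int (fun x => h x * gau s (x - z)) = 0) ->
  {ae mu, forall x, h x = 0}.
Proof.
move=> lh h0; apply: ae0_of_itv; first exact: L1_Lloc.
move=> a b ab.
have mh := L1_measurable lh; have li := L1_indic_itv a b; have mi := L1_measurable li.
have N0 n : 0 < n.+1%:R :> R by rewrite ltr0n.
have mG n : measurable_fun [set: R * R] (fun z => h z.1 * (\1_(`]a, b]%classic : set R) z.2 * gau n.+1%:R (z.2 - z.1))).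
  apply: measurable_funM; first exact: (measurableT_comp mh measurable_fst).
  apply: measurable_funM; first exact: (measurableT_comp mi measurable_snd).
  by apply: (measurableT_comp (gau_measurable _)); apply: measurable_funB; [exact: measurable_snd|exact: measurable_fst].
have iG n : (\int[mu]_x \int[mu]_y `|h x * (\1_(`]a, b]%classic : set R) y * gau n.+1%:R (y - x))|%:E < +oo)%E.
  apply: (fubini_dom (mG n) (L1_abs lh) (L1_abs li)) => x y.
  rewrite !normrM ler_wpM2l// ler_piMr// (ger0_norm (gau_ge0 _ _)).
  by rewrite gau_le1// ltW.
have mS n : measurable_fun [set: R] (fun y => h y * smoothed_indic a b n y).
  have -> : (fun y => h y * smoothed_indic a b n y) =
     fun x => (Kg n.+1%:R)^-1 * Int (fun y => h x * (\1_(`]a, b]%classic : set R) y * gau n.+1%:R (y - x))).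
    apply/funext => x; rewrite IntZ /smoothed_indic; first by ring.
    by apply: tame_gau_center => //; exact: L1_tame.
  by apply: measurable_funM => //; exact: L1_measurable (fubini_L1l (mG n) (iG n)).
have [_ lim] : L1 (fun x => h x * \1_(`]a, b]%classic : set R) x) /\
    Int (fun y => h y * smoothed_indic a b n y) @[n --> \oo] --> II a b h.
  apply: (dominated_convergence_Int_ae (g := fun x => `|h x|)) => //.
  - exact: measurable_funM.
  - exact: L1_abs.
  - by move=> n x; rewrite normrM ler_piMr// smoothed_indic_bound.
  - apply: ae_imp (ae_and (ae_neq a) (ae_neq b)) => x [xa xb].
    by apply: cvgMr; exact: smoothed_indic_cvg.
apply: (cvg_unique _ lim); first exact: Rhausdorff.
rewrite (_ : (fun n => _) = fun=> 0); first exact: cvg_cst.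
apply/funext => n.
transitivity ((Kg n.+1%:R)^-1 * Int (fun x => Int (fun y => h x * (\1_(`]a, b]%classic : set R) y * gau n.+1%:R (y - x))))).
  rewrite -IntZ; last exact: fubini_L1l (mG n) (iG n).
  congr Int; apply/funext => x; rewrite IntZ /smoothed_indic; first by ring.
  by apply: tame_gau_center => //; exact: L1_tame.
rewrite (fubini_Int (mG n) (iG n)) (_ : (fun y => _) = fun=> 0) ?Int0 ?mulr0//.
apply/funext => y.
have -> : (fun x => h x * (\1_(`]a, b]%classic : set R) y * gau n.+1%:R (y - x))) =
    (fun x => \1_(`]a, b]%classic : set R) y * (h x * gau n.+1%:R (x - y))).
  by apply/funext => x; rewrite -gauN opprB mulrCA.
by rewrite IntZ ?h0 ?mulr0//; apply: tame_gau_center => //; exact: L1_tame.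
Qed.

(** Multiplying by [gau 1] makes [h] integrable, and a product of two Gaussians is, up to a
    constant, the Gaussian of parameter 1 + s centred at s z / (1 + s). *)
Lemma gaussian_uniqueness h : tame h ->
  (forall s z, 0 < s -> Int (fun x => h x * gau s (x - z)) = 0) ->
  {ae mu, forall x, h x = 0}.
Proof.
move=> [mh lh] h0.
have l1 : L1 (fun x => h x * gau 1 x) by exact: lh.
apply: (ae_imp _ (gaussian_uniqueness_L1 l1 _)).
  by move=> x /eqP; rewrite mulf_eq0 (gt_eqF (gau_gt0 _ _)) orbF => /eqP.
move=> s z s0.
have s1 : 0 < 1 + s by rewrite addr_gt0.
have -> : (fun x => h x * gau 1 x * gau s (x - z)) =
    (fun x => expR (- (s * z ^+ 2 / (1 + s))) * (h x * gau (1 + s) (x - s * z / (1 + s)))).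
  apply/funext => x; rewrite -mulrA [RHS]mulrCA; congr (_ * _).
  by rewrite /gau -!expRD; congr expR; field; rewrite gt_eqF.
by rewrite IntZ ?h0 ?mulr0//; exact: tame_gau_center.
Qed.

End gaussian_transform.

(** * Fourier pairs: linearity, uniqueness, transforms of integrable functions *)

Section fourier_pairs.
Context {R : realType}.
Notation mu := (@lebesgue_measure R).
Implicit Types (f g h p F G : R -> R) (s z : R).

(** Read off the normal density of variance 1/(2 s). The exact value serves to obtain the constant 2
    pi of the inversion formula. *)
Lemma Kg_sqrt s : 0 < s -> Kg s = Num.sqrt (pi / s).
Proof.
move=> s0; pose sg := Num.sqrt ((2 * s)^-1).
have ss : 0 < (2 * s)^-1 by rewrite invr_gt0 mulr_gt0.
have sg2 : sg ^+ 2 = (2 * s)^-1 by rewrite sqr_sqrtr// ltW.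
have sg0 : sg != 0 by rewrite gt_eqF// sqrtr_gt0.
have := integral_normal_pdf (0 : R) sg; rewrite (normal_pdfE _ sg0).
have -> : (fun x : R => (normal_peak sg * normal_fun 0 sg x)%:E) =
   (fun x => (normal_peak sg * gau s x)%:E).
  apply/funext => x; congr (_ * _)%:E; rewrite /normal_fun /gau subr0; congr expR.
  by rewrite sg2 -mulr_natr; field; rewrite gt_eqF.
rewrite -IntE; last exact/L1Z/L1_gau.
rewrite IntZ; last exact: L1_gau.
move=> [] h.
have pk : normal_peak sg = (Num.sqrt (pi / s))^-1.
  rewrite /normal_peak sg2; congr (Num.sqrt _)^-1.
  by rewrite -mulr_natr; field; rewrite gt_eqF.
have q0 : Num.sqrt (pi / s) != 0 by rewrite gt_eqF// sqrtr_gt0 divr_gt0// pi_gt0.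
by rewrite -[LHS]mul1r -(mulfV q0) -pk -mulrA h mulr1.
Qed.

Lemma Kg_dual s : 0 < s -> Kg s * Kg (dual s) = 2 * pi.
Proof.
move=> s0; have d0 := dual_gt0 s0; have p0 := pi_gt0 R.
rewrite !Kg_sqrt// -sqrtrM ?divr_ge0 ?(ltW s0) ?(ltW p0)//.
have -> : pi / s * (pi / dual s) = (2 * pi) ^+ 2.
  by rewrite /dual invrK; field; rewrite gt_eqF.
by rewrite sqrtr_sqr ger0_norm// mulr_ge0// ltW.
Qed.

Lemma dualK s : 0 < s -> dual (dual s) = s.
Proof. by move=> s0; rewrite /dual; field; rewrite gt_eqF. Qed.

(* h1 + i h2 is the Fourier transform of f, tested against the Gaussians of
   parameter s centred at z, whose transform is Kg s e^(-i z x) gau (dual s) x. *)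
Definition FP f h1 h2 : Prop := [/\ tame f, tame h1, tame h2 &
  forall s z, 0 < s ->
    Kg s * Int (fun x => f x * (cos (z * x) * gau (dual s) x)) =
      Int (fun x => h1 x * gau s (x - z)) /\
    - (Kg s * Int (fun x => f x * (sin (z * x) * gau (dual s) x))) =
      Int (fun x => h2 x * gau s (x - z))].

Lemma tame_cos f s z : tame f -> 0 < s -> L1 (fun x => f x * (cos (z * x) * gau s x)).
Proof.
move=> tf s0; have [_ h] := tame_slow tf (slow_cosM z).
by under eq_fun do rewrite mulrA; exact: h.
Qed.

Lemma tame_sin f s z : tame f -> 0 < s -> L1 (fun x => f x * (sin (z * x) * gau s x)).
Proof.
move=> tf s0; have [_ h] := tame_slow tf (slow_sinM z).
by under eq_fun do rewrite mulrA; exact: h.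
Qed.

Lemma FPD f g h1 h2 k1 k2 : FP f h1 h2 -> FP g k1 k2 ->
  FP (fun x => f x + g x) (fun x => h1 x + k1 x) (fun x => h2 x + k2 x).
Proof.
move=> [tf th1 th2 fh] [tg tk1 tk2 gk]; split; [exact: tameD..|] => s z s0.
have [fh1 fh2] := fh s z s0; have [gk1 gk2] := gk s z s0; have d0 := dual_gt0 s0.
split.
- under eq_fun do rewrite mulrDl; under [in RHS]eq_fun do rewrite mulrDl.
  rewrite !IntD ?mulrDr ?fh1 ?gk1//; [exact: tame_gau_center|exact: tame_gau_center|exact: tame_cos|exact: tame_cos].
- under eq_fun do rewrite mulrDl; under [in RHS]eq_fun do rewrite mulrDl.
  rewrite !IntD ?mulrDr ?opprD ?fh2 ?gk2//; [exact: tame_gau_center|exact: tame_gau_center|exact: tame_sin|exact: tame_sin].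
Qed.

Lemma FPZ c f h1 h2 : FP f h1 h2 ->
  FP (fun x => c * f x) (fun x => c * h1 x) (fun x => c * h2 x).
Proof.
move=> [tf th1 th2 fh]; split; [exact: tameZ..|] => s z s0.
have [fh1 fh2] := fh s z s0; have d0 := dual_gt0 s0.
split.
- under eq_fun do rewrite -mulrA; under [in RHS]eq_fun do rewrite -mulrA.
  by rewrite IntZ ?IntZ -?fh1; [rewrite mulrCA|exact: tame_gau_center|exact: tame_cos].
- under eq_fun do rewrite -mulrA; under [in RHS]eq_fun do rewrite -mulrA.
  by rewrite IntZ ?IntZ -?fh2; [rewrite mulrCA mulrN|exact: tame_gau_center|exact: tame_sin].
Qed.

Lemma FP_eqf f g h1 h2 : f =1 g -> FP f h1 h2 -> FP g h1 h2.
Proof. by move=> /funext ->. Qed.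

Lemma FP_unique f h1 h2 k1 k2 : FP f h1 h2 -> FP f k1 k2 ->
  {ae mu, forall x, h1 x = k1 x /\ h2 x = k2 x}.
Proof.
move=> [tf th1 th2 fh] [_ tk1 tk2 fk]; apply: ae_and.
- apply: (ae_imp _ (gaussian_uniqueness (tameB th1 tk1) _)).
    by move=> x /eqP; rewrite subr_eq0 => /eqP.
  move=> s z s0; have [fh1 _] := fh s z s0; have [fk1 _] := fk s z s0.
  under eq_fun do rewrite mulrBl.
  by rewrite IntB -?fh1 -?fk1 ?subrr//; exact: tame_gau_center.
- apply: (ae_imp _ (gaussian_uniqueness (tameB th2 tk2) _)).
    by move=> x /eqP; rewrite subr_eq0 => /eqP.
  move=> s z s0; have [_ fh1] := fh s z s0; have [_ fk1] := fk s z s0.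
  under eq_fun do rewrite mulrBl.
  by rewrite IntB -?fh1 -?fk1 ?subrr//; exact: tame_gau_center.
Qed.

Lemma kernel_measurable (c : R) (k : R -> R) s : continuous k ->
  measurable_fun [set: R * R] (fun w => k (w.2 * (w.1 - c)) * gau s w.2).
Proof.
move=> ck; apply: measurable_funM; last exact: (measurableT_comp (gau_measurable s) measurable_snd).
apply: (measurableT_comp (continuous_measurable ck)).
apply: measurable_funM; first exact: measurable_snd.
by apply: measurable_funB; [exact: measurable_fst|exact: measurable_cst].
Qed.

(** A Gaussian centred at [a] is a superposition of the functions cos (y (x - a)) with Gaussian
    weight in y. By Fubini, the pairings of f [gau 1] with Gaussians are integrals of the vanishing
    trigonometric ones. *)
Lemma trig_injective f : tame f ->
  (forall s z, 0 < s -> Int (fun x => f x * (cos (z * x) * gau s x)) = 0) ->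
  (forall s z, 0 < s -> Int (fun x => f x * (sin (z * x) * gau s x)) = 0) ->
  {ae mu, forall x, f x = 0}.
Proof.
move=> [mf tf] fc fs.
have lF : L1 (fun x => f x * gau 1 x) by exact: tf.
apply: (ae_imp _ (gaussian_uniqueness_L1 lF _)).
  by move=> x /eqP; rewrite mulf_eq0 (gt_eqF (gau_gt0 _ _)) orbF => /eqP.
move=> d a d0; set F := fun x => f x * gau 1 x; have mF := L1_measurable lF.
have s0 := dual_gt0 d0; set s := dual d in s0.
have mK : measurable_fun [set: R * R] (fun w => F w.1 * (cos (w.2 * (w.1 - a)) * gau s w.2)).
  apply: measurable_funM; first exact: (measurableT_comp mF measurable_fst).
  by apply: (kernel_measurable a); exact: continuous_cos.
have iK : (\int[mu]_x \int[mu]_y `|F x * (cos (y * (x - a)) * gau s y)|%:E < +oo)%E.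
  apply: (fubini_dom mK (L1_abs lF) (L1_gau s0)) => x y.
  rewrite normrM ler_wpM2l// normrM (ger0_norm (gau_ge0 _ _)) ler_piMl ?gau_ge0//.
  exact: norm_cos_le1.
have : Kg s * Int (fun x => F x * gau d (x - a)) = 0; last first.
  by move=> /eqP; rewrite mulf_eq0 (gt_eqF (Kg_gt0 s0)) => /eqP.
rewrite -IntZ; last by apply: tame_gau_center => //; exact: L1_tame.
have -> : (fun x => Kg s * (F x * gau d (x - a))) =
   (fun x => Int (fun y => F x * (cos (y * (x - a)) * gau s y))).
  apply/funext => x; rewrite IntZ; last first.
    by under eq_fun do rewrite [_ * (x - a)]mulrC; exact: L1_slow_gau (slow_cosM _) s0.
  under eq_fun do rewrite [_ * (x - a)]mulrC.
  by rewrite Int_cos_gau// dualK// mulrCA.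
rewrite (fubini_Int mK iK) (_ : (fun y => _) = fun=> 0) ?Int0//; apply/funext => y.
have -> : (fun x => F x * (cos (y * (x - a)) * gau s y)) = (fun x =>
   gau s y * cos (y * a) * (f x * (cos (y * x) * gau 1 x)) + gau s y * sin (y * a) * (f x * (sin (y * x) * gau 1 x))).
  by apply/funext => x; rewrite mulrBr cosB /F; ring.
have tf' : tame f by [].
by rewrite IntD ?IntZ ?fc ?fs ?mulr0 ?addr0//; [exact: tame_sin|exact: tame_cos|exact/L1Z/tame_cos|exact/L1Z/tame_sin].
Qed.

Lemma FP_inj f g h1 h2 : FP f h1 h2 -> FP g h1 h2 -> {ae mu, forall x, f x = g x}.
Proof.
move=> [tf _ _ fh] [tg _ _ gh].
apply: (ae_imp _ (trig_injective (tameB tf tg) _ _)).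
- by move=> x /eqP; rewrite subr_eq0 => /eqP.
- move=> s z s0; have d0 := dual_gt0 s0.
  have [fh1 _] := fh _ z d0; have [gh1 _] := gh _ z d0.
  rewrite dualK// in fh1 gh1.
  under eq_fun do rewrite mulrBl.
  rewrite IntB; [|exact: tame_cos|exact: tame_cos].
  by apply/eqP; rewrite subr_eq0; apply/eqP; apply: (mulfI (lt0r_neq0 (Kg_gt0 d0))); rewrite fh1 gh1.
- move=> s z s0; have d0 := dual_gt0 s0.
  have [_ fh1] := fh _ z d0; have [_ gh1] := gh _ z d0.
  rewrite dualK// in fh1 gh1.
  under eq_fun do rewrite mulrBl.
  rewrite IntB; [|exact: tame_sin|exact: tame_sin].
  by apply/eqP; rewrite subr_eq0; apply/eqP; apply: (mulfI (lt0r_neq0 (Kg_gt0 d0))); apply: oppr_inj; rewrite fh1 gh1.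
Qed.

Section transform_of_L1.
Context (Q : R -> R) (k : R -> R).
Hypothesis lQ : L1 Q.
Hypothesis ck : continuous k.
Hypothesis k1 : forall x, `|k x| <= 1.

Let mQk : measurable_fun [set: R * R] (fun w => Q w.1 * k (w.2 * w.1)).
Proof.
apply: measurable_funM; first exact: (measurableT_comp (L1_measurable lQ) measurable_fst).
apply: (measurableT_comp (continuous_measurable ck)).
by apply: measurable_funM; [exact: measurable_snd|exact: measurable_fst].
Qed.

Let lQk y : L1 (fun x => Q x * k (y * x)).
Proof.
apply: (L1_bnd lQ _ (fun x => k1 (y * x))).
by apply: (measurableT_comp (continuous_measurable ck)); exact: measurable_funM.
Qed.

Let mQkg s z : measurable_fun [set: R * R] (fun w => Q w.1 * k (w.2 * w.1) * gau s (w.2 - z)).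
Proof.
apply: measurable_funM => //.
exact: (measurableT_comp (gau_center_measurable s z) measurable_snd).
Qed.

Let iQkg s z : 0 < s -> (\int[mu]_x \int[mu]_y `|Q x * k (y * x) * gau s (y - z)|%:E < +oo)%E.
Proof.
move=> s0; apply: (fubini_dom (mQkg s z) (L1_abs lQ) (L1_shift (- z) (L1_gau s0))) => x y.
rewrite !normrM (ger0_norm (gau_ge0 _ _)) ler_wpM2r ?gau_ge0//.
by rewrite ler_piMr.
Qed.

Lemma transform_tame : tame (fun y => Int (fun x => Q x * k (y * x))).
Proof.
apply: slow_tame; apply: (slow_bounded (M := Int (fun x => `|Q x|))).
  have := L1_measurable (fubini_L1r (mQkg 1 0) (iQkg 0 ltr01)).
  (* Fubini yields measurability of the transform times a Gaussian; multiplying by e^(y^2) removes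
     that factor. *)
  have mg : measurable_fun [set: R] (fun y : R => expR (y ^+ 2)).
    by apply: measurableT_comp => //; exact: measurable_funX.
  move=> /(measurable_funM mg).
  rewrite (_ : (_ \* _) = (fun y => Int (fun x => Q x * k (y * x))))//.
  apply/funext => y /=; rewrite subr0.
  under eq_fun do rewrite mulrC; rewrite IntZ// /gau mul1r expRN mulrA mulfV ?mul1r//.
  by rewrite gt_eqF// expR_gt0.
move=> y; apply: (le_trans (Int_abs (lQk y))); apply: le_Int; [exact: L1_abs|exact: L1_abs|].
by move=> x; rewrite normrM ler_piMr.
Qed.

Lemma transform_gauss s z : 0 < s ->
  Int (fun y => Int (fun x => Q x * k (y * x)) * gau s (y - z)) =
  Int (fun x => Q x * Int (fun y => k (x * y) * gau s (y - z))).
Proof.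
move=> s0; have := fubini_Int (mQkg s z) (iQkg z s0).
have sk x : slow (fun y => k (x * y)).
  apply: (slow_bounded (M := 1)) => //.
  by apply: (measurableT_comp (continuous_measurable ck)); exact: measurable_funM.
have -> : (fun x => Int (fun y => Q x * k (y * x) * gau s (y - z))) =
   (fun x => Q x * Int (fun y => k (x * y) * gau s (y - z))).
  apply/funext => x; under eq_fun do rewrite -mulrA [_ * x]mulrC.
  by rewrite IntZ//; apply: tame_gau_center => //; exact: slow_tame.
have -> : (fun y => Int (fun x => Q x * k (y * x) * gau s (y - z))) =
   (fun y => Int (fun x => Q x * k (y * x)) * gau s (y - z)).
  by apply/funext => y; under eq_fun do rewrite mulrC; rewrite IntZ// mulrC.
by [].
Qed.

End transform_of_L1.

Lemma FP_L1 Q : L1 Q ->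
  FP Q (fun y => Int (fun x => Q x * cos (y * x))) (fun y => - Int (fun x => Q x * sin (y * x))).
Proof.
move=> lQ.
have tc := transform_tame lQ (@continuous_cos R) norm_cos_le1.
have ts := transform_tame lQ (@continuous_sin R) norm_sin_le1.
have tQ := L1_tame lQ.
split => //.
  by have := tameZ (-1) ts; congr tame; apply/funext => y; rewrite mulN1r.
move=> s z s0; have d0 := dual_gt0 s0; split.
- rewrite (transform_gauss lQ (@continuous_cos R) norm_cos_le1)// -IntZ; last exact: tame_cos.
  congr Int; apply/funext => x; rewrite Int_cos_gau_center//.
  by rewrite [z * x]mulrC; ring.
- have -> : (fun x => - Int (fun x0 => Q x0 * sin (x * x0)) * gau s (x - z)) =
    (fun x => - (Int (fun x0 => Q x0 * sin (x * x0)) * gau s (x - z))).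
    by apply/funext => x; rewrite mulNr.
  rewrite IntN; last exact: tame_gau_center.
  rewrite (transform_gauss lQ (@continuous_sin R) norm_sin_le1)// -IntZ; last exact: tame_sin.
  congr (- _); congr Int; apply/funext => x; rewrite Int_sin_gau_center//.
  by rewrite [z * x]mulrC; ring.
Qed.

End fourier_pairs.

(** * The transform of a derivative *)

Section fourier_derivative.
Context {R : realType}.
Notation mu := (@lebesgue_measure R).
Implicit Types (f g h p F G : R -> R) (s z : R).

Lemma der_trig_transform f (k k' : R -> R) s z : tame f -> 0 < s ->
  (forall x : R, is_derive x 1 k (k' x)) -> continuous k' ->
  (forall x, `|k x| <= 1) -> (forall x, `|k' x| <= 1) ->
  is_derive z 1 (fun t => Int (fun x => f x * (k (t * x) * gau s x)))
    (Int (fun x => f x * (x * k' (z * x) * gau s x))).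
Proof.
move=> tf s0 dk ck' k1 k1'.
have ck := derivative_continuous dk.
have sk t : slow (fun x => k (t * x)).
  apply: (slow_bounded (M := 1)) => //.
  by apply: (measurableT_comp (continuous_measurable ck)); exact: measurable_funM.
apply: (@der_Int _ (fun t x => f x * (k (t * x) * gau s x))
  (fun t x => f x * (x * k' (t * x) * gau s x)) (fun x => `|f x * x * gau s x|)).
- by move=> t; under eq_fun do rewrite mulrA; have [_ h] := tame_slow tf (sk t); exact: h.
- move=> t x.
  have d : is_derive t 1 (fun t => t * x) (1 * x + t * 0) := derM (der_id t) (der_cst t x).
  have := derZ (f x) (derM (@der_comp _ k (fun t => t * x) t _ _ (dk (t * x)) d) (der_cst t (gau s x))).
  by move=> h; apply: (der_eq h); ring.
- by apply: L1_abs; have [_ h] := tame_slow tf slow_id; exact: h.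
- move=> t x _; rewrite !normrM -!mulrA ler_wpM2l// ler_wpM2l//.
  by rewrite ler_piMl.
Qed.

Lemma der_gauss_transform h s z : tame h -> 0 < s ->
  is_derive z 1 (fun t => Int (fun x => h x * gau s (x - t)))
    (Int (fun x => h x * (2 * s * (x - z) * gau s (x - z)))).
Proof.
move=> th s0; have s20 : 0 < s / 2 by rewrite divr_gt0.
(* [B] bounds |t| on the window of [der_Int]; there [p] dominates 2 s (x - t), by |x| <= 1 + x^2. *)
pose B := `|z| + 1; have B0 : 0 <= B by rewrite addr_ge0.
pose p (x : R) := 2 * s * (x ^+ 2 + (1 + B)).
have sp : slow p.
  by apply: slowM; [exact: slow_cst|apply: slowD; [exact: slowX|exact: slow_cst]].
apply: (@der_Int _ (fun t x => h x * gau s (x - t))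
  (fun t x => h x * (2 * s * (x - t) * gau s (x - t)))
  (fun x => `|expR (s * B ^+ 2) * (h x * p x * gau (s / 2) x)|)).
- by move=> t; exact: tame_gau_center.
- move=> t x.
  have d1 : is_derive t 1 (fun t => x - t) (0 - 1) := derB (der_cst t x) (der_id t).
  have h1 := derZ (h x) (@der_comp _ (gau s) (fun t => x - t) t _ _ (gau_der0 s (x - t)) d1).
  by apply: (der_eq h1); ring.
- by apply/L1_abs/L1Z; have [_ hh] := tame_slow th sp; exact: hh.
- move=> t x /andP[t1 t2].
  have tB : `|t| <= B.
    rewrite ler_norml /B; have := ler_norm z; have := ler_norm (- z); rewrite normrN => k1 k2.
    by apply/andP; split; lra.
  have -> : `|expR (s * B ^+ 2) * (h x * p x * gau (s / 2) x)| =
      `|h x| * (`|p x| * (expR (s * B ^+ 2) * gau (s / 2) x)).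
    rewrite normrM (ger0_norm (expR_ge0 _)) normrM (ger0_norm (gau_ge0 _ _)) (normrM (h x)).
    by ring.
  rewrite normrM.
  rewrite ler_wpM2l// normrM (ger0_norm (gau_ge0 _ _)); apply: ler_pM => //; first exact: gau_ge0.
    rewrite /p !normrM ler_wpM2l// (le_trans (ler_normB _ _))//.
    rewrite ger0_norm ?addr_ge0 ?sqr_ge0// addrA lerD//.
    by rewrite addrC le_1Dsqr.
  apply: (le_trans (gau_center t x s0)); rewrite ler_wpM2r ?gau_ge0// ler_expR ler_wpM2l ?(ltW s0)//.
  by rewrite -real_normK ?num_real// ler_sqr ?nnegrE.
Qed.

Lemma AC_cos_gau s z : AC (fun x => cos (z * x) * gau s x)
  (fun x => - (z * sin (z * x)) * gau s x + cos (z * x) * (- (2 * s * x) * gau s x)).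
Proof. exact: AC_mul (AC_cosM z) (AC_gau s). Qed.

Lemma AC_sin_gau s z : AC (fun x => sin (z * x) * gau s x)
  (fun x => z * cos (z * x) * gau s x + sin (z * x) * (- (2 * s * x) * gau s x)).
Proof. exact: AC_mul (AC_sinM z) (AC_gau s). Qed.

Lemma tame_id_trig f p s : tame f -> slow p -> 0 < s -> L1 (fun x => f x * (x * p x * gau s x)).
Proof.
move=> tf sp s0; have [_ h] := tame_slow tf (slowM slow_id sp).
by under eq_fun do rewrite mulrA; exact: h.
Qed.

Lemma Int_gauss_moment h s z : tame h -> 0 < s ->
  Int (fun x => h x * (2 * s * (x - z) * gau s (x - z))) =
  2 * s * (Int (fun x => x * h x * gau s (x - z)) - z * Int (fun x => h x * gau s (x - z))).
Proof.
move=> th s0.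
have l1 : L1 (fun x => x * h x * gau s (x - z)).
  by under eq_fun do rewrite [_ * h _]mulrC; apply: tame_gau_center => //; exact: tame_slow slow_id.
have l2 := tame_gau_center z th s0.
rewrite -IntZ// -IntB//; last exact: L1Z.
rewrite -IntZ; last by apply: L1B => //; exact: L1Z.
by congr Int; apply/funext => x; ring.
Qed.

(** Integration by parts puts the derivative on the trigonometric function times the dual Gaussian.
    The factor x that the Gaussian brings down is evaluated by differentiating the identities of
    [FP] with respect to the centre z. *)
Lemma FP_deriv f f' h1 h2 : AC f f' -> tame f' -> FP f h1 h2 ->
  FP f' (fun x => - (x * h2 x)) (fun x => x * h1 x).
Proof.
move=> ACf tf' [tf th1 th2 fh].
have txh h : tame h -> tame (fun x => x * h x).
  by move=> th; under eq_fun do rewrite mulrC; exact: tame_slow slow_id.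
split => //; [|exact: txh|].
  by have := tameZ (-1) (txh _ th2); congr tame; apply/funext => x; rewrite mulN1r.
move=> s z s0; have d0 := dual_gt0 s0; set d := dual s in d0.
set K := Kg s; have K0 : K != 0 by exact: lt0r_neq0 (Kg_gt0 s0).
have fhE t : K * Int (fun x => f x * (cos (t * x) * gau d x)) = Int (fun x => h1 x * gau s (x - t)).
  by have [] := fh s t s0.
have fhE2 t : - (K * Int (fun x => f x * (sin (t * x) * gau d x))) = Int (fun x => h2 x * gau s (x - t)).
  by have [] := fh s t s0.
have dC := der_trig_transform z tf d0 (is_derive_cos (R := R)) _ norm_cos_le1 _.
have dS := der_trig_transform z tf d0 (is_derive_sin (R := R)) (@continuous_cos R) norm_sin_le1 norm_cos_le1.
have csN : continuous (fun x : R => - sin x).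
  exact: (derivative_continuous (fun x : R => derN (is_derive_sin x))).
have {}dC := dC csN (fun x => eq_ind_r (fun y => y <= 1) (norm_sin_le1 x) (normrN (sin x))).
have lxc : L1 (fun x => f x * (x * cos (z * x) * gau d x)) by exact: tame_id_trig (slow_cosM z) d0.
have lxs : L1 (fun x => f x * (x * sin (z * x) * gau d x)) by exact: tame_id_trig (slow_sinM z) d0.
have lc := tame_cos z tf d0. have ls := tame_sin z tf d0.
have E1 : K * Int (fun x => f x * (x * cos (z * x) * gau d x)) =
    - Int (fun x => h2 x * (2 * s * (x - z) * gau s (x - z))).
  apply: oppr_inj; rewrite opprK.
  rewrite -(der_val (der_gauss_transform z th2 s0)).
  have -> : (fun t => Int (fun x => h2 x * gau s (x - t))) =
      (fun t => - (K * Int (fun x => f x * (sin (t * x) * gau d x)))) by apply/funext => t; rewrite fhE2.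
  by rewrite (der_val (derN (derZ K dS))).
have E2 : K * Int (fun x => f x * (x * sin (z * x) * gau d x)) =
    - Int (fun x => h1 x * (2 * s * (x - z) * gau s (x - z))).
  rewrite -(der_val (der_gauss_transform z th1 s0)).
  have -> : (fun t => Int (fun x => h1 x * gau s (x - t))) =
      (fun t => K * Int (fun x => f x * (cos (t * x) * gau d x))) by apply/funext => t; rewrite fhE.
  rewrite (der_val (derZ K dC)).
  have -> : (fun x => f x * (x * - sin (z * x) * gau d x)) = (fun x => - (f x * (x * sin (z * x) * gau d x))).
    by apply/funext => x; ring.
  by rewrite IntN// mulrN opprK.
rewrite Int_gauss_moment// -fhE2 in E1; rewrite Int_gauss_moment// -fhE in E2.
(* This turns the coefficient (2 d)(2 s) into 1, and the terms carrying z cancel. *)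
have sd : s * d = 4^-1 by rewrite /d /dual; field; rewrite gt_eqF.
have eC : (fun x => f x * (- (z * sin (z * x)) * gau d x + cos (z * x) * (- (2 * d * x) * gau d x))) =
  (fun x => (- z) * (f x * (sin (z * x) * gau d x)) + (- (2 * d)) * (f x * (x * cos (z * x) * gau d x))).
  by apply/funext => x; ring.
have eS : (fun x => f x * (z * cos (z * x) * gau d x + sin (z * x) * (- (2 * d * x) * gau d x))) =
  (fun x => z * (f x * (cos (z * x) * gau d x)) + (- (2 * d)) * (f x * (x * sin (z * x) * gau d x))).
  by apply/funext => x; ring.
split.
- rewrite (AC_parts ACf (AC_cos_gau d z))//; [|exact: tame_cos|by rewrite eC; apply: L1D; exact: L1Z].
  rewrite eC IntD ?IntZ//; [|exact: L1Z|exact: L1Z].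
  have -> : (fun x => - (x * h2 x) * gau s (x - z)) = (fun x => - (x * h2 x * gau s (x - z))).
    by apply/funext => x; rewrite mulNr.
  rewrite IntN; last by apply: tame_gau_center => //; exact: txh.
  move: E1; set X := Int _; set Z := Int _; set Y := Int _ => E1.
  have -> : K * - (- z * Y + - (2 * d) * X) = z * K * Y + 2 * d * (K * X) by ring.
  rewrite E1; have -> : z * K * Y + 2 * d * - (2 * s * (Z - z * - (K * Y))) =
     z * K * Y - 4 * (s * d) * (Z + z * (K * Y)) by ring.
  by rewrite sd mulfV ?mul1r//; ring.
- rewrite (AC_parts ACf (AC_sin_gau d z))//; [|exact: tame_sin|by rewrite eS; apply: L1D; exact: L1Z].
  rewrite eS IntD ?IntZ//; [|exact: L1Z|exact: L1Z].
  move: E2; set X := Int _; set Y := Int _; set Z := Int _ => E2.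
  have -> : - (K * - (z * Z + - (2 * d) * X)) = z * K * Z - 2 * d * (K * X) by ring.
  rewrite E2; have -> : z * K * Z - 2 * d * - (2 * s * (Y - z * (K * Z))) =
     z * K * Z + 4 * (s * d) * (Y - z * (K * Z)) by ring.
  by rewrite sd mulfV ?mul1r//; ring.
Qed.

End fourier_derivative.

(** * Convolution, inversion and the transform of a product *)

Section convolution.
Context {R : realType}.
Notation mu := (@lebesgue_measure R).
Implicit Types (f g h p F G : R -> R) (s z : R).

Lemma Int_reflect f (x : R) : measurable_fun [set: R] f -> Int (fun t => f (x - t)) = Int f.
Proof.
move=> mf; have m : measurable_fun [set: R] (fun t => f (t + x)).
  by apply: (measurableT_comp mf); exact: measurable_funD.
rewrite -(Int_shift x mf) -(Int_opp m); congr Int.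
by apply/funext => t; rewrite addrC.
Qed.

Lemma L1_reflect f (x : R) : L1 f -> L1 (fun t => f (x - t)).
Proof. by move=> /(L1_shift x)/L1_opp; under eq_fun do rewrite addrC. Qed.

(** Meant for convolution kernels, which in general no product of functions of one variable
    dominates. *)
Lemma fubini_dom2 (F : R -> R -> R) g :
  measurable_fun [set: R * R] (fun w => F w.1 w.2) -> (forall x, L1 (F x)) -> L1 g ->
  (forall x, Int (fun y => `|F x y|) <= g x) ->
  (\int[mu]_x \int[mu]_y `|F x y|%:E < +oo)%E.
Proof.
move=> mF lF lg Fg; have /integrableP[mg] := lg; apply: le_lt_trans.
apply: ge0_le_integral => //.
- by move=> x _; apply: integral_ge0 => y _; rewrite lee_fin.
- have /= := @measurable_fun_fubini_tonelli_F _ _ _ _ R mu (fun w => `|F w.1 w.2|%:E)%E _.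
  by apply => //; apply/measurable_EFinP; exact: measurableT_comp.
- apply/measurable_EFinP; apply: measurableT_comp => //; exact: L1_measurable lg.
- move=> x _; rewrite -(IntE (L1_abs (lF x))) /= lee_fin (le_trans (Fg x))//.
  exact: ler_norm.
Qed.

Definition conv f g (x : R) : R := Int (fun t => f t * g (x - t)).

Lemma normM_le_sqr (x y : R) : `|x * y| <= x ^+ 2 + y ^+ 2.
Proof.
have h1 := sqr_ge0 (x - y); have h2 := sqr_ge0 (x + y).
have h3 := sqr_ge0 x; have h4 := sqr_ge0 y.
rewrite ler_norml; apply/andP; split; nra.
Qed.

Section conv_sqr.
Context (f g : R -> R).
Hypothesis mf : measurable_fun [set: R] f.
Hypothesis mg : measurable_fun [set: R] g.
Hypothesis lf : L1 (fun x => f x ^+ 2).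
Hypothesis lg : L1 (fun x => g x ^+ 2).

Let lsum x : L1 (fun t => f t ^+ 2 + g (x - t) ^+ 2).
Proof. by apply: L1D => //; exact: (L1_reflect x lg). Qed.

Let m2 : measurable_fun [set: R * R] (fun w => f w.2 * g (w.1 - w.2)).
Proof.
apply: measurable_funM; first exact: (measurableT_comp mf measurable_snd).
apply: (measurableT_comp mg); apply: measurable_funB; [exact: measurable_fst|exact: measurable_snd].
Qed.

Lemma conv_L1 x : L1 (fun t => f t * g (x - t)).
Proof.
apply: (L1_le _ _ (lsum x)); last by move=> t; exact: normM_le_sqr.
by have := measurableT_comp m2 (measurable_pair1 x).
Qed.

Lemma conv_abs_bound x :
  Int (fun t => `|f t * g (x - t)|) <= Int (fun x => f x ^+ 2) + Int (fun x => g x ^+ 2).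
Proof.
rewrite -[X in _ + X](Int_reflect x (L1_measurable lg)) -IntD//; last exact: (L1_reflect x lg).
apply: le_Int; [exact/L1_abs/conv_L1|exact: lsum|] => t; exact: normM_le_sqr.
Qed.

Let mF s z : measurable_fun [set: R * R] (fun w => f w.2 * g (w.1 - w.2) * gau s (w.1 - z)).
Proof.
apply: measurable_funM => //.
exact: (measurableT_comp (gau_center_measurable s z) measurable_fst).
Qed.

Let lF s z x : L1 (fun t => f t * g (x - t) * gau s (x - z)).
Proof. by under eq_fun do rewrite mulrC; exact/L1Z/conv_L1. Qed.

Let iF s z : 0 < s -> (\int[mu]_x \int[mu]_t `|f t * g (x - t) * gau s (x - z)|%:E < +oo)%E.
Proof.
move=> s0; apply: (fubini_dom2 (mF s z) (lF s z)
  (L1Z (Int (fun x => f x ^+ 2) + Int (fun x => g x ^+ 2)) (L1_shift (- z) (L1_gau s0)))) => x.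
under eq_fun do rewrite normrM (ger0_norm (gau_ge0 _ _)) mulrC.
rewrite IntZ; last exact/L1_abs/conv_L1.
by rewrite mulrC ler_wpM2r ?gau_ge0// conv_abs_bound.
Qed.

Lemma conv_bound x : `|conv f g x| <= Int (fun x => f x ^+ 2) + Int (fun x => g x ^+ 2).
Proof. exact: le_trans (Int_abs (conv_L1 x)) (conv_abs_bound x). Qed.

Lemma conv_measurable : measurable_fun [set: R] (conv f g).
Proof.
have := L1_measurable (fubini_L1l (mF 1 0) (iF 0 ltr01)).
have mg1 : measurable_fun [set: R] (fun y : R => expR (y ^+ 2)).
  by apply: measurableT_comp => //; exact: measurable_funX.
move=> /(measurable_funM mg1); rewrite (_ : (_ \* _) = conv f g)//.
apply/funext => y /=; rewrite subr0.
under eq_fun do rewrite mulrC; rewrite IntZ; last exact: conv_L1.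
by rewrite /gau mul1r expRN mulrA mulfV ?mul1r// gt_eqF// expR_gt0.
Qed.

Lemma conv_tame : tame (conv f g).
Proof. apply: slow_tame; exact: slow_bounded conv_measurable conv_bound. Qed.

(** Associativity of convolution with a Gaussian: translating the argument by t amounts to moving
    the centre to z - t. *)
Lemma conv_gauss s z : 0 < s ->
  Int (fun t => f t * Int (fun x => g x * gau s (x - (z - t)))) =
  Int (fun x => conv f g x * gau s (x - z)).
Proof.
move=> s0; have tg : tame g by exact: sqr_tame.
have -> : (fun x => conv f g x * gau s (x - z)) =
    (fun x => Int (fun t => f t * g (x - t) * gau s (x - z))).
  apply/funext => x; under [in RHS]eq_fun do rewrite mulrC.
  by rewrite IntZ 1?mulrC//; exact: conv_L1.
rewrite (fubini_Int (mF s z) (iF z s0)); congr Int; apply/funext => t.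
have l1 : L1 (fun x => g x * gau s (x - (z - t))) by exact: tame_gau_center.
have l2 := L1_shift (- t) l1.
rewrite -(Int_shift (- t) (L1_measurable l1)) -IntZ//; congr Int; apply/funext => x.
by rewrite mulrA; congr (_ * gau s _); ring.
Qed.

End conv_sqr.

(* The inverse Fourier transform of a1 + i a2, provided that it is real, that
   is, under trigconj0. *)
Definition trigint a1 a2 (x : R) : R :=
  (2 * pi)^-1 * (Int (fun t => a1 t * cos (x * t)) - Int (fun t => a2 t * sin (x * t))).

Definition trigconj0 a1 a2 : Prop := forall x : R,
  Int (fun t => a1 t * sin (x * t)) + Int (fun t => a2 t * cos (x * t)) = 0.

Lemma L1_cosM a1 (x : R) : L1 a1 -> L1 (fun t => a1 t * cos (x * t)).
Proof. by move=> la; apply: (L1_bnd la (cosM_measurable x) (fun t => norm_cos_le1 (x * t))). Qed.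

Lemma L1_sinM a1 (x : R) : L1 a1 -> L1 (fun t => a1 t * sin (x * t)).
Proof. by move=> la; apply: (L1_bnd la (sinM_measurable x) (fun t => norm_sin_le1 (x * t))). Qed.

Lemma Int_cos_sub a1 (z x : R) : L1 a1 -> Int (fun t => a1 t * cos ((z - t) * x)) =
  cos (z * x) * Int (fun t => a1 t * cos (x * t)) + sin (z * x) * Int (fun t => a1 t * sin (x * t)).
Proof.
move=> la; have l1 := L1_cosM x la; have l2 := L1_sinM x la.
rewrite -!IntZ// -IntD//; [|exact: L1Z|exact: L1Z]; congr Int; apply/funext => t.
by rewrite mulrBl cosB [t * x]mulrC; ring.
Qed.

Lemma Int_sin_sub a1 (z x : R) : L1 a1 -> Int (fun t => a1 t * sin ((z - t) * x)) =
  sin (z * x) * Int (fun t => a1 t * cos (x * t)) - cos (z * x) * Int (fun t => a1 t * sin (x * t)).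
Proof.
move=> la; have l1 := L1_cosM x la; have l2 := L1_sinM x la.
rewrite -!IntZ// -IntB//; [|exact: L1Z|exact: L1Z]; congr Int; apply/funext => t.
by rewrite mulrBl sinB [t * x]mulrC; ring.
Qed.

(** The factor e^(-i z x) turns the frequency - t of the inverse transform into z - t; [trigconj0]
    is the vanishing of the imaginary part of that transform. *)
Lemma trigint_cos a1 a2 (z x : R) : L1 a1 -> L1 a2 -> trigconj0 a1 a2 ->
  trigint a1 a2 x * cos (z * x) = (2 * pi)^-1 *
    (Int (fun t => a1 t * cos ((z - t) * x)) + Int (fun t => a2 t * sin ((z - t) * x))).
Proof.
move=> l1 l2 /(_ x) a0; rewrite Int_cos_sub// Int_sin_sub// /trigint.
have -> : Int (fun t => a2 t * cos (x * t)) = - Int (fun t => a1 t * sin (x * t)) by lra.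
by ring.
Qed.

Lemma trigint_sin a1 a2 (z x : R) : L1 a1 -> L1 a2 -> trigconj0 a1 a2 ->
  trigint a1 a2 x * sin (z * x) = (2 * pi)^-1 *
    (Int (fun t => a1 t * sin ((z - t) * x)) - Int (fun t => a2 t * cos ((z - t) * x))).
Proof.
move=> l1 l2 /(_ x) a0; rewrite Int_cos_sub// Int_sin_sub// /trigint.
have -> : Int (fun t => a2 t * cos (x * t)) = - Int (fun t => a1 t * sin (x * t)) by lra.
by ring.
Qed.

Section swap.
Context (B al k : R -> R) (z : R).
Hypothesis lB : L1 B.
Hypothesis lal : L1 al.
Hypothesis ck : continuous k.
Hypothesis k1 : forall x, `|k x| <= 1.

Let mk : measurable_fun [set: R * R] (fun w => k ((z - w.2) * w.1)).
Proof.
apply: (measurableT_comp (continuous_measurable ck)).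
apply: measurable_funM; last exact: measurable_fst.
by apply: measurable_funB; [exact: measurable_cst|exact: measurable_snd].
Qed.

Let mF : measurable_fun [set: R * R] (fun w => B w.1 * (al w.2 * k ((z - w.2) * w.1))).
Proof.
apply: measurable_funM; first exact: (measurableT_comp (L1_measurable lB) measurable_fst).
by apply: measurable_funM => //; exact: (measurableT_comp (L1_measurable lal) measurable_snd).
Qed.

Let iF : (\int[mu]_x \int[mu]_t `|B x * (al t * k ((z - t) * x))|%:E < +oo)%E.
Proof.
apply: (fubini_dom mF (L1_abs lB) (L1_abs lal)) => x t.
by rewrite normrM ler_wpM2l// normrM ler_piMr.
Qed.

Let lalk x : L1 (fun t => al t * k ((z - t) * x)).
Proof.
apply: (L1_bnd lal _ (fun t => k1 ((z - t) * x))).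
by have := measurableT_comp mk (measurable_pair1 x).
Qed.

Let lBk t : L1 (fun x => B x * k ((z - t) * x)).
Proof.
apply: (L1_bnd lB _ (fun x => k1 ((z - t) * x))).
by have := measurableT_comp mk (measurable_pair2 t).
Qed.

Let eF : (fun x => Int (fun t => B x * (al t * k ((z - t) * x)))) =
  (fun x => B x * Int (fun t => al t * k ((z - t) * x))).
Proof. by apply/funext => x; rewrite IntZ. Qed.

Let eG : (fun t => Int (fun x => B x * (al t * k ((z - t) * x)))) =
  (fun t => al t * Int (fun x => B x * k ((z - t) * x))).
Proof. by apply/funext => t; under eq_fun do rewrite mulrCA; rewrite IntZ. Qed.

Lemma swap_L1l : L1 (fun x => B x * Int (fun t => al t * k ((z - t) * x))).
Proof. by rewrite -eF; exact: fubini_L1l mF iF. Qed.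

Lemma swap_L1r : L1 (fun t => al t * Int (fun x => B x * k ((z - t) * x))).
Proof. by rewrite -eG; exact: fubini_L1r mF iF. Qed.

Lemma swap_Int : Int (fun x => B x * Int (fun t => al t * k ((z - t) * x))) =
  Int (fun t => al t * Int (fun x => B x * k ((z - t) * x))).
Proof. by rewrite -eF -eG; exact: fubini_Int mF iF. Qed.

End swap.

Lemma trigint_slow a1 a2 : L1 a1 -> L1 a2 -> slow (trigint a1 a2).
Proof.
move=> l1 l2.
have [m1 _] := transform_tame l1 (@continuous_cos R) norm_cos_le1.
have [m2 _] := transform_tame l2 (@continuous_sin R) norm_sin_le1.
apply: slowM; first exact: slow_cst.
apply: (slow_bounded (M := Int (fun t => `|a1 t|) + Int (fun t => `|a2 t|))).
  exact: measurable_funB.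
move=> x; apply: (le_trans (ler_normB _ _)); apply: lerD.
- apply: (le_trans (Int_abs (L1_cosM x l1))); apply: le_Int; [exact/L1_abs/L1_cosM|exact: L1_abs|].
  by move=> t; rewrite normrM ler_piMr// norm_cos_le1.
- apply: (le_trans (Int_abs (L1_sinM x l2))); apply: le_Int; [exact/L1_abs/L1_sinM|exact: L1_abs|].
  by move=> t; rewrite normrM ler_piMr// norm_sin_le1.
Qed.

(** Written as an inverse transform, the first factor is a superposition of exponentials, each of
    which moves the Gaussian tested against the transform of [b] from z to z - t. Integrating over t
    with weight a1 + i a2 is the convolution. *)
Lemma FP_mul (a1 a2 b b1 b2 : R -> R) : L1 a1 -> L1 a2 -> trigconj0 a1 a2 ->
  L1 (fun x => a1 x ^+ 2) -> L1 (fun x => a2 x ^+ 2) ->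
  measurable_fun [set: R] b1 -> measurable_fun [set: R] b2 ->
  L1 (fun x => b1 x ^+ 2) -> L1 (fun x => b2 x ^+ 2) -> FP b b1 b2 ->
  FP (fun x => trigint a1 a2 x * b x)
     (fun x => (2 * pi)^-1 * (conv a1 b1 x - conv a2 b2 x))
     (fun x => (2 * pi)^-1 * (conv a1 b2 x + conv a2 b1 x)).
Proof.
move=> la1 la2 a0 l2a1 l2a2 mb1 mb2 l2b1 l2b2 [tb tb1 tb2 bh].
have ma1 := L1_measurable la1; have ma2 := L1_measurable la2.
have t11 : tame (conv a1 b1) by exact: conv_tame.
have t12 : tame (conv a1 b2) by exact: conv_tame.
have t21 : tame (conv a2 b1) by exact: conv_tame.
have t22 : tame (conv a2 b2) by exact: conv_tame.
split.
- by under eq_fun do rewrite mulrC; apply: tame_slow => //; exact: trigint_slow.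
- by apply: tameZ; exact: tameB.
- by apply: tameZ; exact: tameD.
move=> s z s0; have d0 := dual_gt0 s0; set d := dual s in d0.
set K := Kg s; set c := (2 * pi)^-1.
(* Absorbing the Gaussian makes [b] integrable, as Fubini requires. *)
pose B x := b x * gau d x.
have lB : L1 B by have [_ h] := tb; exact: h.
have BC t : K * Int (fun x => B x * cos ((z - t) * x)) = Int (fun x => b1 x * gau s (x - (z - t))).
  have [<- _] := bh s (z - t) s0; congr (_ * Int _); apply/funext => x.
  by rewrite /B; ring.
have BS t : K * Int (fun x => B x * sin ((z - t) * x)) = - Int (fun x => b2 x * gau s (x - (z - t))).
  have [_ <-] := bh s (z - t) s0; rewrite opprK; congr (_ * Int _); apply/funext => x.
  by rewrite /B; ring.
have gg u v : (fun x => c * (u x - v x) * gau s (x - z)) = (fun x => c * (u x * gau s (x - z) - v x * gau s (x - z))).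
  by apply/funext => x; ring.
have gg' u v : (fun x => c * (u x + v x) * gau s (x - z)) = (fun x => c * (u x * gau s (x - z) + v x * gau s (x - z))).
  by apply/funext => x; ring.
have swc al : L1 al -> K * Int (fun x => B x * Int (fun t => al t * cos ((z - t) * x))) =
    Int (fun t => al t * Int (fun x => b1 x * gau s (x - (z - t)))).
  move=> lal; rewrite (swap_Int z lB lal (@continuous_cos R) norm_cos_le1).
  rewrite -IntZ; last exact: (swap_L1r z lB lal (@continuous_cos R) norm_cos_le1).
  by congr Int; apply/funext => t; rewrite -BC mulrCA.
have sws al : L1 al -> K * Int (fun x => B x * Int (fun t => al t * sin ((z - t) * x))) =
    - Int (fun t => al t * Int (fun x => b2 x * gau s (x - (z - t)))).
  move=> lal; rewrite (swap_Int z lB lal (@continuous_sin R) norm_sin_le1).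
  have l := swap_L1r z lB lal (@continuous_sin R) norm_sin_le1.
  rewrite -IntZ//; apply: oppr_inj; rewrite opprK -IntN; last exact: L1Z.
  by congr Int; apply/funext => t; rewrite mulrCA BS mulrN opprK.
have lc al : L1 al -> L1 (fun x => B x * Int (fun t => al t * cos ((z - t) * x))).
  by move=> lal; exact: (swap_L1l z lB lal (@continuous_cos R) norm_cos_le1).
have ls al : L1 al -> L1 (fun x => B x * Int (fun t => al t * sin ((z - t) * x))).
  by move=> lal; exact: (swap_L1l z lB lal (@continuous_sin R) norm_sin_le1).
split.
- have -> : (fun x => trigint a1 a2 x * b x * (cos (z * x) * gau d x)) =
    (fun x => c * (B x * Int (fun t => a1 t * cos ((z - t) * x)) +
                   B x * Int (fun t => a2 t * sin ((z - t) * x)))).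
    apply/funext => x; transitivity ((trigint a1 a2 x * cos (z * x)) * B x); first by rewrite /B; ring.
    by rewrite trigint_cos// -/c; ring.
  rewrite gg (IntZ c (L1D (lc _ la1) (ls _ la2))) (IntD (lc _ la1) (ls _ la2)).
  rewrite (IntZ c (L1B (tame_gau_center z t11 s0) (tame_gau_center z t22 s0))).
  rewrite (IntB (tame_gau_center z t11 s0) (tame_gau_center z t22 s0)).
  rewrite -(conv_gauss ma1 mb1 l2a1 l2b1 z s0) -(conv_gauss ma2 mb2 l2a2 l2b2 z s0).
  by rewrite (mulrCA K c) (mulrDr K) (swc _ la1) (sws _ la2).
- have -> : (fun x => trigint a1 a2 x * b x * (sin (z * x) * gau d x)) =
    (fun x => c * (B x * Int (fun t => a1 t * sin ((z - t) * x)) -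
                   B x * Int (fun t => a2 t * cos ((z - t) * x)))).
    apply/funext => x; transitivity ((trigint a1 a2 x * sin (z * x)) * B x); first by rewrite /B; ring.
    by rewrite trigint_sin// -/c; ring.
  rewrite gg' (IntZ c (L1B (ls _ la1) (lc _ la2))) (IntB (ls _ la1) (lc _ la2)).
  rewrite (IntZ c (L1D (tame_gau_center z t12 s0) (tame_gau_center z t21 s0))).
  rewrite (IntD (tame_gau_center z t12 s0) (tame_gau_center z t21 s0)).
  rewrite -(conv_gauss ma1 mb2 l2a1 l2b2 z s0) -(conv_gauss ma2 mb1 l2a2 l2b1 z s0).
  by rewrite -mulrN -mulrN (mulrCA K c) opprB (mulrBr K) (swc _ la2) (sws _ la1) opprK addrC.
Qed.

(** Two successive Gaussian integrals produce [Kg s * Kg (dual s)], which the constant in [trigint]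
    cancels. *)
Lemma FP_inv (a1 a2 : R -> R) : L1 a1 -> L1 a2 -> trigconj0 a1 a2 -> FP (trigint a1 a2) a1 a2.
Proof.
move=> la1 la2 a0; split; [exact/slow_tame/trigint_slow|exact: L1_tame|exact: L1_tame|].
move=> s z s0; have d0 := dual_gt0 s0; set d := dual s in d0.
have lg := L1_gau d0.
have p0 : 2 * pi != 0 :> R by rewrite mulf_neq0// gt_eqF// pi_gt0.
have lc al : L1 al -> L1 (fun x => gau d x * Int (fun t => al t * cos ((z - t) * x))).
  by move=> lal; exact: (swap_L1l z lg lal (@continuous_cos R) norm_cos_le1).
have ls al : L1 al -> L1 (fun x => gau d x * Int (fun t => al t * sin ((z - t) * x))).
  by move=> lal; exact: (swap_L1l z lg lal (@continuous_sin R) norm_sin_le1).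
have Ic al : L1 al -> Int (fun x => gau d x * Int (fun t => al t * cos ((z - t) * x))) =
    Kg d * Int (fun t => al t * gau s (t - z)).
  move=> lal; rewrite (swap_Int z lg lal (@continuous_cos R) norm_cos_le1) -IntZ; last first.
    by apply: tame_gau_center => //; exact: L1_tame.
  congr Int; apply/funext => t; rewrite mulrCA; congr (_ * _).
  under eq_fun do rewrite mulrC.
  by rewrite Int_cos_gau// dualK// -gauN opprB.
have Is al : L1 al -> Int (fun x => gau d x * Int (fun t => al t * sin ((z - t) * x))) = 0.
  move=> lal; rewrite (swap_Int z lg lal (@continuous_sin R) norm_sin_le1).
  rewrite (_ : (fun t => _) = fun=> 0) ?Int0//; apply/funext => t.
  by under eq_fun do rewrite mulrC; rewrite Int_sin_gau// mulr0.
have KK : Kg s * Kg d = 2 * pi := Kg_dual s0.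
split.
- have -> : (fun x => trigint a1 a2 x * (cos (z * x) * gau d x)) =
    (fun x => (2 * pi)^-1 * (gau d x * Int (fun t => a1 t * cos ((z - t) * x)) +
                   gau d x * Int (fun t => a2 t * sin ((z - t) * x)))).
    apply/funext => x; transitivity ((trigint a1 a2 x * cos (z * x)) * gau d x); first by ring.
    by rewrite trigint_cos//; ring.
  rewrite (IntZ _ (L1D (lc _ la1) (ls _ la2))) (IntD (lc _ la1) (ls _ la2)) Is// Ic// addr0.
  by rewrite mulrCA (mulrA (Kg s)) KK mulrA mulVf ?mul1r.
- have -> : (fun x => trigint a1 a2 x * (sin (z * x) * gau d x)) =
    (fun x => (2 * pi)^-1 * (gau d x * Int (fun t => a1 t * sin ((z - t) * x)) -
                   gau d x * Int (fun t => a2 t * cos ((z - t) * x)))).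
    apply/funext => x; transitivity ((trigint a1 a2 x * sin (z * x)) * gau d x); first by ring.
    by rewrite trigint_sin//; ring.
  rewrite (IntZ _ (L1B (ls _ la1) (lc _ la2))) (IntB (ls _ la1) (lc _ la2)) Is// Ic// sub0r.
  by rewrite !mulrN opprK mulrCA (mulrA (Kg s)) KK mulrA mulVf ?mul1r.
Qed.

End convolution.

(** * Moments of the spectral density *)

Section moments.
Context {R : realType}.
Notation mu := (@lebesgue_measure R).
Implicit Types (f g h n : R -> R) (x : R).

Lemma le_Int_ae f g : L1 f -> L1 g -> (forall x, 0 <= f x) -> (forall x, 0 <= g x) ->
  {ae mu, forall x, f x <= g x} -> Int f <= Int g.
Proof.
move=> lf lg f0 g0 fg; rewrite -lee_fin !IntE//; apply: ae_ge0_le_integral => //.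
- by move=> x _; rewrite lee_fin.
- by apply/measurable_EFinP; exact: L1_measurable lf.
- by move=> x _; rewrite lee_fin.
- by apply/measurable_EFinP; exact: L1_measurable lg.
- by apply: ae_imp fg => x + _; rewrite lee_fin.
Qed.

Lemma weighted_L1 n (C C' : R) : measurable_fun [set: R] n -> (forall x, 0 <= n x) ->
  L1 (fun x => n x ^+ 2) -> 0 <= C -> 0 <= C' ->
  {ae mu, forall x, x ^+ 2 * n x <= C * n x + C'} -> L1 n.
Proof.
move=> mn n0 ln2 C0 C'0 h.
apply: (@L1_leae _ _ (fun x => (1 + C) * n x ^+ 2 + (1 + C + C') * (1 + x ^+ 2)^-1)) => //.
  apply: ae_imp h => x h; rewrite ger0_norm//.
  have w0 : 0 < 1 + x ^+ 2 by rewrite ltr_pwDl// sqr_ge0.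
  have w1 : (1 + x ^+ 2)^-1 <= 1 by rewrite invf_le1// lerDl sqr_ge0.
  have wi0 : 0 < (1 + x ^+ 2)^-1 by rewrite invr_gt0.
  have nE : n x = (x ^+ 2 * n x + n x) * (1 + x ^+ 2)^-1.
    by apply: (mulIf (lt0r_neq0 w0)); rewrite mulfVK ?gt_eqF//; ring.
  (* n <= ((1 + C) n + C') w and n w <= n^2 + w^2 with w = 1 / (1 + x^2) *)
  rewrite {1}nE; move: h (n0 x) wi0 w1; move: (n x) (x ^+ 2 * n x) (1 + x ^+ 2)^-1.
  move=> a b w h a0 w0' w1.
  have h1 : (b + a) * w <= ((1 + C) * a + C') * w by apply: ler_wpM2r; [exact: ltW|lra].
  have h2 : a * w <= a ^+ 2 + w by have := sqr_ge0 (a - w); have := sqr_ge0 w; have := sqr_ge0 a; nra.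
  apply: (le_trans h1).
  have := ler_wpM2l (addr_ge0 ler01 C0) h2; nra.
by apply: L1D; apply: L1Z => //; exact: L1_oneDsqrV.
Qed.

Section conv_moment.
Context (f h : R -> R) (k : nat).
Hypothesis mf : measurable_fun [set: R] f.
Hypothesis mh : measurable_fun [set: R] h.
Hypothesis f0 : forall x, 0 <= f x.
Hypothesis h0 : forall x, 0 <= h x.
Hypothesis l2f : L1 (fun x => f x ^+ 2).
Hypothesis l2h : L1 (fun x => h x ^+ 2).
Hypothesis lf : forall j, (j <= k)%N -> L1 (fun x => `|x| ^+ j * f x).
Hypothesis lh : forall j, (j <= k)%N -> L1 (fun x => `|x| ^+ j * h x).

Let mpow (j : nat) : measurable_fun [set: R] (fun x : R => `|x| ^+ j).
Proof. by apply: measurable_funX; exact: normr_measurable. Qed.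

(** In the variables t and y = x - t, |x|^k is at most (|t| + |y|)^k; the binomial expansion [P]
    splits into products of one weighted factor for [f] and one for [h]. *)
Let G (t y : R) := `|t + y| ^+ k * (f t * h y).
Let P (t y : R) := \sum_(j < k.+1) ('C(k, j)%:R * (`|t| ^+ j * f t)) * (`|y| ^+ (k - j) * h y).

Let GP t y : `|G t y| <= P t y.
Proof.
rewrite ger0_norm; last by rewrite !mulr_ge0// exprn_ge0.
apply: (@le_trans _ _ ((`|y| + `|t|) ^+ k * (f t * h y))).
  rewrite ler_wpM2r ?mulr_ge0// lerXn2r ?nnegrE ?addr_ge0//.
  by rewrite [leRHS]addrC ler_normD.
rewrite exprDn mulr_suml /P le_eqVlt; apply/orP; left; apply/eqP.
by apply: eq_bigr => j _; rewrite -mulr_natl; ring.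
Qed.

Let mG : measurable_fun [set: R * R] (fun w => G w.1 w.2).
Proof.
apply: measurable_funM.
  apply: measurable_funX; apply: measurableT_comp => //.
  by apply: measurable_funD; [exact: measurable_fst|exact: measurable_snd].
apply: measurable_funM; first exact: (measurableT_comp mf measurable_fst).
exact: (measurableT_comp mh measurable_snd).
Qed.

Lemma L1_sum (m : nat) (F : nat -> R -> R) : (forall j, (j < m)%N -> L1 (F j)) ->
  L1 (fun x => \sum_(j < m) F j x).
Proof.
elim: m => [|m IH] lF; first by under eq_fun do rewrite big_ord0; exact: L1_0.
under eq_fun do rewrite big_ord_recr /=.
by apply: L1D; [apply: IH => j jm; exact: lF (ltnW jm)|exact: lF].
Qed.

Lemma Int_sum (m : nat) (F : nat -> R -> R) : (forall j, (j < m)%N -> L1 (F j)) ->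
  Int (fun x => \sum_(j < m) F j x) = \sum_(j < m) Int (F j).
Proof.
elim: m => [|m IH] lF; first by under eq_fun do rewrite big_ord0; rewrite big_ord0 Int0.
under eq_fun do rewrite big_ord_recr /=.
have lF' j : (j < m)%N -> L1 (F j) by move=> jm; exact: lF (ltnW jm).
by rewrite IntD ?IH ?big_ord_recr//; [exact: L1_sum|exact: lF].
Qed.

Let c t (j : nat) := 'C(k, j)%:R * (`|t| ^+ j * f t).

Let lc t j : L1 (fun y => c t j * (`|y| ^+ (k - j) * h y)).
Proof. by apply: L1Z; apply: lh; rewrite leq_subr. Qed.

Let lP t : L1 (P t).
Proof. exact: (@L1_sum k.+1 (fun j y => c t j * (`|y| ^+ (k - j) * h y)) (fun j _ => lc t j)). Qed.

Let lG t : L1 (G t).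
Proof.
apply: (L1_le _ (GP t) (lP t)).
by have := measurableT_comp mG (measurable_pair1 t).
Qed.

Let F (t x : R) := f t * h (x - t) * `|x| ^+ k.

Let FG t x : F t x = G t (x - t).
Proof. by rewrite /F /G [t + _]addrC subrK; ring. Qed.

Let mF : measurable_fun [set: R * R] (fun w => F w.1 w.2).
Proof.
apply: measurable_funM; last exact: (measurableT_comp (mpow k) measurable_snd).
apply: measurable_funM; first exact: (measurableT_comp mf measurable_fst).
apply: (measurableT_comp mh).
by apply: measurable_funB; [exact: measurable_snd|exact: measurable_fst].
Qed.

Let lF t : L1 (F t).
Proof. by rewrite (_ : F t = fun x => G t (x + - t)); [exact: L1_shift|apply/funext => x; exact: FG]. Qed.

Let F0 t x : 0 <= F t x.
Proof. by rewrite !mulr_ge0// exprn_ge0. Qed.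

Let D (t : R) := \sum_(j < k.+1) (Int (fun y => `|y| ^+ (k - j) * h y) * 'C(k, j)%:R) * (`|t| ^+ j * f t).

Let lD : L1 D.
Proof.
apply: (@L1_sum k.+1 (fun j t => (Int (fun y => `|y| ^+ (k - j) * h y) * 'C(k, j)%:R) * (`|t| ^+ j * f t))).
by move=> j jk; apply: L1Z; exact: lf.
Qed.

Let FD t : Int (fun x => `|F t x|) <= D t.
Proof.
under eq_fun do rewrite FG.
have lGa := L1_abs (lG t).
rewrite (Int_shift (- t) (L1_measurable lGa)) (le_trans (le_Int lGa (lP t) (GP t)))//.
rewrite (@Int_sum k.+1 (fun j y => c t j * (`|y| ^+ (k - j) * h y)) (fun j _ => lc t j)).
apply: ler_sum => j _; rewrite IntZ; last by apply: lh; exact: leq_subr.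
by rewrite /c le_eqVlt; apply/orP; left; apply/eqP; ring.
Qed.

Let iF : (\int[mu]_x \int[mu]_y `|F x y|%:E < +oo)%E.
Proof. exact: fubini_dom2 mF lF lD FD. Qed.

Let eF : (fun x => Int (fun t => F t x)) = (fun x => `|x| ^+ k * conv f h x).
Proof.
apply/funext => x; rewrite /conv -IntZ; last exact: conv_L1.
by congr Int; apply/funext => t; rewrite mulrC.
Qed.

Lemma conv_moment_L1 : L1 (fun x => `|x| ^+ k * conv f h x).
Proof. by rewrite -eF; exact: fubini_L1r mF iF. Qed.

Lemma conv_moment : Int (fun x => `|x| ^+ k * conv f h x) <=
  \sum_(j < k.+1) 'C(k, j)%:R * Int (fun x => `|x| ^+ j * f x) * Int (fun x => `|x| ^+ (k - j) * h x).
Proof.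
rewrite -eF -(fubini_Int mF iF).
have h1 : Int (fun t => Int (F t)) <= Int D.
  apply: le_Int => [||t]; [exact: fubini_L1l mF iF|exact: lD|].
  apply: (le_trans (ler_norm _)); exact: le_trans (Int_abs (lF t)) (FD t).
apply: (le_trans h1); rewrite (@Int_sum k.+1 (fun j t => (Int (fun y => `|y| ^+ (k - j) * h y) * 'C(k, j)%:R) * (`|t| ^+ j * f t))); last first.
  by move=> j jk; apply: L1Z; exact: lf.
apply: ler_sum => j _; rewrite IntZ; last by apply: lf; rewrite -ltnS.
by rewrite le_eqVlt; apply/orP; left; apply/eqP; ring.
Qed.

End conv_moment.

End moments.

(** C(k, j) j! (k - j)! = k! and k - j + 1 <= k + 1. In the moment recursion this lets the
    factorials in a product of two moments cancel the binomial coefficient. *)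
Lemma bin_fact_le k j : (j <= k)%N -> ('C(k, j) * (j`! * (k - j).+1`!) <= k.+1`!)%N.
Proof.
move=> jk; rewrite !factS -(bin_fact jk).
have : ((k - j).+1 <= k.+1)%N by rewrite ltnS leq_subr.
move: (k - j)%N => l lk; rewrite (mulnCA j`!) (mulnCA 'C(k, j)).
by rewrite leq_mul.
Qed.

(** * Factorial growth of the moments *)

Section moments_growth.
Context {R : realType}.
Notation mu := (@lebesgue_measure R).
Context (n : R -> R) (C : R).
Hypothesis mn : measurable_fun [set: R] n.
Hypothesis n0 : forall x, 0 <= n x.
Hypothesis ln : L1 n.
Hypothesis ln2 : L1 (fun x => n x ^+ 2).
Hypothesis lxn2 : L1 (fun x => (`|x| * n x) ^+ 2).
Hypothesis C0 : 0 <= C.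
Let h x := `|x| * n x.
Hypothesis nE : {ae mu, forall x, `|x| ^+ 3 * n x <= C * (`|x| * n x) + C * conv n h x}.

Let mpow (j : nat) : measurable_fun [set: R] (fun x : R => `|x| ^+ j).
Proof. by apply: measurable_funX; exact: normr_measurable. Qed.

Let mh : measurable_fun [set: R] h.
Proof. by apply: measurable_funM => //; exact: normr_measurable. Qed.

Let h0 x : 0 <= h x. Proof. by rewrite mulr_ge0. Qed.

Let M j := fun x : R => `|x| ^+ j * n x.

Let mM j : measurable_fun [set: R] (M j).
Proof. by apply: measurable_funM. Qed.

Let M0 j x : 0 <= M j x. Proof. by rewrite mulr_ge0// exprn_ge0. Qed.

Let hM j : (fun x => `|x| ^+ j * h x) = M j.+1.
Proof. by apply/funext => x; rewrite /M exprSr mulrA. Qed.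

(** [conv n h] is bounded, so the hypothesis reads x^2 h <= C h + C S for h = |x| n, which is the
    situation of [weighted_L1]. *)
Let lM1 : L1 (M 1).
Proof.
have -> : M 1 = h by apply/funext => x; rewrite /M expr1.
pose S := Int (fun x => n x ^+ 2) + Int (fun x => h x ^+ 2).
have S0 : 0 <= S by rewrite addr_ge0// Int_ge0// => x; exact: sqr_ge0.
apply: (@weighted_L1 _ h C (C * S)) => //; first exact: mulr_ge0.
apply: ae_imp nE => x; rewrite exprS mulrAC -mulrA [_ * (`|x| ^+ 2)]mulrC real_normK ?num_real// mulrCA.
move=> /le_trans; apply; rewrite lerD2l ler_wpM2l//.
exact: le_trans (ler_norm _) (conv_bound mn mh ln2 lxn2 x).
Qed.

Let step_ae k : {ae mu, forall x, M k.+3 x <= C * M k.+1 x + C * (`|x| ^+ k * conv n h x)}.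
Proof.
apply: ae_imp nE => x /(ler_wpM2l (exprn_ge0 k (normr_ge0 x))) e.
have -> : M k.+3 x = `|x| ^+ k * (`|x| ^+ 3 * n x) by rewrite /M mulrA -exprD addn3.
by apply: (le_trans e); rewrite /M exprSr le_eqVlt; apply/orP; left; apply/eqP; ring.
Qed.

Let conv0 x : 0 <= conv n h x.
Proof. by apply: Int_ge0 => t; rewrite mulr_ge0. Qed.

(** The inequality leads from orders up to k + 1 to order k + 3; order k + 2 is interpolated by
    a^(k+2) <= a^(k+1) + a^(k+3). *)
Let lM k : forall j, (j <= k.+1)%N -> L1 (M j).
Proof.
elim: k => [|k IH] j.
  by case: j => [_|[_|//]] //; rewrite (_ : M 0 = n)//; apply/funext => x; rewrite /M mul1r.
rewrite leq_eqVlt => /orP[/eqP ->|]; last by rewrite ltnS; exact: IH.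
have lc : L1 (fun x => `|x| ^+ k * conv n h x).
  apply: conv_moment_L1 => //.
  - by move=> i ik; exact: IH (leqW ik).
  - by move=> i ik; rewrite hM; exact: IH.
have lb : L1 (fun x => C * M k.+1 x + C * (`|x| ^+ k * conv n h x)).
  by apply: L1D; apply: L1Z => //; exact: IH.
have l3 : L1 (M k.+3).
  apply: (L1_leae _ _ lb) => //.
  apply: ae_imp (step_ae k) => x; rewrite (ger0_norm (M0 _ _)).
  exact.
apply: (L1_le _ _ (L1D (IH _ (leqnn _)) l3)) => // x; rewrite ger0_norm// /M -mulrDl ler_wpM2r//.
rewrite !exprS; have := exprn_ge0 k (normr_ge0 x).
by move: (`|x| ^+ k) `|x| (normr_ge0 x) => p a a0 p0; have := sqr_ge0 (1 - a); have := mulr_ge0 p0 a0; nra.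
Qed.

Lemma moments_L1 k : L1 (fun x => `|x| ^+ k * n x).
Proof. exact: lM (leqnSn k). Qed.

Let m k := Int (M k).

Let m0 k : 0 <= m k. Proof. exact: Int_ge0. Qed.

Let step k : m k.+3 <= C * m k.+1 + C * \sum_(j < k.+1) 'C(k, j)%:R * m j * m (k - j).+1.
Proof.
have lc : L1 (fun x => `|x| ^+ k * conv n h x).
  by apply: conv_moment_L1 => // i ik; rewrite ?hM; exact: moments_L1.
have := @le_Int_ae _ _ _ (moments_L1 k.+3) (L1D (L1Z C (moments_L1 k.+1)) (L1Z C lc)) (M0 k.+3) _ (step_ae k).
rewrite (IntD (L1Z C (moments_L1 k.+1)) (L1Z C lc)) (IntZ C (moments_L1 k.+1)) (IntZ C lc).
move=> /(_ (fun x => addr_ge0 (mulr_ge0 C0 (M0 _ x)) (mulr_ge0 C0 (mulr_ge0 (exprn_ge0 k (normr_ge0 x)) (conv0 x))))).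
move=> /le_trans; apply; rewrite lerD2l ler_wpM2l//.
have lhM j : (j <= k)%N -> L1 (fun x => `|x| ^+ j * h x) by rewrite hM => _; exact: moments_L1.
have := @conv_moment _ n h k mn mh n0 h0 ln2 lxn2 (fun j _ => moments_L1 j) lhM.
move=> /le_trans; apply.
by apply: ler_sum => j _; rewrite hM.
Qed.

(** By induction each of the k + 1 terms of the convolution sum is at most A^2 B^(k+1) (k+1)!, so
    their sum is at most A^2 B^(k+1) (k+2)!. The target exponent k + 3 leaves B^2 to absorb C (1 +
    A). *)
Lemma moments_factorial : exists A B : R, [/\ 0 <= A, 1 <= B &
  forall k, Int (fun x => `|x| ^+ k * n x) <= A * B ^+ k * k`!%:R].
Proof.
(* [A] covers the three moments that the recursion does not reach; [B] is taken so that C (1 + A) <=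
   B <= B^2. *)
pose A := m 0 + m 1 + m 2; pose B := 1 + C * (1 + A).
have A0 : 0 <= A by rewrite !addr_ge0.
have B1 : 1 <= B by rewrite lerDl mulr_ge0// addr_ge0.
have B0 : 0 <= B by exact: le_trans B1.
exists A, B; split => // k; rewrite -/(M k) -/(m k).
have pB j : 1 <= B ^+ j by rewrite exprn_ege1.
have base j : (j <= 2)%N -> m j <= A.
  by case: j => [|[|[|//]]] _; rewrite /A; have := m0 0; have := m0 1; have := m0 2; lra.
have small j : (j <= 2)%N -> m j <= A * B ^+ j * j`!%:R.
  move=> j2; apply: (le_trans (base j j2)); rewrite -mulrA ler_peMr// -[leLHS]mulr1.
  by rewrite ler_pM// ler1n fact_gt0.
have [N kN] : exists N, (k <= N)%N by exists k.
elim: N k kN => [|N IH] k kN; first by apply: small; exact: leq_trans kN _.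
case: k kN => [|[|[|k]]] kN; try exact: small.
have bd : \sum_(j < k.+1) 'C(k, j)%:R * m j * m (k - j).+1 <= A ^+ 2 * B ^+ k.+1 * k.+2`!%:R.
  have hj (j : 'I_k.+1) : 'C(k, j)%:R * m j * m (k - j).+1 <= A ^+ 2 * B ^+ k.+1 * k.+1`!%:R.
    have jk : (j <= k)%N by rewrite -ltnS.
    have b1 := IH j (leq_trans jk (leq_trans (leq_addr 2 _) (_ : (k + 2 <= N)%N))).
    have b2 := IH (k - j).+1.
    have := bin_fact_le jk; rewrite -(ler_nat R) natrM natrM => /(ler_wpM2l (mulr_ge0 (sqr_ge0 A) (exprn_ge0 k.+1 B0))).
    apply: le_trans; apply: (@le_trans _ _ ('C(k, j)%:R * (A * B ^+ j * j`!%:R) * (A * B ^+ (k - j).+1 * (k - j).+1`!%:R))).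
      rewrite ler_pM ?mulr_ge0// ?ler_wpM2l//.
      - by apply: b1; rewrite addn2.
      - by apply: b2; rewrite -ltnS (leq_trans _ kN)// !ltnS (leq_trans (leq_subr _ _))// leqW.
    have -> : B ^+ k.+1 = B ^+ j * B ^+ (k - j).+1 by rewrite -exprD addnS subnKC.
    by rewrite le_eqVlt; apply/orP; left; apply/eqP; ring.
  apply: (le_trans (ler_sum _ (fun j _ => hj j))).
  rewrite sumr_const card_ord -(mulr_natr _ k.+1) -(mulrA (A ^+ 2 * B ^+ k.+1)) ler_wpM2l ?mulr_ge0 ?sqr_ge0 ?exprn_ge0//.
  by rewrite -natrM ler_nat (factS k.+1) mulnC leq_mul.
apply: (le_trans (step k)).
have b1 := IH k.+1 (leq_trans (leqnSn _) kN).
have f1 : 1 <= k.+1`!%:R :> R by rewrite ler1n fact_gt0.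
have f2 : k.+1`!%:R <= k.+3`!%:R :> R by rewrite ler_nat leq_fact// ltnS (leq_trans (leqnSn _)).
have f3 : k.+2`!%:R <= k.+3`!%:R :> R by rewrite ler_nat leq_fact.
have CB : C * (1 + A) <= B ^+ 2.
  by apply: (@le_trans _ _ B); [rewrite /B; lra|rewrite expr2 ler_peMr].
have ABk : 0 <= A * B ^+ k.+1 by rewrite mulr_ge0// exprn_ge0.
apply: (@le_trans _ _ (C * (A * B ^+ k.+1 * k.+3`!%:R) + C * (A ^+ 2 * B ^+ k.+1 * k.+3`!%:R))).
  apply: lerD; apply: ler_wpM2l => //.
    by apply: (le_trans b1); apply: ler_wpM2l.
  by apply: (le_trans bd); apply: ler_wpM2l => //; rewrite mulr_ge0 ?sqr_ge0 ?exprn_ge0.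
apply: (@le_trans _ _ (C * (1 + A) * (A * B ^+ k.+1 * k.+3`!%:R))); first by lra.
apply: (@le_trans _ _ (B ^+ 2 * (A * B ^+ k.+1 * k.+3`!%:R))).
  by rewrite ler_wpM2r// mulr_ge0.
by rewrite [in leRHS](_ : k.+3 = (2 + k.+1)%N) ?exprD//; lra.
Qed.

End moments_growth.

(** * The travelling wave system *)

Section pairs.
Context {R : realType}.
Notation mu := (@lebesgue_measure R).
Implicit Types (f g h n F G H : R -> R) (x : R).

Lemma AC_eq F f F' f' : F =1 F' -> f =1 f' -> AC F f -> AC F' f'.
Proof. by move=> /funext -> /funext ->. Qed.

Lemma AC_0_cst F f x y : (forall x, f x = 0) -> AC F f -> F x = F y.
Proof.
move=> f0; have {f0} -> : f = (fun=> 0) by apply/funext.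
have z : forall a b : R, a <= b -> AC F (fun=> 0) -> F b = F a.
  move=> a b ab [_ /(_ _ _ ab)]; rewrite /II; under eq_fun do rewrite mul0r.
  by rewrite Int0 => /eqP; rewrite subr_eq0 => /eqP.
by case: (leP x y) => [/z|/ltW/z] h /h.
Qed.

Lemma tame_ae f g : measurable_fun [set: R] g -> {ae mu, forall x, f x = g x} -> tame f -> tame g.
Proof.
move=> mg fg [mf lf]; split=> // s s0; apply: (L1_ae _ _ (lf s s0)).
- by apply: measurable_funM => //; exact: L1_measurable (L1_gau s0).
- by apply: ae_imp fg => x ->.
Qed.

Lemma FP_aef f g h1 h2 : measurable_fun [set: R] g -> {ae mu, forall x, f x = g x} ->
  FP f h1 h2 -> FP g h1 h2.
Proof.
move=> mg fg [tf t1 t2 h]; have tg := tame_ae mg fg tf; split=> // s z s0.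
have [<- <-] := h s z s0; have d0 := dual_gt0 s0; split; [congr (_ * _)|congr (- (_ * _))].
- apply: Int_ae; [exact: tame_cos|exact: tame_cos|].
  by apply: ae_imp fg => x ->.
- apply: Int_ae; [exact: tame_sin|exact: tame_sin|].
  by apply: ae_imp fg => x ->.
Qed.

Lemma FP_aeh f h1 h2 k1 k2 : measurable_fun [set: R] k1 -> measurable_fun [set: R] k2 ->
  {ae mu, forall x, h1 x = k1 x /\ h2 x = k2 x} -> FP f h1 h2 -> FP f k1 k2.
Proof.
move=> mk1 mk2 hk [tf t1 t2 h].
have e1 : {ae mu, forall x, h1 x = k1 x} by apply: ae_imp hk => x [].
have e2 : {ae mu, forall x, h2 x = k2 x} by apply: ae_imp hk => x [].
have tk1 := tame_ae mk1 e1 t1; have tk2 := tame_ae mk2 e2 t2.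
split=> // s z s0; have [-> ->] := h s z s0; split.
- apply: Int_ae; [exact: tame_gau_center|exact: tame_gau_center|].
  by apply: ae_imp e1 => x ->.
- apply: Int_ae; [exact: tame_gau_center|exact: tame_gau_center|].
  by apply: ae_imp e2 => x ->.
Qed.

Lemma measurable_reflect f : measurable_fun [set: R] f -> measurable_fun [set: R] (fun x => f (- x)).
Proof. by move=> mf; apply: (measurableT_comp mf); exact: oppr_measurable. Qed.

Lemma tame_reflect f : tame f -> tame (fun x => f (- x)).
Proof.
move=> [mf lf]; split=> [|s s0]; first exact: measurable_reflect.
have := L1_opp (lf s s0); congr L1; apply/funext => x; congr (_ * _).
by rewrite /gau sqrrN.
Qed.

Lemma Int_gau_reflect f s (z : R) : tame f -> 0 < s ->
  Int (fun x => f (- x) * gau s (x - z)) = Int (fun x => f x * gau s (x - - z)).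
Proof.
move=> tf s0; rewrite -(Int_opp (L1_measurable (tame_gau_center (- z) tf s0))).
congr Int; apply/funext => x; congr (_ * _); rewrite /gau opprK.
by rewrite -[(- x + z) ^+ 2]sqrrN opprD opprK.
Qed.

(** For a real [f], the reflected pair with its second component negated is again a transform of
    [f]; uniqueness identifies the two. *)
Lemma FP_hermitian f h1 h2 : FP f h1 h2 ->
  {ae mu, forall x, h1 x = h1 (- x) /\ h2 x = - h2 (- x)}.
Proof.
move=> F; have [tf t1 t2 h] := F; apply: (FP_unique F).
split; [by []|exact: tame_reflect| |].
  by under eq_fun do rewrite -mulN1r; apply: tameZ; exact: tame_reflect.
move=> s z s0; have [e1 e2] := h s (- z) s0; split.
- by rewrite Int_gau_reflect// -e1; congr (_ * Int _); apply/funext => x; rewrite mulNr cosN.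
- under [in RHS]eq_fun do rewrite mulNr.
  rewrite IntN; last by apply: tame_gau_center => //; exact: tame_reflect.
  rewrite Int_gau_reflect// -e2 opprK -mulrN; congr (_ * _); rewrite -IntN; last exact: tame_sin (dual_gt0 s0).
  by congr Int; apply/funext => x; rewrite mulNr sinN; ring.
Qed.

Lemma hermitian_trigconj0 h1 h2 : L1 h1 -> L1 h2 ->
  {ae mu, forall x, h1 x = h1 (- x) /\ h2 x = - h2 (- x)} -> trigconj0 h1 h2.
Proof.
move=> l1 l2 H x.
have odd k : L1 k -> {ae mu, forall x, k x = - k (- x)} -> Int k = 0.
  move=> lk ko; suff : Int k = - Int k by lra.
  rewrite -[in RHS](Int_opp (L1_measurable lk)) -IntN; last exact: L1_opp.
  by apply: Int_ae => //; apply/L1N/L1_opp.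
rewrite !odd ?addr0//; [exact: L1_cosM| |exact: L1_sinM|].
- by apply: ae_imp H => t [_ ->]; rewrite mulrN cosN mulNr.
- by apply: ae_imp H => t [-> _]; rewrite mulrN sinN mulrN opprK.
Qed.

Lemma conv_le f g F G (a b : R) :
  measurable_fun [set: R] f -> measurable_fun [set: R] g ->
  measurable_fun [set: R] F -> measurable_fun [set: R] G ->
  L1 (fun x => F x ^+ 2) -> L1 (fun x => G x ^+ 2) ->
  L1 (fun x => f x ^+ 2) -> L1 (fun x => g x ^+ 2) ->
  (forall x, `|f x| <= a * F x) -> (forall x, `|g x| <= b * G x) ->
  forall x, `|conv f g x| <= a * b * conv F G x.
Proof.
move=> mf mg mF mG lF lG lf lg fF gG x.
have l1 := conv_L1 mf mg lf lg x; have l2 := conv_L1 mF mG lF lG x.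
rewrite -IntZ//; apply: (le_trans (Int_abs l1)); apply: le_Int; [exact: L1_abs|exact: L1Z|].
move=> t; rewrite normrM (_ : a * b * _ = (a * F t) * (b * G (x - t))); last by ring.
by rewrite ler_pM.
Qed.

Lemma conv_comm f g x : measurable_fun [set: R] f -> measurable_fun [set: R] g ->
  L1 (fun x => f x ^+ 2) -> L1 (fun x => g x ^+ 2) -> conv f g x = conv g f x.
Proof.
move=> mf mg lf lg; rewrite /conv -(Int_reflect x (L1_measurable (conv_L1 mf mg lf lg x))).
by congr Int; apply/funext => t; rewrite mulrC subKr.
Qed.

(** |x| <= |t| + |x - t|, and the two resulting convolutions agree by commutativity. It distributes
    the extra factor |x| over the transform of the product eta g. *)
Lemma normM_conv n x : measurable_fun [set: R] n -> (forall x, 0 <= n x) ->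
  L1 (fun x => n x ^+ 2) -> L1 (fun x => (`|x| * n x) ^+ 2) ->
  `|x| * conv n n x <= 2 * conv n (fun x => `|x| * n x) x.
Proof.
move=> mn n0 ln lh; set h := fun x => `|x| * n x.
have mh : measurable_fun [set: R] h by apply: measurable_funM => //; exact: normr_measurable.
have l1 := conv_L1 mn mn ln ln x; have l2 := conv_L1 mn mh ln lh x; have l3 := conv_L1 mh mn lh ln x.
rewrite mulrDl !mul1r -{1}conv_comm// -IntD// -IntZ//.
apply: le_Int; [exact: L1Z|exact: L1D|] => t.
rewrite (_ : h t * n (x - t) + n t * h (x - t) = (`|t| + `|x - t|) * (n t * n (x - t))); last by rewrite /h; ring.
rewrite ler_wpM2r ?mulr_ge0//.
by rewrite (le_trans _ (ler_normD _ _))// addrC subrK.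
Qed.

End pairs.

(** * Conservation laws and spectral estimates of the wave system *)

Section system.
Context {R : realType}.
Notation mu := (@lebesgue_measure R).
Context (U1 U2 v1 v2 g : R -> R) (c : R).
Hypothesis aU1 : AC U1 v1.
Hypothesis aU2 : AC U2 v2.
Hypothesis av1 : AC v1 (fun x => c * v2 x - U1 x * g x).
Hypothesis av2 : AC v2 (fun x => - c * v1 x - U2 x * g x).
Hypothesis mg : measurable_fun [set: R] g.
Hypothesis lg : L1 (fun x => g x ^+ 2).
Hypothesis lv1 : L1 (fun x => v1 x ^+ 2).
Hypothesis lv2 : L1 (fun x => v2 x ^+ 2).
Let eta x := 1 - U1 x ^+ 2 - U2 x ^+ 2.
Hypothesis leta : L1 (fun x => eta x ^+ 2).
Let eta' x := - 2 * (U1 x * v1 x + U2 x * v2 x).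

Let mU1 : measurable_fun [set: R] U1. Proof. exact: AC_measurable aU1. Qed.
Let mU2 : measurable_fun [set: R] U2. Proof. exact: AC_measurable aU2. Qed.
Let mv1 : measurable_fun [set: R] v1. Proof. exact: AC_measurable av1. Qed.
Let mv2 : measurable_fun [set: R] v2. Proof. exact: AC_measurable av2. Qed.
Let meta : measurable_fun [set: R] eta.
Proof. by apply: measurable_funB; [apply: measurable_funB => //|]; exact: measurable_funX. Qed.

Let aeta : AC eta eta'.
Proof.
apply: (AC_eq _ _ (ACD (AC_cst 1) (ACZ (-1) (ACD (AC_mul aU1 aU1) (AC_mul aU2 aU2))))) => x.
- by rewrite /eta; ring.
- by rewrite /eta'; ring.
Qed.

(** The squares of both components are at most 1 - eta <= 2 + eta^2, whose integrals over unit
    intervals are uniformly bounded, and the derivatives are square integrable: [AC_bounded]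
    applies. *)
Let U_bounded : exists2 M, 0 <= M & forall x, `|U1 x| <= M /\ `|U2 x| <= M.
Proof.
have bd (F f : R -> R) : AC F f -> L1 (fun x => f x ^+ 2) -> (forall x, F x ^+ 2 <= 1 - eta x) ->
    exists M : R, forall x, `|F x| <= M.
  move=> aF lf Fe; apply: (AC_bounded (C := 2 + Int (fun x => eta x ^+ 2)) aF lf) => x.
  have [x1 ix1] : x <= x + 1 /\ True by split; rewrite ?lerDl.
  have li := L1_indic_itv x (x + 1).
  have lb : L1 (fun y => 2 * \1_(`]x, x + 1]%classic : set R) y + eta y ^+ 2) by apply: L1D => //; exact: L1Z.
  have -> : 2 + Int (fun x => eta x ^+ 2) = Int (fun y => 2 * \1_(`]x, x + 1]%classic : set R) y + eta y ^+ 2).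
    by rewrite IntD ?IntZ ?Int_indic_itv//; [lra|exact: L1Z].
  apply: le_Int => // [|y].
    by apply: Lloc_L1; apply: Lloc_continuous => z; apply: continuousM; exact: (AC_continuous aF).
  have i0 : 0 <= \1_(`]x, x + 1]%classic : set R) y :> R by [].
  have i1 : \1_(`]x, x + 1]%classic : set R) y <= 1 :> R by rewrite (le_trans (ler_norm _))// indic_itv_le1.
  move: (\1_(`]x, x + 1]%classic : set R) y) i0 i1 => i i0 i1.
  have := Fe y; have := sqr_ge0 (1 + eta y); have := sqr_ge0 (F y); have := sqr_ge0 (eta y); nra.
have [M1 h1] := bd _ _ aU1 lv1 (fun x => ltac:(rewrite /eta; have := sqr_ge0 (U2 x); lra)).
have [M2 h2] := bd _ _ aU2 lv2 (fun x => ltac:(rewrite /eta; have := sqr_ge0 (U1 x); lra)).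
exists (`|M1| + `|M2|); first by rewrite addr_ge0.
move=> x; split; [apply: (le_trans (h1 x))|apply: (le_trans (h2 x))].
- by apply: (le_trans (ler_norm _)); rewrite lerDl.
- by apply: (le_trans (ler_norm _)); rewrite lerDr.
Qed.

Lemma L1_sqrZ_bounded (a b f : R -> R) (M : R) : measurable_fun [set: R] f -> 0 <= M ->
  (forall x, `|f x| <= M * (`|a x| + `|b x|)) ->
  L1 (fun x => a x ^+ 2) -> L1 (fun x => b x ^+ 2) -> L1 (fun x => f x ^+ 2).
Proof.
move=> mf M0 fM la lb.
apply: (L1_le _ _ (L1Z (2 * M ^+ 2) (L1D la lb))); first exact: measurable_funX.
move=> x; rewrite normrX -(real_normK (num_real (a x))) -(real_normK (num_real (b x))).
move: (fM x) (normr_ge0 (f x)) (normr_ge0 (a x)) (normr_ge0 (b x)).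
move: `|f x| `|a x| `|b x| => F p q h F0 p0 q0.
apply: (@le_trans _ _ ((M * (p + q)) ^+ 2)); first by rewrite lerXn2r ?nnegrE ?mulr_ge0 ?addr_ge0.
have := mulr_ge0 (sqr_ge0 M) (sqr_ge0 (p - q)); nra.
Qed.

Let leta' : L1 (fun x => eta' x ^+ 2).
Proof.
have [M M0 UM] := U_bounded.
apply: (L1_sqrZ_bounded (a := v1) (b := v2) (M := 2 * M)) => //; last 2 first.
- by rewrite mulr_ge0.
- move=> x; rewrite /eta' normrM normrN (@ger0_norm _ 2)// -(mulrA 2 M) ler_wpM2l// mulrDr.
  have [h1 h2] := UM x; rewrite (le_trans (ler_normD _ _))// !normrM.
  by apply: lerD; exact: ler_wpM2r.
- by apply: measurable_funM => //; apply: measurable_funD; exact: measurable_funM.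
Qed.

(* The two sides differ by a constant, which is square integrable, hence zero. *)
Let momentum x : U2 x * v1 x - U1 x * v2 x = - (c / 2) * eta x.
Proof.
pose J x := U2 x * v1 x - U1 x * v2 x + c / 2 * eta x.
have [M M0 UM] := U_bounded.
have aJ : AC J (fun=> 0).
  apply: (AC_eq _ _ (ACD (ACD (AC_mul aU2 av1) (ACZ (-1) (AC_mul aU1 av2))) (ACZ (c / 2) aeta))) => y.
  - by rewrite /J; ring.
  - by rewrite /eta'; field.
have Jc y : J y = J 0 by exact: AC_0_cst aJ.
have lJ1 : L1 (fun x => (U2 x * v1 x - U1 x * v2 x) ^+ 2).
  apply: (L1_sqrZ_bounded (a := v1) (b := v2) (M := M)) => //.
  - by apply: measurable_funB; exact: measurable_funM.
  - move=> y; have [h1 h2] := UM y; rewrite (le_trans (ler_normB _ _))// !normrM mulrDr.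
    by apply: lerD; exact: ler_wpM2r.
have lJ : L1 (fun y => J y ^+ 2).
  apply: (L1_sqrZ_bounded (a := fun x => U2 x * v1 x - U1 x * v2 x) (b := eta) (M := 1 + `|c / 2|)) => //.
  - exact: AC_measurable aJ.
  - move=> y; rewrite (le_trans (ler_normD _ _))// normrM.
    move: (normr_ge0 (c / 2)) (normr_ge0 (eta y)) (normr_ge0 (U2 y * v1 y - U1 y * v2 y)).
    by move: `|c / 2| `|eta y| `|_ - _| => p q r; nra.
have J0 : J 0 = 0.
  by apply: L1_sqr_cst0; move: lJ; rewrite (_ : (fun y => J y ^+ 2) = fun=> J 0 ^+ 2)//; apply/funext => y; rewrite Jc.
by have := Jc x; rewrite J0 /J; lra.
Qed.

(** With [U1] and [U2] bounded, the right-hand sides of the equations for [v1] and [v2] are square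
    integrable, so [AC_bounded] applies once more. *)
Lemma system_bounded : exists M, forall x,
  [/\ `|U1 x| <= M, `|U2 x| <= M, `|v1 x| <= M & `|v2 x| <= M].
Proof.
have [M M0 UM] := U_bounded.
have bd (v w U : R -> R) (b : R) : measurable_fun [set: R] w -> measurable_fun [set: R] U ->
    L1 (fun x => w x ^+ 2) -> (forall x, `|U x| <= M) -> AC v (fun x => b * w x - U x * g x) ->
    L1 (fun x => v x ^+ 2) -> exists N : R, forall x, `|v x| <= N.
  move=> mw mU lw UM' av lv; apply: (AC_bounded (C := Int (fun x => v x ^+ 2)) av).
  - apply: (L1_sqrZ_bounded (a := w) (b := g) (M := `|b| + M)) => //.
    + by apply: measurable_funB; exact: measurable_funM.
    + by rewrite addr_ge0.
    + move=> x; rewrite (le_trans (ler_normB _ _))// !normrM mulrDr.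
      by apply: lerD; rewrite ler_wpM2r// ?lerDl// (le_trans (UM' x))// lerDr.
  - move=> x; apply: le_Int => // [|y].
      by apply: Lloc_L1; apply: Lloc_continuous => z; apply: continuousM; exact: (AC_continuous av).
    by rewrite ler_piMr ?sqr_ge0// (le_trans (ler_norm _))// indic_itv_le1.
have [N1 h1] := bd _ _ _ _ mv2 mU1 lv2 (fun x => (UM x).1) av1 lv1.
have [N2 h2] := bd _ _ _ _ mv1 mU2 lv1 (fun x => (UM x).2) av2 lv2.
exists (M + `|N1| + `|N2|) => x; have [u1 u2] := UM x.
have n1 := normr_ge0 N1; have n2 := normr_ge0 N2.
have w1 := le_trans (h1 x) (ler_norm N1); have w2 := le_trans (h2 x) (ler_norm N2).
by split; lra.
Qed.

Let K x := v1 x ^+ 2 + v2 x ^+ 2.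

Let lK : L1 K. Proof. exact: L1D. Qed.

(** The terms in c cancel, because the first-order coupling is a rotation. *)
Let aK : AC K (fun x => g x * eta' x).
Proof.
apply: (AC_eq _ _ (ACD (AC_mul av1 av1) (AC_mul av2 av2))) => x; first by rewrite /K; ring.
by rewrite /eta'; ring.
Qed.

(** Replacing |u|^2 by 1 - eta splits 2 g |u|^2 into 2 g - 2 eta g, and the momentum identity turns
    the first-order coupling into - c^2 eta. *)
Let aeta' : AC eta' (fun x => - c ^+ 2 * eta x + (2 * g x - 2 * (K x + eta x * g x))).
Proof.
apply: (AC_eq _ _ (ACZ (-2) (ACD (AC_mul aU1 av1) (AC_mul aU2 av2)))) => x; first by rewrite /eta'.
have := momentum x; rewrite {1}/eta /K => h.
transitivity (- 2 * (v1 x ^+ 2 + v2 x ^+ 2) + 2 * c * (U2 x * v1 x - U1 x * v2 x) +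
  2 * g x * (U1 x ^+ 2 + U2 x ^+ 2)); first by ring.
by rewrite h /eta; field.
Qed.

Context (m1 m2 p1 p2 : R -> R) (M : R).
Hypothesis Feta : FP eta m1 m2.
Hypothesis Fg : FP g p1 p2.
Hypothesis lm1 : L1 (fun x => m1 x ^+ 2).
Hypothesis lm2 : L1 (fun x => m2 x ^+ 2).
Hypothesis M0 : 0 <= M.
Let n x := `|m1 x| + `|m2 x|.
Hypothesis p1M : forall x, `|p1 x| <= M * n x.
Hypothesis p2M : forall x, `|p2 x| <= M * n x.

Let mm1 : measurable_fun [set: R] m1. Proof. by have [_ [] ] := Feta. Qed.
Let mm2 : measurable_fun [set: R] m2. Proof. by have [_ _ [] ] := Feta. Qed.
Let mp1 : measurable_fun [set: R] p1. Proof. by have [_ [] ] := Fg. Qed.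
Let mp2 : measurable_fun [set: R] p2. Proof. by have [_ _ [] ] := Fg. Qed.

Let mn : measurable_fun [set: R] n.
Proof. by apply: measurable_funD; apply: measurableT_comp => //; exact: normr_measurable. Qed.
Let n0 x : 0 <= n x. Proof. by rewrite addr_ge0. Qed.
Let nm1 x : `|m1 x| <= 1 * n x. Proof. by rewrite mul1r lerDl. Qed.
Let nm2 x : `|m2 x| <= 1 * n x. Proof. by rewrite mul1r lerDr. Qed.

Let ln2 : L1 (fun x => n x ^+ 2).
Proof.
apply: (L1_sqrZ_bounded (a := m1) (b := m2) (M := 1)) => // x.
by rewrite mul1r ger0_norm.
Qed.

Let Feta' : FP eta' (fun x => - (x * m2 x)) (fun x => x * m1 x).
Proof. by apply: FP_deriv aeta _ Feta; apply: sqr_tame => //; exact: AC_measurable aeta'. Qed.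

Let lQ : L1 (fun x => K x + eta x * g x).
Proof.
apply: L1D => //; apply: (L1_le _ _ (L1D leta lg)); first exact: measurable_funM.
by move=> x; exact: normM_le_sqr.
Qed.

Let Feta'' q1 q2 : FP (fun x => K x + eta x * g x) q1 q2 ->
  {ae mu, forall x, x ^+ 2 * m1 x = c ^+ 2 * m1 x - 2 * p1 x + 2 * q1 x /\
                    x ^+ 2 * m2 x = c ^+ 2 * m2 x - 2 * p2 x + 2 * q2 x}.
Proof.
move=> FQ.
have F2 : FP (fun x => - c ^+ 2 * eta x + (2 * g x - 2 * (K x + eta x * g x)))
    (fun x => - c ^+ 2 * m1 x + (2 * p1 x + -2 * q1 x)) (fun x => - c ^+ 2 * m2 x + (2 * p2 x + -2 * q2 x)).
  apply: FP_eqf (FPD (FPZ (- c ^+ 2) Feta) (FPD (FPZ 2 Fg) (FPZ (-2) FQ))) => x.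
  by ring.
have F3 := FP_deriv aeta' (let: And4 t _ _ _ := F2 in t) Feta'.
by apply: ae_imp (FP_unique F3 F2) => x [e1 e2]; split; lra.
Qed.

Let S := Int (fun x => `|K x + eta x * g x|).

Let S0 : 0 <= S. Proof. exact: Int_ge0. Qed.

(** The quadratic terms enter only through the boundedness, by S, of the transform of the integrable
    function K + eta g. *)
Let n_ae : {ae mu, forall x, x ^+ 2 * n x <= (c ^+ 2 + 4 * M) * n x + 4 * S}.
Proof.
have [q1 [q2 [FQ q1S q2S]]] : exists q1, exists q2, [/\ FP (fun x => K x + eta x * g x) q1 q2,
    forall x, `|q1 x| <= S & forall x, `|q2 x| <= S].
  exists (fun y => Int (fun x => (K x + eta x * g x) * cos (y * x))).
  exists (fun y => - Int (fun x => (K x + eta x * g x) * sin (y * x))).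
  split; first exact: FP_L1.
  - move=> y; have l := L1_cosM y lQ; apply: (le_trans (Int_abs l)); apply: le_Int; [exact: L1_abs|exact: L1_abs|].
    by move=> x; rewrite normrM ler_piMr// norm_cos_le1.
  - move=> y; have l := L1_sinM y lQ; rewrite normrN; apply: (le_trans (Int_abs l)); apply: le_Int; [exact: L1_abs|exact: L1_abs|].
    by move=> x; rewrite normrM ler_piMr// norm_sin_le1.
apply: ae_imp (Feta'' FQ) => x [e1 e2].
have b (m p q : R) : x ^+ 2 * m = c ^+ 2 * m - 2 * p + 2 * q -> `|p| <= M * n x -> `|q| <= S ->
    x ^+ 2 * `|m| <= c ^+ 2 * `|m| + 2 * (M * n x) + 2 * S.
  move=> e pM qS; rewrite -[x ^+ 2](ger0_norm (sqr_ge0 x)) -normrM e.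
  rewrite (le_trans (ler_normD _ _))// lerD//; last by rewrite normrM ger0_norm// ler_wpM2l.
  rewrite (le_trans (ler_normB _ _))// lerD//; last by rewrite normrM ger0_norm// ler_wpM2l.
  by rewrite normrM ger0_norm// sqr_ge0.
have := b _ _ _ e1 (p1M x) (q1S x); have := b _ _ _ e2 (p2M x) (q2S x).
by rewrite /n; lra.
Qed.

Let C0 : 0 <= c ^+ 2 + 4 * M. Proof. by rewrite addr_ge0 ?sqr_ge0// mulr_ge0. Qed.

Let ln : L1 n.
Proof. by apply: (weighted_L1 mn n0 ln2 C0 _ n_ae); rewrite mulr_ge0. Qed.

(** Multiplying the preceding bound by [n] gives x^2 n^2 <= C n^2 + 4 S n, with both terms on the
    right integrable by now. *)
Let lxn2 : L1 (fun x => (`|x| * n x) ^+ 2).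
Proof.
apply: (L1_leae _ _ (L1D (L1Z (c ^+ 2 + 4 * M) ln2) (L1Z (4 * S) ln))).
  by apply: measurable_funX; apply: measurable_funM => //; exact: normr_measurable.
apply: ae_imp n_ae => x /(ler_wpM2r (n0 x)); rewrite ger0_norm ?sqr_ge0// exprMn real_normK ?num_real//.
by move=> h; rewrite expr2 mulrA (le_trans h)//; lra.
Qed.

Let h x := `|x| * n x.
Let mh : measurable_fun [set: R] h.
Proof. by apply: measurable_funM => //; exact: normr_measurable. Qed.
Let dd := conv n h.
Let dd0 x : 0 <= dd x.
Proof. by apply: Int_ge0 => t; rewrite !mulr_ge0. Qed.

Let lm1' : L1 m1.
Proof. by apply: (L1_le _ _ ln) => // x; rewrite -[n x]mul1r. Qed.
Let lm2' : L1 m2.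
Proof. by apply: (L1_le _ _ ln) => // x; rewrite -[n x]mul1r. Qed.
Let lp1' : L1 p1. Proof. exact: (L1_le _ p1M (L1Z M ln)). Qed.
Let lp2' : L1 p2. Proof. exact: (L1_le _ p2M (L1Z M ln)). Qed.

Lemma L1_sqr_dom (f F : R -> R) (a : R) : measurable_fun [set: R] f ->
  (forall x, `|f x| <= a * F x) -> L1 (fun x => F x ^+ 2) -> L1 (fun x => f x ^+ 2).
Proof.
move=> mf fF lF; apply: (L1_le _ _ (L1Z (a ^+ 2) lF)); first exact: measurable_funX.
by move=> x; rewrite normrX -exprMn lerXn2r ?nnegrE// (le_trans _ (fF x)).
Qed.

Let lp1 : L1 (fun x => p1 x ^+ 2). Proof. exact: L1_sqr_dom p1M ln2. Qed.
Let lp2 : L1 (fun x => p2 x ^+ 2). Proof. exact: L1_sqr_dom p2M ln2. Qed.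

Lemma eta_trigint : {ae mu, forall x, eta x = trigint m1 m2 x}.
Proof.
by apply: (FP_inj Feta); apply: FP_inv => //; exact: hermitian_trigconj0 (FP_hermitian Feta).
Qed.

Lemma g_trigint : {ae mu, forall x, g x = trigint p1 p2 x}.
Proof.
by apply: (FP_inj Fg); apply: FP_inv => //; exact: hermitian_trigconj0 (FP_hermitian Fg).
Qed.

Let a1 x := - (x * m2 x).
Let a2 x := x * m1 x.
Let ma1 : measurable_fun [set: R] a1.
Proof. by apply: measurable_funN; exact: measurable_funM. Qed.
Let ma2 : measurable_fun [set: R] a2.
Proof. exact: measurable_funM. Qed.
Let a1h x : `|a1 x| <= 1 * h x.
Proof. by rewrite normrN normrM mul1r ler_wpM2l// -[n x]mul1r. Qed.
Let a2h x : `|a2 x| <= 1 * h x.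
Proof. by rewrite normrM mul1r ler_wpM2l// -[n x]mul1r. Qed.
Let la1 : L1 (fun x => a1 x ^+ 2). Proof. exact: L1_sqr_dom a1h lxn2. Qed.
Let la2 : L1 (fun x => a2 x ^+ 2). Proof. exact: L1_sqr_dom a2h lxn2. Qed.

(* The gain of a third power comes from the energy density K, whose derivative
   g eta' makes x times its transform a convolution. *)
Let n_ae3 : {ae mu, forall x, `|x| ^+ 3 * n x <= (c ^+ 2 + 24 * M) * h x + (c ^+ 2 + 24 * M) * dd x}.
Proof.
have pp : (2 * pi : R)^-1 <= 1.
  by have ppi := pi_ge2 R; rewrite invf_le1; lra.
have pp0 : 0 <= (2 * pi : R)^-1 by rewrite invr_ge0 mulr_ge0// pi_ge0.
pose k1 y := Int (fun x => K x * cos (y * x)); pose k2 y := - Int (fun x => K x * sin (y * x)).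
have FK : FP K k1 k2 by exact: FP_L1.
have FK' := FP_deriv aK _ FK.
have hp := hermitian_trigconj0 lp1' lp2' (FP_hermitian Fg).
have hm := hermitian_trigconj0 lm1' lm2' (FP_hermitian Feta).
have meta' : measurable_fun [set: R] eta' by exact: AC_measurable aeta'.
have lge : L1 (fun x => g x * eta' x).
  apply: (L1_le _ _ (L1D lg leta')); first exact: measurable_funM.
  by move=> x; exact: normM_le_sqr.
have {}FK' := FK' (L1_tame lge).
have Fge : FP (fun x => g x * eta' x) (fun x => (2 * pi)^-1 * (conv p1 a1 x - conv p2 a2 x))
     (fun x => (2 * pi)^-1 * (conv p1 a2 x + conv p2 a1 x)).
  apply: FP_aef (FP_mul lp1' lp2' hp lp1 lp2 ma1 ma2 la1 la2 Feta'); first exact: measurable_funM.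
  by apply: ae_imp g_trigint => x ->.
have Fee : FP (fun x => eta x * g x) (fun x => (2 * pi)^-1 * (conv m1 p1 x - conv m2 p2 x))
     (fun x => (2 * pi)^-1 * (conv m1 p2 x + conv m2 p1 x)).
  apply: FP_aef (FP_mul lm1' lm2' hm lm1 lm2 mp1 mp2 lp1 lp2 Fg); first exact: measurable_funM.
  by apply: ae_imp eta_trigint => x ->.
apply: ae_imp (ae_and (Feta'' (FPD FK Fee)) (FP_unique FK' Fge)) => x [[e1 e2] [e3 e4]].
have bpa (p a : R -> R) : measurable_fun [set: R] p -> L1 (fun x => p x ^+ 2) -> (forall x, `|p x| <= M * n x) ->
    measurable_fun [set: R] a -> L1 (fun x => a x ^+ 2) -> (forall x, `|a x| <= 1 * h x) ->
    `|conv p a x| <= M * dd x.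
  by move=> mp lp pM ma la aM; have := @conv_le _ _ _ _ _ M 1 mp ma mn mh ln2 lxn2 lp la pM aM x; rewrite mulr1.
have bmp (m p : R -> R) : measurable_fun [set: R] m -> L1 (fun x => m x ^+ 2) -> (forall x, `|m x| <= 1 * n x) ->
    measurable_fun [set: R] p -> L1 (fun x => p x ^+ 2) -> (forall x, `|p x| <= M * n x) ->
    `|x| * `|conv m p x| <= 2 * (M * dd x).
  move=> mm lm mM mp lp pM; have := @conv_le _ _ _ _ _ 1 M mm mp mn mn ln2 ln2 lm lp mM pM x; rewrite mul1r.
  move=> /(ler_wpM2l (normr_ge0 x)) /le_trans; apply.
  by rewrite mulrCA [leRHS]mulrCA ler_wpM2l// normM_conv.
have tri (a b B : R) : `|a| <= B -> `|b| <= B -> `|(2 * pi)^-1 * (a + b)| <= 2 * B.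
  move=> aB bB; rewrite normrM ger0_norm// (le_trans (ler_piMl _ pp))//.
  by rewrite (le_trans (ler_normD _ _))//; lra.
have k1b : `|x * k1 x| <= 2 * (M * dd x) by rewrite e4; apply: tri; exact: bpa.
have k2b : `|x * k2 x| <= 2 * (M * dd x).
  by rewrite -normrN e3; apply: tri; rewrite ?normrN; exact: bpa.
have tri2 (a b B : R) : `|x| * `|a| <= B -> `|x| * `|b| <= B -> `|x| * `|(2 * pi)^-1 * (a + b)| <= 2 * B.
  move=> aB bB; rewrite -normrM (_ : x * _ = (2 * pi)^-1 * (x * a + x * b)); last by ring.
  by apply: tri; rewrite normrM.
have b1 : `|x| * `|(2 * pi)^-1 * (conv m1 p1 x - conv m2 p2 x)| <= 2 * (2 * (M * dd x)).
  by apply: tri2; rewrite ?normrN; exact: bmp.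
have b2 : `|x| * `|(2 * pi)^-1 * (conv m1 p2 x + conv m2 p1 x)| <= 2 * (2 * (M * dd x)).
  by apply: tri2; exact: bmp.
(* The constant 12 is 2 (2 + 4): twice the bounds 2 M dd for x times the transform of [K] and 4 M dd
   for that of eta g. Adding the two components of [n] makes it 24. *)
have fin (m p k e : R) : x ^+ 2 * m = c ^+ 2 * m - 2 * p + 2 * (k + e) -> `|p| <= M * n x ->
    `|x * k| <= 2 * (M * dd x) -> `|x| * `|e| <= 2 * (2 * (M * dd x)) ->
    `|x| ^+ 3 * `|m| <= c ^+ 2 * (`|x| * `|m|) + 2 * (M * h x) + 12 * (M * dd x).
  move=> e0E pM kb eb; rewrite exprS -mulrA -normrX -[`|x ^+ 2| * _]normrM e0E.
  have n2 (y : R) : `|2 * y| = 2 * `|y| by rewrite normrM ger0_norm.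
  have : `|c ^+ 2 * m - 2 * p + 2 * (k + e)| <= c ^+ 2 * `|m| + 2 * (M * n x) + 2 * (`|k| + `|e|).
    rewrite (le_trans (ler_normD _ _))// lerD//; last by rewrite n2 ler_wpM2l// ler_normD.
    rewrite (le_trans (ler_normB _ _))// lerD//; last by rewrite n2 ler_wpM2l.
    by rewrite normrM ger0_norm// sqr_ge0.
  move=> /(ler_wpM2l (normr_ge0 x)) /le_trans; apply.
  by rewrite normrM in kb; rewrite /h; lra.
have := fin _ _ _ _ e1 (p1M x) k1b b1; have := fin _ _ _ _ e2 (p2M x) k2b b2.
have h1 : 0 <= c ^+ 2 * dd x by rewrite mulr_ge0 ?sqr_ge0.
have h2 : 0 <= M * h x by rewrite !mulr_ge0.
move: h1 h2; rewrite /h /n; lra.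
Qed.

Lemma system_moments : exists A B : R, [/\ 0 <= A, 1 <= B &
  forall k, L1 (fun x => `|x| ^+ k * n x) /\ Int (fun x => `|x| ^+ k * n x) <= A * B ^+ k * k`!%:R].
Proof.
have c0 : 0 <= c ^+ 2 + 24 * M by rewrite addr_ge0 ?sqr_ge0// mulr_ge0.
have [A [B [A0 B1 AB]]] := moments_factorial mn n0 ln ln2 lxn2 c0 n_ae3.
by exists A, B; split => // k; split; [exact: moments_L1 mn n0 ln ln2 lxn2 c0 n_ae3 k|].
Qed.

End system.

(** * Normalized derivatives *)

Section smoothness.
Context {R : realType}.
Notation mu := (@lebesgue_measure R).
Implicit Types (F f g : R -> R) (x : R).

Lemma AC_is_derive F f x : AC F f -> continuous f -> is_derive x 1 F (f x).
Proof.
move=> [lf FE] cf; pose a := x - 1.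
have ax : a < x by rewrite /a; lra.
have xu : x < x + 1 by lra.
have li : mu.-integrable `]a, x + 1] (EFin \o f).
  have : L1 (f \_ `]a, x + 1]).
    have := Lloc_L1 a (x + 1) lf; congr L1; apply/funext => y.
    by rewrite patchE indicE; case: ifP; rewrite ?mulr1 ?mulr0.
  rewrite /L1 => h; rewrite integrable_mkcond//; move: h; congr (_.-integrable _ _).
  by apply/funext => y /=; rewrite !patchE; case: ifP.
have [dG GE] := continuous_FTC1 xu li ax (cf x).
pose G y := F a + \int[mu]_(t in `]a, y]) f t.
have dG' : is_derive x 1 G (f x).
  have h : is_derive x 1 (fun y => \int[mu]_(t in `]a, y]) f t) (f x).
    by apply: DeriveDef => //; rewrite -derive1E.
  by have := derD (der_cst x (F a)) h; rewrite add0r.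
have e : \forall y \near x, G y = F y.
  near=> y; have ay : a < y by near: y; exact: lt_nbhsr.
  rewrite /G -[F y](subrK (F a)) (FE _ _ (ltW ay)) addrC; congr (_ + _).
  rewrite /II [LHS]Rintegral_mkcond; congr Int; apply/funext => z.
  by rewrite patchE indicE; case: ifP; rewrite ?mulr1 ?mulr0.
exact: near_eq_is_derive e dG'.
Unshelve. all: by end_near.
Qed.

Lemma trigint_der (a1 a2 : R -> R) x : L1 a1 -> L1 a2 ->
  L1 (fun t => t * a1 t) -> L1 (fun t => t * a2 t) ->
  is_derive x 1 (trigint a1 a2) (trigint (fun t => - (t * a2 t)) (fun t => t * a1 t) x).
Proof.
move=> l1 l2 lt1 lt2.
have d a (k k' : R -> R) : L1 a -> L1 (fun t => t * a t) -> (forall x : R, is_derive x 1 k (k' x)) ->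
    (forall x, `|k x| <= 1) -> (forall x, `|k' x| <= 1) ->
    is_derive x 1 (fun x => Int (fun t => a t * k (x * t))) (Int (fun t => t * a t * k' (x * t))).
  move=> la lta dk k1 k'1.
  have ck := derivative_continuous dk.
  apply: (@der_Int _ (fun x t => a t * k (x * t)) (fun x t => t * a t * k' (x * t)) (fun t => `|t * a t|)).
  - move=> y; apply: (L1_bnd la _ (fun t => k1 (y * t))).
    by apply: (measurableT_comp (continuous_measurable ck)); exact: measurable_funM.
  - move=> y t.
    have dy : is_derive y 1 (fun y => y * t) (1 * t + y * 0) := derM (der_id y) (der_cst y t).
    by apply: (der_eq (derZ (a t) (@der_comp _ k (fun y => y * t) y _ _ (dk (y * t)) dy))); ring.
  - exact: L1_abs.
  - by move=> y t _; rewrite normrM ler_piMr.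
have dc := d a1 cos (fun x => - sin x) l1 lt1 (fun x => is_derive_cos x) norm_cos_le1
  (fun x => ltac:(rewrite normrN; exact: norm_sin_le1)).
have ds := d a2 sin cos l2 lt2 (fun x => is_derive_sin x) norm_sin_le1 norm_cos_le1.
apply: (der_eq (derZ (2 * pi)^-1 (derB dc ds))); rewrite /trigint; congr (_ * _).
have ls1 := L1_sinM x lt1; have lc2 := L1_cosM x lt2.
under eq_fun do rewrite mulrN.
rewrite (IntN ls1) addrC; congr (_ - _); rewrite -(IntN lc2).
by congr Int; apply/funext => t; rewrite mulNr.
Qed.

(* d n is the n-th derivative of d 0 divided by n!, so that the coefficients of
   a product are Cauchy products. *)
Definition taylor_seq (d : nat -> R -> R) (A B : R) : Prop :=
  (forall n x, is_derive x 1 (d n) (n.+1%:R * d n.+1 x)) /\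
  (forall n x, `|d n x| <= A * B ^+ n).

(** Each differentiation multiplies the spectrum by i t, which is [T], and its size by |t|; the k!
    in the moment bound is cancelled by the normalization. *)
Lemma trigint_taylor (a1 a2 : R -> R) (A B : R) :
  measurable_fun [set: R] a1 -> measurable_fun [set: R] a2 -> 
  (forall k, L1 (fun x => `|x| ^+ k * (`|a1 x| + `|a2 x|)) /\
    Int (fun x => `|x| ^+ k * (`|a1 x| + `|a2 x|)) <= A * B ^+ k * k`!%:R) ->
  exists2 d, taylor_seq d A B & d 0 = trigint a1 a2.
Proof.
move=> ma1 ma2 mom.
pose T (a : (R -> R) * (R -> R)) := ((fun t => - (t * a.2 t)), (fun t => t * a.1 t)) : (R -> R) * (R -> R).
pose a k := iter k T (a1, a2).
pose n x := `|a1 x| + `|a2 x|.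
have ma k : measurable_fun [set: R] (a k).1 /\ measurable_fun [set: R] (a k).2.
  elim: k => [//|k [h1 h2]] /=; split; [apply: measurable_funN|]; exact: measurable_funM.
have ab k x : `|(a k).1 x| + `|(a k).2 x| = `|x| ^+ k * n x.
  elim: k => [|k IH]; first by rewrite mul1r.
  by rewrite /= normrN !normrM -mulrDr exprS -mulrA addrC [_ + `|(a k).2 x|]addrC addrC IH.
have la k : L1 (a k).1 /\ L1 (a k).2.
  have [l _] := mom k; have [m1 m2] := ma k.
  by split; apply: (L1_le _ _ l) => // x; rewrite -[leRHS](ab k) ?lerDl ?lerDr.
pose d k x := k`!%:R^-1 * trigint (a k).1 (a k).2 x.
exists d; last by apply/funext => x; rewrite /d invr1 mul1r.
split=> k x.
- have [l1 l2] := la k; have [/= l3 l4] := la k.+1.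
  have l3' : L1 (fun t => t * (a k).2 t) by have := L1N l3; under eq_fun do rewrite opprK.
  apply: (der_eq (derZ k`!%:R^-1 (trigint_der x l1 l2 l4 l3'))).
  by rewrite /d factS natrM invfM -(mulrA k.+1%:R^-1) mulVKf// pnatr_eq0.
- have [l1 l2] := la k; rewrite /d normrM ger0_norm; last by rewrite invr_ge0.
  have f0 : 0 < k`!%:R :> R by rewrite ltr0n fact_gt0.
  rewrite mulrC ler_pdivrMr//.
  have [lk] := mom k; apply: le_trans.
  rewrite /trigint normrM ger0_norm ?invr_ge0 ?mulr_ge0 ?pi_ge0//.
  apply: (@le_trans _ _ (1 * (Int (fun t => `|(a k).1 t|) + Int (fun t => `|(a k).2 t|)))).
    apply: ler_pM => //; first by rewrite invr_ge0 mulr_ge0// pi_ge0.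
    + by have ppi := pi_ge2 R; rewrite invf_le1; lra.
    + rewrite (le_trans (ler_normB _ _))// lerD//.
      * apply: (le_trans (Int_abs (L1_cosM x l1))); apply: le_Int; [exact/L1_abs/L1_cosM|exact: L1_abs|].
        by move=> t; rewrite normrM ler_piMr// norm_cos_le1.
      * apply: (le_trans (Int_abs (L1_sinM x l2))); apply: le_Int; [exact/L1_abs/L1_sinM|exact: L1_abs|].
        by move=> t; rewrite normrM ler_piMr// norm_sin_le1.
  rewrite mul1r -IntD; [|exact: L1_abs|exact: L1_abs].
  by rewrite le_eqVlt; apply/orP; left; apply/eqP; congr Int; apply/funext => t; rewrite ab.
Qed.

End smoothness.

(** * Linear second order system with a Taylor-bounded coefficient *)

Section ode.
Context {R : realType}.
Implicit Types (f g : R -> R) (d e h : nat -> R -> R) (x : R).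

Lemma der_sum m (F dF : nat -> R -> R) x :
  (forall k, (k < m)%N -> is_derive x 1 (F k) (dF k x)) ->
  is_derive x 1 (fun y => \sum_(k < m) F k y) (\sum_(k < m) dF k x).
Proof.
elim: m => [|m IH] h.
  by rewrite big_ord0; under eq_fun do rewrite big_ord0; exact: der_cst.
rewrite big_ord_recr /=; under eq_fun do rewrite big_ord_recr /=.
by apply: derD; [apply: IH => k km; exact: h (ltnW km)|exact: h].
Qed.

(** Leibniz's rule for normalized derivatives: on the right each weight n + 1 is split as k + (n + 1
    - k), and each half loses the end term whose weight is zero. *)
Lemma sum_cauchy_der n (p q : nat -> R) :
  \sum_(k < n.+1) (k.+1%:R * p k.+1 * q (n - k)%N + p k * ((n - k).+1%:R * q (n - k).+1)) =
  n.+1%:R * \sum_(k < n.+2) p k * q (n.+1 - k)%N.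
Proof.
rewrite big_split /= mulr_sumr.
have -> : \sum_(k < n.+2) n.+1%:R * (p k * q (n.+1 - k)%N) =
    \sum_(k < n.+2) (k%:R * p k * q (n.+1 - k)%N) +
    \sum_(k < n.+2) (p k * ((n.+1 - k)%:R * q (n.+1 - k)%N)).
  rewrite -big_split; apply: eq_bigr => k _ /=.
  by rewrite natrB; [ring|rewrite -ltnS].
congr (_ + _).
- rewrite [RHS]big_ord_recl /= mulr0n !mul0r add0r; apply: eq_bigr => k _; by rewrite /bump /= add1n subSS.
- rewrite [RHS]big_ord_recr /= subnn mulr0n mul0r mulr0 addr0; apply: eq_bigr => k _.
  by rewrite subSn// -ltnS.
Qed.

(** The n-th derivative divided by n!, available as a total function before any differentiability is
    known. *)
Fixpoint taylor_coeff f n : R -> R :=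
  if n is m.+1 then fun x => m.+1%:R^-1 * derive1 (taylor_coeff f m) x else f.

Lemma taylor_coeff_der f n x a : is_derive x 1 (taylor_coeff f n) a ->
  n.+1%:R * taylor_coeff f n.+1 x = a.
Proof. by move=> /der_val /= ->; rewrite mulVKf// pnatr_eq0. Qed.

Lemma cauchy_der n d h x :
  (forall k, (k <= n)%N -> is_derive x 1 (d k) (k.+1%:R * d k.+1 x)) ->
  (forall k, is_derive x 1 (h k) (k.+1%:R * h k.+1 x)) ->
  is_derive x 1 (fun y => \sum_(k < n.+1) d k y * h (n - k)%N y)
    (n.+1%:R * \sum_(k < n.+2) d k x * h (n.+1 - k)%N x).
Proof.
move=> dd dh.
rewrite -(sum_cauchy_der n (fun k => d k x) (fun k => h k x)).
apply: (@der_sum n.+1 (fun k y => d k y * h (n - k)%N y) (fun k y => k.+1%:R * d k.+1 y * h (n - k)%N y + d k y * ((n - k).+1%:R * h (n - k).+1 y))).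
by move=> k kn; exact: derM (dd k kn) (dh _).
Qed.

Section system.
Context (U1 U2 v1 v2 : R -> R) (h : nat -> R -> R) (c : R).
Hypothesis dh : forall n x, is_derive x 1 (h n) (n.+1%:R * h n.+1 x).
Hypothesis dU1 : forall x, is_derive x 1 U1 (v1 x).
Hypothesis dU2 : forall x, is_derive x 1 U2 (v2 x).
Hypothesis dv1 : forall x, is_derive x 1 v1 (c * v2 x - U1 x * h 0 x).
Hypothesis dv2 : forall x, is_derive x 1 v2 (- c * v1 x - U2 x * h 0 x).
Let d := taylor_coeff U1.
Let e := taylor_coeff U2.

Let d1E : d 1 = v1.
Proof. by apply/funext => x; have := taylor_coeff_der (n := 0) (dU1 x); rewrite mul1r. Qed.

Let e1E : e 1 = v2.
Proof. by apply/funext => x; have := taylor_coeff_der (n := 0) (dU2 x); rewrite mul1r. Qed.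

(** Differentiability and recursion are proved together: the recursion writes order n + 2 through
    lower orders and [h], already known to be differentiable, and differentiating it gives the
    recursion at the next order. *)
Let inv n := [/\ forall k x, (k <= n.+1)%N -> is_derive x 1 (d k) (k.+1%:R * d k.+1 x),
  forall k x, (k <= n.+1)%N -> is_derive x 1 (e k) (k.+1%:R * e k.+1 x),
  forall x, n.+2%:R * n.+1%:R * d n.+2 x = c * n.+1%:R * e n.+1 x - \sum_(k < n.+1) d k x * h (n - k)%N x &
  forall x, n.+2%:R * n.+1%:R * e n.+2 x = - c * n.+1%:R * d n.+1 x - \sum_(k < n.+1) e k x * h (n - k)%N x].

Let step n (p q : nat -> R -> R) (b : R) :
  (forall k x, (k <= n.+1)%N -> is_derive x 1 (p k) (k.+1%:R * p k.+1 x)) ->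
  (forall k x, (k <= n.+1)%N -> is_derive x 1 (q k) (k.+1%:R * q k.+1 x)) ->
  (forall x, n.+2%:R * n.+1%:R * p n.+2 x = b * n.+1%:R * q n.+1 x - \sum_(k < n.+1) p k x * h (n - k)%N x) ->
  forall x, is_derive x 1 (p n.+2)
   (n.+2%:R^-1 * (b * n.+2%:R * q n.+2 x - \sum_(k < n.+2) p k x * h (n.+1 - k)%N x)).
Proof.
move=> dp dq pE x.
have n1 : n.+1%:R != 0 :> R by rewrite pnatr_eq0.
have n2 : n.+2%:R != 0 :> R by rewrite pnatr_eq0.
have -> : p n.+2 = fun y => (n.+2%:R * n.+1%:R)^-1 * (b * n.+1%:R * q n.+1 y - \sum_(k < n.+1) p k y * h (n - k)%N y).
  by apply/funext => y; rewrite -pE mulKf// mulf_neq0.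
have dc := cauchy_der (fun k kn => dp k x (leqW kn)) (fun k => dh k x).
apply: (der_eq (derZ (n.+2%:R * n.+1%:R)^-1 (derB (derZ (b * n.+1%:R) (dq n.+1 x (leqnn _))) dc))).
by move: (\sum_(k < n.+2) _) n1 n2; move: (n.+1%:R) (n.+2%:R) => a a' s a0 a'0; field; rewrite a0 a'0.
Qed.

Let inv_all n : inv n.
Proof.
elim: n => [|n [dd de fd fe]].
  have H1 x : is_derive x 1 (d 1) (c * v2 x - U1 x * h 0 x) by rewrite d1E; exact: dv1.
  have H2 x : is_derive x 1 (e 1) (- c * v1 x - U2 x * h 0 x) by rewrite e1E; exact: dv2.
  have dd k x : (k <= 1)%N -> is_derive x 1 (d k) (k.+1%:R * d k.+1 x).
    case: k => [_|[_|//]]; first by rewrite d1E mul1r; exact: dU1.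
    by rewrite (taylor_coeff_der (H1 x)).
  have de k x : (k <= 1)%N -> is_derive x 1 (e k) (k.+1%:R * e k.+1 x).
    case: k => [_|[_|//]]; first by rewrite e1E mul1r; exact: dU2.
    by rewrite (taylor_coeff_der (H2 x)).
  split=> // x; rewrite big_ord1 subn0 !mulr1.
  - by rewrite (taylor_coeff_der (H1 x)) e1E.
  - by rewrite (taylor_coeff_der (H2 x)) d1E.
have sd x := step dd de fd x; have se x := step de dd fe x.
have n2 : n.+2%:R != 0 :> R by rewrite pnatr_eq0.
split.
- move=> k x; rewrite leq_eqVlt => /predU1P[->|]; last by rewrite ltnS; exact: dd.
  by rewrite (taylor_coeff_der (sd x)).
- move=> k x; rewrite leq_eqVlt => /predU1P[->|]; last by rewrite ltnS; exact: de.
  by rewrite (taylor_coeff_der (se x)).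
- by move=> x; rewrite mulrAC (taylor_coeff_der (sd x)) mulrC mulVKf.
- by move=> x; rewrite mulrAC (taylor_coeff_der (se x)) mulrC mulVKf.
Qed.

Context (A0 B0 M : R).
Hypothesis hb : forall n x, `|h n x| <= A0 * B0 ^+ n.
Hypothesis B01 : 1 <= B0.
Hypothesis c0 : 0 <= c.
Hypothesis Ub : forall x, [/\ `|U1 x| <= M, `|U2 x| <= M, `|v1 x| <= M & `|v2 x| <= M].

Context (B : R).
Hypothesis BE : B = B0 + c + A0.

Let A00 : 0 <= A0.
Proof. by have := hb 0 0; rewrite mulr1; exact: le_trans. Qed.
Let M0 : 0 <= M.
Proof. by have [h1 _ _ _] := Ub 0; exact: le_trans h1. Qed.
Let B1 : 1 <= B.
Proof. by rewrite BE -addrA (le_trans B01)// lerDl addr_ge0. Qed.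
Let Bp n : 0 <= B ^+ n.
Proof. by rewrite exprn_ge0// (le_trans ler01). Qed.

(** After division by n + 1 the right side of the recursion is at most M (c B^(n+1) + A0 B^n) <= M
    (c + A0) B^(n+1) <= M B^(n+2), whence B = B0 + c + A0; the factor n + 2 on the left is given
    away. *)
Let bound n (p q : nat -> R -> R) (b x : R) : `|b| <= c ->
  (forall k, (k <= n.+1)%N -> `|p k x| <= M * B ^+ k) ->
  (forall k, (k <= n.+1)%N -> `|q k x| <= M * B ^+ k) ->
  n.+2%:R * n.+1%:R * p n.+2 x = b * n.+1%:R * q n.+1 x - \sum_(k < n.+1) p k x * h (n - k)%N x ->
  `|p n.+2 x| <= M * B ^+ n.+2.
Proof.
move=> bc pb qb pE.
have B00 : 0 <= B0 := le_trans ler01 B01.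
have Bge0 : 0 <= B := le_trans ler01 B1.
have B0B : B0 <= B by rewrite BE -addrA lerDl addr_ge0.
have n1 : 0 < n.+1%:R :> R by rewrite ltr0n.
have n2 : 1 <= n.+2%:R :> R by rewrite ler1n.
have s : `|\sum_(k < n.+1) p k x * h (n - k)%N x| <= n.+1%:R * (M * A0 * B ^+ n).
  apply: (le_trans (ler_norm_sum _ _ _)).
  apply: (@le_trans _ _ (\sum_(k < n.+1) (M * A0 * B ^+ n))); last first.
    by rewrite sumr_const card_ord -[leLHS]mulr_natl.
  apply: ler_sum => k _; have kn : (k <= n)%N by rewrite -ltnS.
  rewrite normrM; apply: (@le_trans _ _ (M * B ^+ k * (A0 * B ^+ (n - k)))).
    apply: ler_pM => //; first by apply: pb; exact: leqW.
    apply: (le_trans (hb _ _)); by rewrite ler_wpM2l// lerXn2r ?nnegrE.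
  have -> : B ^+ n = B ^+ k * B ^+ (n - k) by rewrite -exprD subnKC.
  by rewrite le_eqVlt; apply/orP; left; apply/eqP; ring.
have t : `|b * n.+1%:R * q n.+1 x| <= n.+1%:R * (c * (M * B ^+ n.+1)).
  rewrite !normrM (ger0_norm (ltW n1)) mulrAC mulrC ler_wpM2l ?(ltW n1)//.
  by rewrite ler_pM// qb.
have : n.+2%:R * n.+1%:R * `|p n.+2 x| <= n.+1%:R * (c * (M * B ^+ n.+1)) + n.+1%:R * (M * A0 * B ^+ n).
  have -> : n.+2%:R * n.+1%:R * `|p n.+2 x| = `|n.+2%:R * n.+1%:R * p n.+2 x|.
    by rewrite normrM ger0_norm.
  by rewrite pE (le_trans (ler_normB _ _))// lerD.
have h1 : M * A0 * B ^+ n <= M * A0 * B ^+ n.+1.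
  by rewrite ler_wpM2l ?mulr_ge0// exprS ler_peMl.
have h2 : M * ((c + A0) * B ^+ n.+1) <= M * B ^+ n.+2.
  by rewrite ler_wpM2l// (exprS B n.+1) ler_wpM2r// BE -addrA lerDr (le_trans ler01).
have p0 := normr_ge0 (p n.+2 x).
rewrite -mulrDr mulrAC mulrC ler_pM2l// => h3.
have h4 : `|p n.+2 x| <= n.+2%:R * `|p n.+2 x| by rewrite ler_peMl.
apply: (le_trans h4); apply: (le_trans h3); apply: le_trans h2.
have -> : M * ((c + A0) * B ^+ n.+1) = c * (M * B ^+ n.+1) + M * A0 * B ^+ n.+1 by ring.
by rewrite lerD2l.
Qed.

Let bounds n : forall k x, (k <= n.+1)%N -> `|d k x| <= M * B ^+ k /\ `|e k x| <= M * B ^+ k.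
Proof.
elim: n => [|n IH] k x.
  have [u1 u2 w1 w2] := Ub x.
  case: k => [_|[_|//]]; first by rewrite !mulr1.
  by rewrite d1E e1E expr1; split; [apply: (le_trans w1)|apply: (le_trans w2)]; rewrite ler_peMr.
rewrite leq_eqVlt => /predU1P[->|]; last by rewrite ltnS; exact: IH.
have [_ _ fd fe] := inv_all n.
split.
- apply: (bound (b := c) _ _ _ (fd x)); first by rewrite ger0_norm.
  + by move=> j jn; have [] := IH j x jn.
  + by move=> j jn; have [] := IH j x jn.
- apply: (bound (b := - c) _ _ _ (fe x)); first by rewrite normrN ger0_norm.
  + by move=> j jn; have [] := IH j x jn.
  + by move=> j jn; have [] := IH j x jn.
Qed.

Lemma ode_taylor : taylor_seq d M B /\ taylor_seq e M B.
Proof.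
split; (split => n x; [have [dd de _ _] := inv_all n; exact: dd || exact: de|]).
- by have [] := bounds x (leqnSn n).
- by have [] := bounds x (leqnSn n).
Qed.

End system.
End ode.

(** * Analytic extension to a strip *)

Lemma bin_le_exp2 n k : ('C(n, k) <= 2 ^ n)%N.
Proof.
elim: n k => [|n IH] [|k]; rewrite ?bin0 ?expn_gt0// binS expnS mul2n -addnn.
by rewrite leq_add.
Qed.

Lemma leq_exp2 n : (n <= 2 ^ n)%N.
Proof. exact: ltnW (ltn_expl n (ltnSn 1)). Qed.

Section taylor.
Context {R : realType}.
Implicit Types (d : nat -> R -> R) (x h : R).

Lemma derX (f : R -> R) n x (a : R) : is_derive x 1 f a ->
  is_derive x 1 (fun y => f y ^+ n) (n%:R * f x ^+ n.-1 * a).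
Proof.
move=> df; elim: n => [|n IH]; first by rewrite !mul0r; exact: der_cst.
under eq_fun do rewrite exprS.
apply: (der_eq (derM df IH)); case: n {IH} => [|n] /=; first by rewrite expr0; ring.
by rewrite -[n.+2%:R]natr1 exprS; ring.
Qed.

(** Normalizing derivatives of [d k] by n! instead of (n + k)!/k! produces the binomial coefficient,
    which is at most 2^(n+k); hence the doubled ratio. *)
Lemma taylor_shift d A B k : 0 <= B -> taylor_seq d A B ->
  taylor_seq (fun n x => 'C(n + k, k)%:R * d (n + k)%N x) (A * (2 * B) ^+ k) (2 * B).
Proof.
move=> B0 [dd db]; split => n x.
  apply: (der_eq (derZ 'C(n + k, k)%:R (dd (n + k)%N x))).
  rewrite !mulrA -!natrM addSn; congr (_%:R * _).
  by rewrite mulnC (mul_bin_down (n + k).+1 k) subSn ?leq_addl// addnK.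
have A0 : 0 <= A by have := db 0%N x; rewrite mulr1; exact: le_trans.
rewrite normrM ger0_norm//; apply: (@le_trans _ _ (2 ^+ (n + k) * (A * B ^+ (n + k)))).
  by apply: ler_pM => //; rewrite -natrX ler_nat bin_le_exp2.
by rewrite le_eqVlt; apply/orP; left; apply/eqP; rewrite !exprMn !exprD; ring.
Qed.

Lemma taylor_remainder d A B x h N : 0 <= B -> taylor_seq d A B ->
  `|d 0%N (x + h) - \sum_(n < N) d n x * h ^+ n| <= A * (2 * B * `|h|) ^+ N.
Proof.
move=> B0 [dd db].
have A0 : 0 <= A by have := db 0%N x; rewrite mulr1; exact: le_trans.
case: N => [|N]; first by rewrite big_ord0 subr0; have := db 0%N (x + h); rewrite !mulr1.
(* The Taylor polynomial centred at x + t h, evaluated at x + h: it runs from the polynomial at x to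
   the exact value. The mean value theorem gives Cauchy's form of the remainder, and N + 1 <=
   2^(N+1) explains the factor 2. *)
pose G (t : R) := \sum_(n < N.+1) d n (x + t * h) * (h * (1 - t)) ^+ n.
pose dG (t : R) := N.+1%:R * h * d N.+1 (x + t * h) * (h * (1 - t)) ^+ N.
have dl (t : R) : is_derive t 1 (fun t => x + t * h) h.
  by apply: (der_eq (derD (der_cst t x) (derM (der_id t) (der_cst t h)))); ring.
have dp (t : R) : is_derive t 1 (fun t => h * (1 - t)) (- h).
  by apply: (der_eq (derZ h (derB (der_cst t 1) (der_id t)))); ring.
have dt n (t : R) : is_derive t 1 (fun t => d n (x + t * h) * (h * (1 - t)) ^+ n)
    (n.+1%:R * h * d n.+1 (x + t * h) * (h * (1 - t)) ^+ n - n%:R * h * d n (x + t * h) * (h * (1 - t)) ^+ n.-1).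
  have e1 := @der_comp _ (d n) (fun t => x + t * h) t _ _ (dd n (x + t * h)) (dl t).
  by apply: (der_eq (derM e1 (derX n (dp t)))); ring.
(* The derivative of G telescopes. *)
have dGE (t : R) : is_derive t 1 G (dG t).
  rewrite /G /dG; elim: N {G dG} => [|N IH].
    under eq_fun do rewrite big_ord1; apply: (der_eq (dt 0%N t)); ring.
  under eq_fun do rewrite big_ord_recr /=.
  by apply: (der_eq (derD IH (dt N.+1 t))) => /=; ring.
have cG := derivative_continuous dGE.
have [t t01 Gt] := MVT (@ltr01 R) (fun t _ => dGE t) (continuous_subspaceT cG).
move: t01; rewrite in_itv /= => /andP[t0 t1].
have -> : d 0%N (x + h) = G 1.
  rewrite /G big_ord_recl /= subrr mulr0 mul1r expr0 mulr1 big1 ?addr0// => i _.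
  by rewrite exprS !mul0r mulr0.
have -> : \sum_(n < N.+1) d n x * h ^+ n = G 0.
  by apply: eq_bigr => n _; rewrite mul0r addr0 subr0 mulr1.
rewrite Gt subr0 mulr1 /dG !normrM normrX.
have h1 : `|h * (1 - t)| <= `|h|.
  by rewrite normrM ler_piMr// ger0_norm; lra.
apply: (@le_trans _ _ (N.+1%:R * `|h| * (A * B ^+ N.+1) * `|h| ^+ N)).
  rewrite ger0_norm// -!mulrA ler_wpM2l// ler_wpM2l//.
  rewrite [leRHS]mulrA ler_pM// ?exprn_ge0//; first by rewrite lerXn2r ?nnegrE.
have -> : A * (2 * B * `|h|) ^+ N.+1 = 2 ^+ N.+1 * (A * B ^+ N.+1 * `|h| ^+ N.+1).
  by rewrite !exprMn; ring.
have -> : N.+1%:R * `|h| * (A * B ^+ N.+1) * `|h| ^+ N = N.+1%:R * (A * B ^+ N.+1 * `|h| ^+ N.+1).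
  by rewrite (exprS `|h|); ring.
rewrite ler_wpM2r//; last by rewrite -natrX ler_nat leq_exp2.
by rewrite !mulr_ge0// exprn_ge0.
Qed.

Lemma taylor_remainder_shift d A B x h n K : 0 <= B -> taylor_seq d A B ->
  `|d n (x + h) - \sum_(k < K) 'C(n + k, n)%:R * d (n + k)%N x * h ^+ k| <=
    A * (2 * B) ^+ n * (4 * B * `|h|) ^+ K.
Proof.
move=> B0 td; have B20 : 0 <= 2 * B by rewrite mulr_ge0.
have := taylor_remainder x h K B20 (taylor_shift n B0 td).
rewrite add0n binn mul1r (_ : 2 * (2 * B) = 4 * B); last by ring.
by under eq_bigr do rewrite [(_ + n)%N]addnC.
Qed.

Lemma geometric_sum (c : nat -> R) (M q : R) : 0 <= q -> q <= 2^-1 ->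
  (forall k, `|c k| <= M * q ^+ k) ->
  exists L, forall K, `|L - \sum_(k < K) c k| <= 2 * M * q ^+ K.
Proof.
move=> q0 q2 cM.
have M0 : 0 <= M by have := cM 0%N; rewrite mulr1; exact: le_trans.
pose S K := \sum_(k < K) c k.
have tail K j : `|S (K + j)%N - S K| <= 2 * M * q ^+ K.
  (* The factor 1 - q^j is what makes the induction on j go through; it uses q <= 1/2. *)
  apply: (@le_trans _ _ (2 * M * q ^+ K * (1 - q ^+ j))); last first.
    rewrite ler_piMr ?mulr_ge0 ?exprn_ge0//; have := exprn_ge0 j q0; lra.
  elim: j => [|j IH]; first by rewrite addn0 !subrr mulr0 normr0.
  rewrite addnS /S big_ord_recr /= -/(S _) addrAC (le_trans (ler_normD _ _))//.
  apply: (le_trans (lerD IH (cM (K + j)%N))); rewrite exprD.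
  rewrite (_ : M * (q ^+ K * q ^+ j) = 2 * M * q ^+ K * (q ^+ j * 2^-1)); last by field.
  rewrite -mulrDr ler_wpM2l ?mulr_ge0 ?exprn_ge0// exprS.
  have := exprn_ge0 j q0; move: (q ^+ j) => p p0; nra.
have cS : cvgn (series c).
  apply: normed_cvg; apply: (@series_le_cvg _ _ (geometric M q)).
  - by move=> n; exact: normr_ge0.
  - by move=> n; rewrite mulr_ge0// exprn_ge0.
  - exact: cM.
  - by apply: is_cvg_geometric_series; rewrite ger0_norm//; lra.
have {}cS : S n @[n --> \oo] --> limn (series c).
  by move: cS; rewrite seriesEord.
exists (limn (series c)) => K.
have h : `|S n - S K| @[n --> \oo] --> `|limn (series c) - S K|.
  exact: (cvg_norm (cvgB cS (cvg_cst (S K)))).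
apply: (cvgr_to_le h).
exists K => // m /= Km; rewrite -(subnKC Km); exact: tail.
Qed.

End taylor.

Section complex_series.
Context {R : realType}.
Local Notation C := R[i].
Implicit Types (a b c : nat -> C) (s h w z : C).

Lemma norm_complex_le (x y : R) : `|x +i* y| <= (`|x| + `|y|)%:C.
Proof.
rewrite normc_def lecR /= -[leRHS]ger0_norm ?addr_ge0// -sqrtr_sqr ler_wsqrtr//.
rewrite sqrrD !real_normK ?num_real// -addrA lerD2l lerDr mulrn_wge0// mulr_ge0//.
Qed.

Lemma normc_ge_Im z : `|Im z|%:C <= `|z|.
Proof. by rewrite normc_def lecR -sqrtr_sqr ler_wsqrtr// lerDr sqr_ge0. Qed.

Lemma sum_realC (m : nat) (F : nat -> R) : \sum_(k < m) (F k)%:C = (\sum_(k < m) F k)%:C :> C.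
Proof. by rewrite rmorph_sum. Qed.

Lemma geometric_sumC c (M q : R) : 0 <= q -> q <= 2^-1 ->
  (forall k, `|c k| <= (M * q ^+ k)%:C) ->
  exists L, forall K, `|L - \sum_(k < K) c k| <= (4 * M * q ^+ K)%:C.
Proof.
move=> q0 q2 cM.
have [l1 h1] := @geometric_sum R (fun k => Re (c k)) M q q0 q2
  (fun k => ltac:(rewrite -lecR; exact: le_trans (normc_ge_Re _) (cM k))).
have [l2 h2] := @geometric_sum R (fun k => Im (c k)) M q q0 q2
  (fun k => ltac:(rewrite -lecR; exact: le_trans (normc_ge_Im _) (cM k))).
exists (l1 +i* l2) => K.
have -> : \sum_(k < K) c k = (\sum_(k < K) Re (c k)) +i* (\sum_(k < K) Im (c k)).
  elim: K => [|K IH]; first by rewrite !big_ord0.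
  by rewrite !big_ord_recr /= IH; case: (c K).
apply: (le_trans (norm_complex_le _ _)); rewrite lecR.
by apply: (le_trans (lerD (h1 K) (h2 K))); rewrite -!mulrDl; lra.
Qed.

(** The inner sum stops at k < N - n, so both sides run over the same pairs with n + k < N and the
    identity is exact. *)
Lemma sum_reexpand (T : comPzRingType) (a : nat -> T) (s h : T) N :
  \sum_(j < N) a j * (s + h) ^+ j =
  \sum_(n < N) (\sum_(k < N - n) 'C(n + k, n)%:R * a (n + k)%N * s ^+ k) * h ^+ n.
Proof.
elim: N => [|N IH]; first by rewrite !big_ord0.
rewrite big_ord_recr /= IH [RHS]big_ord_recr /= subSnn big_ord1 addn0 binn mul1r expr0 mulr1.
have -> : \sum_(n < N) (\sum_(k < N.+1 - n) 'C(n + k, n)%:R * a (n + k)%N * s ^+ k) * h ^+ n =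
   \sum_(n < N) ((\sum_(k < N - n) 'C(n + k, n)%:R * a (n + k)%N * s ^+ k) * h ^+ n +
                 'C(N, n)%:R * a N * s ^+ (N - n) * h ^+ n).
  apply: eq_bigr => n _; have nN : (n <= N)%N by exact: ltnW.
  by rewrite subSn// big_ord_recr /= subnKC// mulrDl.
rewrite big_split /= -addrA; congr (_ + _).
rewrite exprDn big_ord_recr /= binn subnn expr0 mul1r mulrDr mulr1n; congr (_ + _).
by rewrite mulr_sumr; apply: eq_bigr => n _; rewrite -mulr_natl; ring.
Qed.

(** The last hypothesis says that [b n] is the n-th coefficient after moving the centre by [s].
    Cutting at n + k < N costs at most A (4 B rho)^N <= A 4^(-N) in each of N terms, and N <=
    2^N. *)
Lemma reexpand a b s h (A B rho : R) : 0 <= A -> 0 <= B -> 0 <= rho -> 16 * B * rho <= 1 ->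
  `|h| <= rho%:C ->
  (forall n K, `|b n - \sum_(k < K) 'C(n + k, n)%:R * a (n + k)%N * s ^+ k| <=
     (A * (2 * B) ^+ n * (4 * B * rho) ^+ K)%:C) ->
  forall N, `|\sum_(n < N) b n * h ^+ n - \sum_(j < N) a j * (s + h) ^+ j| <= (A * 2^-1 ^+ N)%:C.
Proof.
move=> A0 B0 r0 Br hr tail N.
rewrite sum_reexpand -sumrB; under eq_bigr do rewrite -mulrBl.
apply: (le_trans (ler_norm_sum _ _ _)).
have q0 : 0 <= 4 * B * rho by rewrite !mulr_ge0.
have q4 : 4 * B * rho <= 4^-1 by lra.
apply: (@le_trans _ _ (\sum_(n < N) (A * (4 * B * rho) ^+ N)%:C)).
  apply: ler_sum => n _; rewrite normrM normrX.
  apply: (@le_trans _ _ ((A * (2 * B) ^+ n * (4 * B * rho) ^+ (N - n))%:C * rho%:C ^+ n)).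
    apply: ler_pM; [exact: normr_ge0|by rewrite exprn_ge0|exact: tail|].
    by rewrite lerXn2r ?nnegrE// ler0c.
  rewrite -rmorphXn -rmorphM lecR -!mulrA ler_wpM2l//.
  have -> : (4 * (B * rho)) ^+ N = (4 * (B * rho)) ^+ n * (4 * (B * rho)) ^+ (N - n).
    by rewrite -exprD subnKC// ltnW.
  rewrite mulrCA mulrC ler_wpM2r ?exprn_ge0//; first by rewrite mulrA.
  rewrite -exprMn lerXn2r ?nnegrE ?mulr_ge0//.
  by have := mulr_ge0 B0 r0; lra.
rewrite (sum_realC N (fun=> A * (4 * B * rho) ^+ N)) lecR sumr_const card_ord -[leLHS]mulr_natr -mulrA ler_wpM2l//.
apply: (@le_trans _ _ (4^-1 ^+ N * 2 ^+ N)).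
  apply: ler_pM => //; first exact: exprn_ge0.
  - by rewrite lerXn2r ?nnegrE// invr_ge0.
  - by rewrite -natrX ler_nat leq_exp2.
rewrite -exprMn (_ : 4^-1 * 2 = 2^-1)//; by field.
Qed.

End complex_series.

(** * Gluing Taylor series centred on the real axis *)

Section extension.
Context {R : realType}.
Local Notation C := R[i].

Lemma half_expr_cvg (M : R) : (fun N => M * 2^-1 ^+ N) @ \oo --> (0 : R).
Proof. by apply: cvg_geometric; rewrite ger0_norm; lra. Qed.

Lemma geometric_cvgC (u : nat -> (R[i] : numFieldType)) (L : (R[i] : numFieldType)) (M : R) :
  (forall N, `|L - \sum_(n < N) u n| <= (M * 2^-1 ^+ N)%:C) -> series u @ \oo --> L.
Proof.
(* Positivity in R[i] forces [e] to be real. *)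
move=> h; apply/cvgrPdist_lt => e; rewrite ltcE /= => /andP[/eqP e1 e0].
have /cvgrPdist_lt/(_ _ e0)[N _ hN] := half_expr_cvg M.
exists N => // n /= Nn; rewrite seriesEord; apply: (le_lt_trans (h n)).
rewrite ltcE /= e1 eqxx /=; apply: le_lt_trans (hN n Nn).
by rewrite sub0r normrN ler_norm.
Qed.

Lemma geometric_cvg (u : nat -> R) (L : R) (M : R) :
  (forall N, `|L - \sum_(n < N) u n| <= M * 2^-1 ^+ N) -> series u @ \oo --> L.
Proof.
move=> h; apply/cvgrPdist_lt => e e0.
have /cvgrPdist_lt/(_ _ e0)[N _ hN] := half_expr_cvg M.
exists N => // n /= Nn; rewrite seriesEord; apply: (le_lt_trans (h n)).
by apply: le_lt_trans (hN n Nn); rewrite sub0r normrN ler_norm.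
Qed.

Lemma taylor_real_analytic (d : nat -> R -> R) (A B : R) : 0 < B -> taylor_seq d A B ->
  forall x : R, analytic_at (d 0%N) x.
Proof.
move=> B0 td x; exists (fun n => d n x), (4 * B)^-1; split; first by rewrite invr_gt0 mulr_gt0.
move=> w wx; apply: (@geometric_cvg _ _ A) => N.
have A0 : 0 <= A by have := td.2 0%N x; rewrite mulr1; exact: le_trans.
have := taylor_remainder x (w - x) N (ltW B0) td; rewrite subrKC => /le_trans; apply.
rewrite ler_wpM2l// lerXn2r ?nnegrE ?invr_ge0 ?mulr_ge0 ?(ltW B0)//.
move: wx; rewrite -[_^-1]mul1r ltr_pdivlMr ?mulr_gt0//; lra.
Qed.

Section strip.
Context (d e : nat -> R -> R) (A B : R).
Hypothesis B0 : 0 < B.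
Hypothesis td : taylor_seq d A B.
Hypothesis te : taylor_seq e A B.
(** The largest increment for which [reexpand] applies. *)
Let r := (16 * B)^-1.
Let D n x : C := d n x +i* e n x.

Let A0 : 0 <= A.
Proof. by have := td.2 0%N 0; rewrite mulr1; exact: le_trans. Qed.

Let r0 : 0 < r. Proof. by rewrite invr_gt0 mulr_gt0. Qed.

Let rB : 16 * B * r = 1. Proof. by rewrite mulfV// gt_eqF// mulr_gt0. Qed.

Let DB n x : `|D n x| <= (2 * A * B ^+ n)%:C.
Proof.
apply: (le_trans (norm_complex_le _ _)); rewrite lecR.
by apply: (le_trans (lerD (td.2 n x) (te.2 n x))); lra.
Qed.

Let iy (y : R) : C := 0 +i* y.

Let iyN (y : R) : `|iy y| <= `|y|%:C.
Proof. by apply: (le_trans (norm_complex_le _ _)); rewrite normr0 add0r. Qed.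

(** The extension at z sums the Taylor series centred at Re z in the increment i Im z. The condition
    on z stands under the existential so that [choice] returns a total function, with the dummy
    value 0 outside the strip. *)
Let extension_ex (z : C) : exists L : C, `|Im z| < r ->
  forall N, `|L - \sum_(n < N) D n (Re z) * iy (Im z) ^+ n| <= (8 * A * (B * `|Im z|) ^+ N)%:C.
Proof.
have [h|h] := boolP (`|Im z| < r); last by exists 0.
have B0' := ltW B0.
have [|||L hL] := @geometric_sumC _ (fun n => D n (Re z) * iy (Im z) ^+ n) (2 * A) (B * `|Im z|).
- by rewrite mulr_ge0.
- by have := ler_wpM2l B0' (ltW h); have := rB; lra.
- move=> k; rewrite normrM normrX exprMn mulrA rmorphM rmorphXn.
  apply: ler_pM; [exact: normr_ge0|by rewrite exprn_ge0|exact: DB|].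
  by rewrite lerXn2r ?iyN ?nnegrE ?normr_ge0 ?ler0c.
by exists L => _ N; rewrite (_ : 8 * A = 4 * (2 * A)); [exact: hL|ring].
Qed.

(** The definition uses a different centre for each point. The series at Re w and the one at z0 are
    both compared with the polynomial centred at Re z0, which makes [F] the sum of one power series
    on a disc around z0 inside the strip. *)
Let analytic_strip (F : C -> C) (z0 : C) :
  (forall z, `|Im z| < r -> forall N, `|F z - \sum_(n < N) D n (Re z) * iy (Im z) ^+ n| <=
    (8 * A * (B * `|Im z|) ^+ N)%:C) ->
  `|Im z0| < r -> analytic_at F z0.
Proof.
move=> FE z0r; have B0' := ltW B0; have r0' := ltW r0.
pose a N := D N (Re z0).
have Br : 16 * B * r <= 1 by rewrite rB.
have Byr (y : R) : `|y| < r -> 2 * B * `|y| <= 4 * B * r.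
  by move=> /ltW h; have := ler_wpM2l B0' h; have := mulr_ge0 B0' r0'; lra.
have cE n : exists cn : C, forall K, `|cn - \sum_(k < K) 'C(n + k, n)%:R * a (n + k)%N * iy (Im z0) ^+ k| <=
    (8 * A * (2 * B) ^+ n * (4 * B * r) ^+ K)%:C.
  have h2 := Byr _ z0r.
  have [|||L hL] := @geometric_sumC _ (fun k => 'C(n + k, n)%:R * a (n + k)%N * iy (Im z0) ^+ k)
    (2 * A * (2 * B) ^+ n) (2 * B * `|Im z0|).
  - by rewrite !mulr_ge0.
  - by apply: (le_trans h2); lra.
  - move=> k; rewrite !normrM normrX.
    rewrite (_ : 2 * A * (2 * B) ^+ n * (2 * B * `|Im z0|) ^+ k =
      2 ^+ (n + k) * (2 * A * B ^+ (n + k)) * `|Im z0| ^+ k); last first.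
      by rewrite !exprMn !exprD; ring.
    have -> : (2 ^+ (n + k) * (2 * A * B ^+ (n + k)) * `|Im z0| ^+ k)%:C =
        (2 ^+ (n + k))%:C * (2 * A * B ^+ (n + k))%:C * `|Im z0|%:C ^+ k.
      by rewrite 2!(rmorphM (real_complex R)) (rmorphXn (real_complex R) k `|Im z0|).
    apply: ler_pM; [by rewrite mulr_ge0|by rewrite exprn_ge0| |].
      apply: ler_pM => //; last exact: DB.
      rewrite normr_nat -natrX -[leLHS](rmorph_nat (real_complex R)) lecR ler_nat; exact: bin_le_exp2.
    by rewrite lerXn2r ?iyN ?nnegrE ?normr_ge0 ?ler0c.
  exists L => K; apply: (le_trans (hL K)); rewrite lecR.
  rewrite (_ : 4 * (2 * A * (2 * B) ^+ n) = 8 * A * (2 * B) ^+ n); last by ring.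
  rewrite ler_wpM2l ?mulr_ge0 ?exprn_ge0 ?mulr_ge0//.
  by rewrite lerXn2r ?nnegrE ?mulr_ge0.
have [c cP] := choice cE.
exists c, (r - `|Im z0|)%:C; split; first by rewrite ltcR subr_gt0.
move=> w; set v := w - z0 => vr.
have vRe : `|Re v| < r - `|Im z0| by rewrite -ltcR; exact: le_lt_trans (normc_ge_Re v) vr.
have vIm : `|Im v| < r - `|Im z0| by rewrite -ltcR; exact: le_lt_trans (normc_ge_Im v) vr.
have wIm : `|Im w| < r.
  have -> : Im w = Im z0 + Im v by rewrite /v; case: (w) (z0) => [? ?] [? ?] /=; ring.
  by apply: (le_lt_trans (ler_normD _ _)); lra.
have wRe : Re w = Re z0 + Re v by rewrite /v; case: (w) (z0) => [? ?] [? ?] /=; ring.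
have e1 := FE w wIm.
have sv : `|Re v| <= r by rewrite ltW// (lt_le_trans vRe)// gerBl.
(* Recentring along the real axis, between Re z0 and Re w. *)
have e2 : forall N, `|\sum_(n < N) D n (Re w) * iy (Im w) ^+ n -
    \sum_(j < N) a j * ((Re v)%:C + iy (Im w)) ^+ j| <= (2 * A * 2^-1 ^+ N)%:C.
  apply: (@reexpand _ a (fun n => D n (Re w)) _ _ (2 * A) B r) => //; first by rewrite mulr_ge0.
    by apply: (le_trans (iyN _)); rewrite lecR ltW.
  move=> n K.
  have -> : \sum_(k < K) 'C(n + k, n)%:R * a (n + k)%N * (Re v)%:C ^+ k =
     (\sum_(k < K) 'C(n + k, n)%:R * d (n + k)%N (Re z0) * Re v ^+ k) +i*
     (\sum_(k < K) 'C(n + k, n)%:R * e (n + k)%N (Re z0) * Re v ^+ k).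
    elim: K => [|K IH]; first by rewrite !big_ord0.
    rewrite !big_ord_recr /= IH /a /D -rmorphXn -(rmorph_nat (real_complex R)).
    by apply/eqP; rewrite eq_complex /=; apply/andP; split; apply/eqP; ring.
  apply: (le_trans (norm_complex_le _ _)); rewrite lecR wRe.
  have b1 := taylor_remainder_shift (Re z0) (Re v) n K B0' td.
  have b2 := taylor_remainder_shift (Re z0) (Re v) n K B0' te.
  have : A * (2 * B) ^+ n * (4 * B * `|Re v|) ^+ K <= A * (2 * B) ^+ n * (4 * B * r) ^+ K.
    rewrite ler_wpM2l ?mulr_ge0 ?exprn_ge0 ?mulr_ge0//.
    by rewrite lerXn2r ?nnegrE ?mulr_ge0// ler_wpM2l// mulr_ge0.
  move=> b; apply: (le_trans (le_trans (lerD b1 b2) (lerD b b))).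
  by rewrite le_eqVlt; apply/orP; left; apply/eqP; ring.
(* Recentring from Re z0 to z0, by the imaginary increment i Im z0. *)
have e3 : forall N, `|\sum_(n < N) c n * v ^+ n -
    \sum_(j < N) a j * (iy (Im z0) + v) ^+ j| <= (8 * A * 2^-1 ^+ N)%:C.
  apply: (@reexpand _ a c _ _ (8 * A) B r) => //; first by rewrite mulr_ge0.
  by apply: (le_trans (ltW vr)); rewrite lecR gerBl.
(* Both comparisons evaluate the polynomial at the same displacement w - Re z0. *)
have sE : (Re v)%:C + iy (Im w) = iy (Im z0) + v.
  rewrite /v /iy; case: (w) (z0) => [? ?] [? ?] /=; apply/eqP; rewrite eq_complex /=.
  by apply/andP; split; apply/eqP; ring.
(* 18 = 8 + 2 + 8, the constants of [e1], [e2] and [e3]. *)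
apply: (@geometric_cvgC _ _ (18 * A)) => N.
move: (e1 N) (e2 N) (e3 N); rewrite sE.
move: (\sum_(n < N) _) (\sum_(j < N) a j * _) (\sum_(n < N) c n * v ^+ n) => S1 S2 S3 i1 i2 i3.
have {}i1 : `|F w - S1| <= (8 * A * 2^-1 ^+ N)%:C.
  apply: (le_trans i1); rewrite lecR ler_wpM2l ?mulr_ge0//.
  rewrite lerXn2r ?nnegrE ?mulr_ge0//; have := Byr _ wIm; lra.
rewrite (_ : F w - S3 = (F w - S1) + (S1 - S2) - (S3 - S2)); last by ring.
rewrite (le_trans (ler_normB _ _))// (le_trans (lerD (le_trans (ler_normD _ _) (lerD i1 i2)) i3))//.
by rewrite -!rmorphD lecR; lra.
Qed.

Lemma strip_extension : exists2 r : R, 0 < r & exists F : C -> C,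
  (forall z : C, `|Im z| < r -> analytic_at F z) /\
  forall x : R, F x%:C = d 0%N x +i* e 0%N x.
Proof.
have [F FE] := choice extension_ex.
exists r => //; exists F; split=> [z zr|x]; first exact: analytic_strip FE zr.
have := FE x%:C; rewrite /= normr0 => /(_ r0 1%N).
rewrite big_ord1 mulr0 mulr0 expr0 mulr1 normr_le0 subr_eq0 => /eqP ->.
by rewrite /D.
Qed.

End strip.
End extension.

(** * From distributions to functions *)

Section schwartz_gaussians.
Context {R : realType}.
Notation mu := (@lebesgue_measure R).
Implicit Types (f g h : R -> R) (s z b x : R).

(** Closed under differentiation and containing the translated Gaussians as well as the components
    of their transforms, so that one decay estimate makes all of them Schwartz functions. *)
Definition gauss_trig s z b f : Prop := exists P Q : {poly R},
  forall x, f x = (P.[x] * cos (z * x) + Q.[x] * sin (z * x)) * gau s (x - b).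

Lemma gauss_trig_der s z b f : gauss_trig s z b f ->
  exists2 g, gauss_trig s z b g & forall x, is_derive x 1 f (g x).
Proof.
move=> [P [Q /funext ->]].
pose L : {poly R} := (2 * s) *: ('X - b%:P).
pose P' := P^`() + z *: Q - L * P; pose Q' := Q^`() - z *: P - L * Q.
exists (fun x => (P'.[x] * cos (z * x) + Q'.[x] * sin (z * x)) * gau s (x - b)).
  by exists P', Q'.
move=> x; have dz : is_derive x 1 (fun x => z * x) (z * 1) := derZ z (der_id x).
have dc := @der_comp _ cos (fun x => z * x) x _ _ (is_derive_cos (z * x)) dz.
have ds := @der_comp _ sin (fun x => z * x) x _ _ (is_derive_sin (z * x)) dz.
have db : is_derive x 1 (fun x => x - b) (1 - 0) := derB (der_id x) (der_cst x b).
have dg := @der_comp _ (gau s) (fun x => x - b) x _ _ (gau_der0 s (x - b)) db.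
apply: (der_eq (derM (derD (derM (der_horner P x) dc) (derM (der_horner Q x) ds)) dg)).
by rewrite /P' /Q' /L !(hornerD, hornerN, hornerM, hornerZ, hornerX, hornerC); ring.
Qed.

Lemma gauss_trig_derive1n n s z b f : gauss_trig s z b f -> gauss_trig s z b (derive1n n f).
Proof.
move=> gf; elim: n => [|n /gauss_trig_der[g gg dg]]; first by rewrite derive1n0.
rewrite derive1nS (_ : derive1 _ = g)//.
by apply/funext => x; exact: der_val.
Qed.

Lemma gauss_trig0 s z b : gauss_trig s z b (fun=> 0).
Proof. by exists 0, 0 => x; rewrite !horner0 !mul0r addr0 mul0r. Qed.

Lemma slow_horner (P : {poly R}) : slow (horner P).
Proof.
elim/poly_ind: P => [|P c IH].
  by rewrite (_ : horner 0 = fun=> 0); [exact: slow_cst|apply/funext => x; rewrite horner0].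
rewrite (_ : horner _ = fun x => P.[x] * x + c); last by apply/funext => x; rewrite hornerMXaddC.
by apply: slowD; [apply: slowM => //; exact: slow_id|exact: slow_cst].
Qed.

Lemma gauss_trig_bound k s z b f : 0 < s -> gauss_trig s z b f ->
  exists C, forall x, `|x| ^+ k * `|f x| <= C.
Proof.
move=> s0 [P [Q /funext ->]]; have s20 : 0 < s / 2 by rewrite divr_gt0.
pose p x := x ^+ k * (P.[x] * cos (z * x) + Q.[x] * sin (z * x)).
have [_ /(_ _ s20)[C C0 hC]] : slow p.
  apply: slowM; first exact: slowX.
  apply: slowD; apply: slowM; by [exact: slow_horner|exact: slow_cosM|exact: slow_sinM].
exists (expR (s * b ^+ 2) * C) => x.
rewrite -normrX -normrM mulrA normrM -/(p x) (ger0_norm (gau_ge0 _ _)).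
apply: (@le_trans _ _ (`|p x| * (expR (s * b ^+ 2) * gau (s / 2) x))).
  by rewrite ler_wpM2l// gau_center.
by rewrite mulrCA ler_wpM2l ?expR_ge0.
Qed.

Lemma gauss_trig_schwartz s z b f g : 0 < s -> gauss_trig s z b f -> gauss_trig s z b g ->
  schwartz (fun x => f x +i* g x).
Proof.
move=> s0 gf gg; split.
  move=> n x; split.
  - by have [h _ dh] := gauss_trig_der (gauss_trig_derive1n n gf); exact: der_derivable (dh x).
  - by have [h _ dh] := gauss_trig_der (gauss_trig_derive1n n gg); exact: der_derivable (dh x).
move=> k n.
have [C1 h1] := gauss_trig_bound k s0 (gauss_trig_derive1n n gf).
have [C2 h2] := gauss_trig_bound k s0 (gauss_trig_derive1n n gg).
exists (C1 + C2) => _ [x _ <-]; apply: le_trans (lerD (h1 x) (h2 x)).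
rewrite /schwartz_term -mulrDr ler_wpM2l ?exprn_ge0// -lecR.
exact: (norm_complex_le (derive1n n f x) (derive1n n g x)).
Qed.

Lemma Cintegral_eq (F : R -> R[i]) (f g : R -> R) : (forall x, F x = f x +i* g x) ->
  Cintegral F = Int f +i* Int g.
Proof. by move=> e; congr (_ +i* _); congr (Rintegral _ _ _); apply/funext => x; rewrite e. Qed.

Lemma fourier_gau s b xi : 0 < s ->
  fourier (fun x => (gau s (x - b))%:C) xi =
  (Kg s * gau (dual s) xi * cos (b * xi)) +i* (- (Kg s * gau (dual s) xi * sin (b * xi))).
Proof.
move=> s0; rewrite /fourier (Cintegral_eq (f := fun x => cos (xi * x) * gau s (x - b))
  (g := fun x => - (sin (xi * x) * gau s (x - b)))); last first.
  move=> x; rewrite cosN sinN [x * xi]mulrC.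
  by apply/eqP; rewrite eq_complex /=; apply/andP; split; apply/eqP; ring.
rewrite Int_cos_gau_center// IntN; last first.
  apply: tame_gau_center => //; apply: slow_tame; exact: slow_sinM.
by rewrite Int_sin_gau_center// [xi * b]mulrC; congr (_ +i* _); ring.
Qed.

Lemma gauss_trig_gau s b : gauss_trig s 0 b (fun x => gau s (x - b)).
Proof. by exists 1, 0 => x; rewrite hornerC horner0 !mul0r cos0 addr0 !mul1r. Qed.

Lemma schwartz_gau s b : 0 < s -> schwartz (fun x => (gau s (x - b))%:C).
Proof.
by move=> s0; exact: gauss_trig_schwartz s0 (gauss_trig_gau s b) (gauss_trig0 s 0 b).
Qed.

Lemma schwartz_fourier_gau s b : 0 < s -> schwartz (fourier (fun x => (gau s (x - b))%:C)).
Proof.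
move=> s0; have d0 := dual_gt0 s0.
have -> : fourier (fun x => (gau s (x - b))%:C) = fun xi =>
  (Kg s * gau (dual s) xi * cos (b * xi)) +i* (- (Kg s * gau (dual s) xi * sin (b * xi))).
  by apply/funext => xi; exact: fourier_gau.
apply: (gauss_trig_schwartz (s := dual s) (z := b) (b := 0)) => //.
- by exists (Kg s)%:P, 0 => x; rewrite !hornerC subr0; ring.
- by exists 0, (- Kg s)%:P => x; rewrite !hornerC subr0; ring.
Qed.

Lemma Lfun2_sqr f : f \in Lfun mu 2%:E -> measurable_fun [set: R] f /\ L1 (fun x => f x ^+ 2).
Proof.
by move=> lf; split; [move: lf; rewrite inE => /andP[]; rewrite inE|exact: Lfun2_integrable_sqr].
Qed.

Lemma Lfun_oo_bounded f : f \in Lfun mu +oo%E -> measurable_fun [set: R] f /\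
  exists2 M, 0 <= M & {ae mu, forall x, `|f x| <= M}.
Proof.
rewrite inE => /andP[mf]; rewrite inE => nf; split; first by move: mf; rewrite inE.
move: nf; rewrite /= /finite_norm unlock /=.
rewrite -[X in mu X]set_itvNyy lebesgue_measure_itv /= (_ : (0 < +oo + +oo)%E); last by rewrite addye// ltry.
move=> /(@ess_supr_bounded _ _ _ mu (fun x => `|f x|)) [M hM].
exists `|M|; first exact: normr_ge0.
by apply: ae_imp hM => x /= h; apply: (le_trans h); exact: ler_norm.
Qed.

End schwartz_gaussians.

(** * Distributional transforms read on Gaussians *)

Section distributions.
Context {R : realType}.
Notation mu := (@lebesgue_measure R).
Implicit Types (f g h w : R -> R) (s z x : R).

Definition gauss s z (x : R) : R[i] := (gau s (x - z))%:C.

Lemma distribution_gauss (H : R -> R[i]) h1 h2 s z : (forall x, H x = h1 x +i* h2 x) ->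
  distribution_of H (gauss s z) =
  Int (fun x => h1 x * gau s (x - z)) +i* Int (fun x => h2 x * gau s (x - z)).
Proof.
move=> HE; apply: Cintegral_eq => x; rewrite HE /gauss.
by apply/eqP; rewrite eq_complex /=; apply/andP; split; apply/eqP; ring.
Qed.

Lemma distribution_fourier_gauss (F : R -> R[i]) f1 f2 s z :
  (forall x, F x = f1 x +i* f2 x) -> tame f1 -> tame f2 -> 0 < s ->
  distribution_of F (fourier (gauss s z)) =
  (Kg s * (Int (fun x => f1 x * (cos (z * x) * gau (dual s) x)) +
           Int (fun x => f2 x * (sin (z * x) * gau (dual s) x)))) +i*
  (Kg s * (Int (fun x => f2 x * (cos (z * x) * gau (dual s) x)) -
           Int (fun x => f1 x * (sin (z * x) * gau (dual s) x)))).
Proof.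
move=> FE t1 t2 s0; have d0 := dual_gt0 s0.
have c1 := tame_cos z t1 d0; have c2 := tame_cos z t2 d0.
have s1 := tame_sin z t1 d0; have s2 := tame_sin z t2 d0.
rewrite -(IntD c1 s2) -(IntB c2 s1) -(IntZ _ (L1D c1 s2)) -(IntZ _ (L1B c2 s1)).
apply: Cintegral_eq => x; rewrite FE fourier_gau//.
by apply/eqP; rewrite eq_complex /=; apply/andP; split; apply/eqP; ring.
Qed.

Section transform.
Context (F H : R -> R[i]) (f1 f2 h1 h2 : R -> R).
Hypothesis FE : forall x, F x = f1 x +i* f2 x.
Hypothesis HE : forall x, H x = h1 x +i* h2 x.
Hypothesis t1 : tame f1.
Hypothesis t2 : tame f2.
Hypothesis th1 : tame h1.
Hypothesis th2 : tame h2.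
Hypothesis FH : has_fourier (distribution_of F) H.

Let pairing s z : 0 < s ->
  Kg s * (Int (fun x => f1 x * (cos (z * x) * gau (dual s) x)) +
          Int (fun x => f2 x * (sin (z * x) * gau (dual s) x))) = Int (fun x => h1 x * gau s (x - z)) /\
  Kg s * (Int (fun x => f2 x * (cos (z * x) * gau (dual s) x)) -
          Int (fun x => f1 x * (sin (z * x) * gau (dual s) x))) = Int (fun x => h2 x * gau s (x - z)).
Proof.
move=> s0; have := FH (schwartz_gau z s0).
by rewrite (distribution_fourier_gauss z FE t1 t2 s0) (distribution_gauss s z HE) => -[-> ->].
Qed.

Lemma has_fourier_FP : (forall x, f2 x = 0) -> FP f1 h1 h2.
Proof.
move=> f20; split=> // s z s0; have [<- <-] := pairing z s0.
have z0 (k : R -> R) : Int (fun x => f2 x * k x) = 0.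
  by under eq_fun do rewrite f20 mul0r; rewrite Int0.
by rewrite !z0 addr0 sub0r mulrN.
Qed.

(** Serves to prove that W convolved with eta is real, although only its transform is given. *)
Lemma has_fourier_hermitian : {ae mu, forall x, h1 x = h1 (- x) /\ h2 x = - h2 (- x)} ->
  {ae mu, forall x, f2 x = 0} /\ FP f1 h1 h2.
Proof.
move=> herm.
have e1 s z : 0 < s -> Int (fun x => h1 x * gau s (x - - z)) = Int (fun x => h1 x * gau s (x - z)).
  move=> s0; rewrite -Int_gau_reflect//; apply: Int_ae; [|exact: tame_gau_center|].
    by apply: tame_gau_center => //; exact: tame_reflect.
  by apply: ae_imp herm => x [<- _].
have e2 s z : 0 < s -> Int (fun x => h2 x * gau s (x - - z)) = - Int (fun x => h2 x * gau s (x - z)).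
  move=> s0; rewrite -Int_gau_reflect// -IntN; last exact: tame_gau_center.
  apply: Int_ae; [|apply: L1N; exact: tame_gau_center|].
    by apply: tame_gau_center => //; exact: tame_reflect.
  by apply: ae_imp herm => x [_ ->]; rewrite mulNr opprK.
have cN (k : R -> R) s z : Int (fun x => k x * (cos (- z * x) * gau s x)) =
    Int (fun x => k x * (cos (z * x) * gau s x)).
  by congr Int; apply/funext => x; rewrite mulNr cosN.
have sN (k : R -> R) s z : tame k -> 0 < s -> Int (fun x => k x * (sin (- z * x) * gau s x)) =
    - Int (fun x => k x * (sin (z * x) * gau s x)).
  move=> tk s0; rewrite -IntN; last exact: tame_sin.
  by congr Int; apply/funext => x; rewrite mulNr sinN; ring.
(* Compare the pairings at z and - z. *)
have both s z : 0 < s -> Int (fun x => f2 x * (sin (z * x) * gau (dual s) x)) = 0 /\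
    Int (fun x => f2 x * (cos (z * x) * gau (dual s) x)) = 0.
  move=> s0; have d0 := dual_gt0 s0; have K0 := Kg_gt0 s0.
  have [p1 p2] := pairing z s0; have [q1 q2] := pairing (- z) s0.
  move: q1 q2; rewrite !cN !sN// e1// e2// -p1 -p2 => q1 q2.
  by split; apply: (mulfI (lt0r_neq0 K0)); rewrite mulr0; lra.
split.
  apply: (trig_injective t2) => s z s0; have d0 := dual_gt0 s0; have [h3 h4] := both _ z d0.
    by move: h4; rewrite dualK.
  by move: h3; rewrite dualK.
split=> // s z s0; have [<- <-] := pairing z s0; have [-> ->] := both s z s0.
by rewrite addr0 sub0r mulrN.
Qed.

End transform.

(** Conjugating the transform of the Gaussian centred at z gives that of the Gaussian centred at -
    z. Reality of [W] therefore conjugates the pairing of [w] when z changes sign, and Gaussian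
    uniqueness makes this pointwise. *)
Lemma real_distribution_hermitian (W : functional) (w : R -> R[i]) w1 w2 :
  real_distribution W -> has_fourier W w -> (forall x, w x = w1 x +i* w2 x) ->
  tame w1 -> tame w2 -> {ae mu, forall x, w1 x = w1 (- x) /\ w2 x = - w2 (- x)}.
Proof.
move=> Wr Ww wE t1 t2.
have key s z : 0 < s -> distribution_of w (gauss s (- z)) = (distribution_of w (gauss s z))^*.
  move=> s0; rewrite -(Ww _ (schwartz_gau (- z) s0)) -(Ww _ (schwartz_gau z s0)).
  rewrite -(Wr _ (schwartz_fourier_gau z s0)); congr W; apply/funext => x.
  rewrite !fourier_gau// mulNr cosN sinN mulrN opprK.
  by apply/eqP; rewrite eq_complex /= opprK !eqxx.
have r1 := tame_reflect t1; have r2 := tame_reflect t2.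
have h1 : {ae mu, forall x, w1 x + -1 * w1 (- x) = 0}.
  apply: gaussian_uniqueness; first by apply: tameD => //; exact: tameZ.
  move=> s z s0; have := key s z s0; rewrite !(distribution_gauss _ _ wE) => -[e1 _].
  under eq_fun do rewrite mulrDl -mulrA mulN1r.
  rewrite (IntB (tame_gau_center z t1 s0) (tame_gau_center z r1 s0)).
  by rewrite Int_gau_reflect// e1 subrr.
have h2 : {ae mu, forall x, w2 x + w2 (- x) = 0}.
  apply: gaussian_uniqueness; first exact: tameD.
  move=> s z s0; have := key s z s0; rewrite !(distribution_gauss _ _ wE) => -[_ e2].
  under eq_fun do rewrite mulrDl.
  rewrite (IntD (tame_gau_center z t2 s0) (tame_gau_center z r2 s0)).
  by rewrite Int_gau_reflect// e2 subrr.
by apply: ae_imp (ae_and h1 h2) => x [? ?]; split; lra.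
Qed.

End distributions.

(** * From the weak equation to an absolutely continuous system *)

Section weak.
Context {R : realType}.
Notation mu := (@lebesgue_measure R).
Implicit Types (f g h phi psi : R -> R) (x a b : R).

Lemma Cderive1n_real n phi x : Cderive1n n (fun x => (phi x)%:C) x = (derive1n n phi x)%:C.
Proof.
rewrite /Cderive1n /=; congr (_ +i* _).
elim: n x => [//|n IH] x; rewrite derive1nS (_ : derive1n n _ = fun=> 0); last exact/funext.
by rewrite derive1_cst.
Qed.

Lemma derive_support phi psi a b : (forall x, is_derive x 1 phi (psi x)) ->
  (forall x, phi x != 0 -> a <= x <= b) -> forall x, psi x != 0 -> a <= x <= b.
Proof.
move=> dphi s x; apply: contra_neqT => /negP xab.
have [lo|hi] : x < a \/ b < x.
  by case: (ltP x a) => [|ax]; [left|right; rewrite ltNge; apply/negP => xb; apply: xab; rewrite ax].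
- have e : \forall y \near x, 0 = phi y.
    near=> y; have ya : y < a by near: y; exact: lt_nbhsl.
    apply/esym/eqP; apply: contraTT ya => /s /andP[h _]; by rewrite -leNgt.
  have d0 := near_eq_is_derive e (der_cst x 0).
  by rewrite -(der_val (dphi x)) (der_val d0).
- have e : \forall y \near x, 0 = phi y.
    near=> y; have ya : b < y by near: y; exact: lt_nbhsr.
    apply/esym/eqP; apply: contraTT ya => /s /andP[_ h]; by rewrite -leNgt.
  have d0 := near_eq_is_derive e (der_cst x 0).
  by rewrite -(der_val (dphi x)) (der_val d0).
Unshelve. all: by end_near.
Qed.

Lemma Lloc_test_L1 f phi a b : Lloc f -> continuous phi ->
  (forall x, phi x != 0 -> a <= x <= b) -> L1 (fun x => f x * phi x).
Proof.
move=> lf cp s; have := Lloc_L1 (a - 1) b (Lloc_mul_continuous lf cp); congr L1.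
apply/funext => x; rewrite indic_itvE.
have [->|/s /andP[ax xb]] := eqVneq (phi x) 0; first by rewrite mulr0 mul0r.
by rewrite xb (lt_le_trans _ ax) ?mulr1// ltrBlDr ltrDl.
Qed.

Lemma L2_Lloc f : measurable_fun [set: R] f -> L1 (fun x => f x ^+ 2) -> Lloc f.
Proof.
move=> mf lf; apply: (Lloc_dom mf (LlocD (Lloc_cst 1) (L1_Lloc lf))) => x.
exact: le_1Dsqr.
Qed.

Lemma Cintegral_test (F : R -> R[i]) phi : Cintegral (fun x => F x * (phi x)%:C) =
  Int (fun x => Re (F x) * phi x) +i* Int (fun x => Im (F x) * phi x).
Proof.
apply: Cintegral_eq => x; case: (F x) => p q.
by apply/eqP; rewrite eq_complex /=; apply/andP; split; apply/eqP; ring.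
Qed.

Lemma weak_derivative_test (f g : R -> R[i]) phi psi a b : weak_derivative f g ->
  infinitely_derivable phi -> (forall x, is_derive x 1 phi (psi x)) ->
  (forall x, phi x != 0 -> a <= x <= b) ->
  Int (fun x => Re (f x) * psi x) = - Int (fun x => Re (g x) * phi x) /\
  Int (fun x => Im (f x) * psi x) = - Int (fun x => Im (g x) * phi x).
Proof.
move=> [_ _ fg] iphi dphi s; have := fg _ (infder_test iphi s).
have -> : (fun x => f x * Cderive1n 1 (fun x => (phi x)%:C) x) = (fun x => f x * (psi x)%:C).
  by apply/funext => x; rewrite Cderive1n_real derive1n1 (der_val (dphi x)).
by rewrite !Cintegral_test => -[-> ->].
Qed.

Section solution.
Context (u v g : R -> R[i]) (c : R).
Hypothesis uv : weak_derivative u v.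
Hypothesis v2 : L2 v.
Hypothesis g2 : L2 g.
Hypothesis g_real : {ae mu, forall x, Im (g x) = 0}.
Hypothesis sol : forall phi : R -> R[i], test_function phi ->
      - ('i * c%:C * Cintegral (fun x => u x * Cderive1n 1 phi x))
      + Cintegral (fun x => u x * Cderive1n 2 phi x)
      + Cintegral (fun x => u x * g x * phi x) = 0.

(** The du Bois-Reymond lemma is used twice: for u, with its weak derivative v, and for v, whose
    weak derivative is read off the equation once the derivatives on the test function have been
    moved to u. *)
Lemma weak_solution_AC : exists U1 U2 V1 V2 : R -> R,
  [/\ [/\ AC U1 V1, AC U2 V2, AC V1 (fun x => c * V2 x - U1 x * Re (g x)) &
          AC V2 (fun x => - c * V1 x - U2 x * Re (g x))],
      {ae mu, forall x, u x = U1 x +i* U2 x} &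
      L1 (fun x => V1 x ^+ 2) /\ L1 (fun x => V2 x ^+ 2)].
Proof.
have [lu lv _] := uv.
have lu1 := locally_integrable_Lloc lu.1; have lu2 := locally_integrable_Lloc lu.2.
have lv1 := locally_integrable_Lloc lv.1; have lv2 := locally_integrable_Lloc lv.2.
have [mv1 l2v1] := Lfun2_sqr v2.1; have [mv2 l2v2] := Lfun2_sqr v2.2.
have [mg1 l2g1] := Lfun2_sqr g2.1; have [mg2 l2g2] := Lfun2_sqr g2.2.
have lg1 := L2_Lloc mg1 l2g1.
have [U1 aU1 uU1] := du_bois_reymond lu1 lv1
  (fun phi psi a b i d s => (weak_derivative_test uv i d s).1).
have [U2 aU2 uU2] := du_bois_reymond lu2 lv2
  (fun phi psi a b i d s => (weak_derivative_test uv i d s).2).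
have mU1 := AC_measurable aU1; have mU2 := AC_measurable aU2.
have lUg U f : AC U f -> Lloc (fun x => U x * Re (g x)).
  move=> aU; under eq_fun do rewrite mulrC.
  exact: Lloc_mul_continuous lg1 (AC_continuous aU).
have key phi psi a b : infinitely_derivable phi -> (forall x, is_derive x 1 phi (psi x)) ->
    (forall x, phi x != 0 -> a <= x <= b) ->
    Int (fun x => Re (v x) * psi x) = - Int (fun x => (c * Im (v x) - U1 x * Re (g x)) * phi x) /\
    Int (fun x => Im (v x) * psi x) = - Int (fun x => (- c * Re (v x) - U2 x * Re (g x)) * phi x).
  move=> iphi dphi s.
  have ipsi : infinitely_derivable psi.
    have [q iq dq] := infder_der iphi.
    by rewrite (_ : psi = q)//; apply/funext => x; rewrite -(der_val (dphi x)) (der_val (dq x)).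
  have s' := derive_support dphi s.
  have [chi ichi dchi] := infder_der ipsi.
  have cphi := infder_continuous iphi.
  have mphi := continuous_measurable cphi.
  have := sol (infder_test iphi s).
  have -> : (fun x => u x * Cderive1n 1 (fun x => (phi x)%:C) x) = (fun x => u x * (psi x)%:C).
    by apply/funext => x; rewrite Cderive1n_real derive1n1 (der_val (dphi x)).
  have -> : (fun x => u x * Cderive1n 2 (fun x => (phi x)%:C) x) = (fun x => u x * (chi x)%:C).
    apply/funext => x; rewrite Cderive1n_real derive1nS derive1n1 (_ : derive1 phi = psi).
      by rewrite (der_val (dchi x)).
    by apply/funext => y; exact: der_val.
  rewrite !Cintegral_test.
  have [-> ->] := weak_derivative_test uv iphi dphi s.
  have [-> ->] := weak_derivative_test uv ipsi dchi s'.
  have [mu1 _] := lu1; have [mu2 _] := lu2.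
  have ReM x : Re (u x * g x) = Re (u x) * Re (g x) - Im (u x) * Im (g x) by case: (u x) (g x) => [? ?] [].
  have ImM x : Im (u x * g x) = Re (u x) * Im (g x) + Im (u x) * Re (g x) by case: (u x) (g x) => [? ?] [].
  have -> : Int (fun x => Re (u x * g x) * phi x) = Int (fun x => U1 x * Re (g x) * phi x).
    under eq_fun do rewrite ReM; apply: Int_aem.
    - by apply: measurable_funM => //; apply: measurable_funB; exact: measurable_funM.
    - by apply: measurable_funM => //; exact: measurable_funM.
    - by apply: ae_imp (ae_and uU1 g_real) => x [-> ->]; rewrite mulr0 subr0.
  have -> : Int (fun x => Im (u x * g x) * phi x) = Int (fun x => U2 x * Re (g x) * phi x).
    under eq_fun do rewrite ImM; apply: Int_aem.
    - by apply: measurable_funM => //; apply: measurable_funD; exact: measurable_funM.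
    - by apply: measurable_funM => //; exact: measurable_funM.
    - by apply: ae_imp (ae_and uU2 g_real) => x [-> ->]; rewrite mulr0 add0r.
  have Lv1 := Lloc_test_L1 lv1 cphi s; have Lv2 := Lloc_test_L1 lv2 cphi s.
  have LU1 := Lloc_test_L1 (lUg _ _ aU1) cphi s; have LU2 := Lloc_test_L1 (lUg _ _ aU2) cphi s.
  have -> : (fun x => (c * Im (v x) - U1 x * Re (g x)) * phi x) =
      (fun x => c * (Im (v x) * phi x) - U1 x * Re (g x) * phi x) by apply/funext => x; ring.
  have -> : (fun x => (- c * Re (v x) - U2 x * Re (g x)) * phi x) =
      (fun x => - c * (Re (v x) * phi x) - U2 x * Re (g x) * phi x) by apply/funext => x; ring.
  rewrite (IntB (L1Z c Lv2) LU1) (IntB (L1Z (- c) Lv1) LU2) (IntZ c Lv2) (IntZ (- c) Lv1).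
  move=> /eqP; rewrite eq_complex /= => /andP[/eqP h1 /eqP h2]; split; lra.
have l1 : Lloc (fun x => c * Im (v x) - U1 x * Re (g x)) by apply: LlocB; [exact: LlocZ|exact: lUg aU1].
have l2 : Lloc (fun x => - c * Re (v x) - U2 x * Re (g x)) by apply: LlocB; [exact: LlocZ|exact: lUg aU2].
have [V1 aV1 vV1] := du_bois_reymond lv1 l1 (fun phi psi a b i d s => (key phi psi a b i d s).1).
have [V2 aV2 vV2] := du_bois_reymond lv2 l2 (fun phi psi a b i d s => (key phi psi a b i d s).2).
have mV1 := AC_measurable aV1; have mV2 := AC_measurable aV2.
exists U1, U2, V1, V2; split.
- split.
  + exact: AC_ae mV1 vV1 aU1.
  + exact: AC_ae mV2 vV2 aU2.
  + apply: AC_ae aV1; last by apply: ae_imp vV2 => x ->.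
    by apply: measurable_funB; exact: measurable_funM.
  + apply: AC_ae aV2; last by apply: ae_imp vV1 => x ->.
    by apply: measurable_funB; exact: measurable_funM.
- by apply: ae_imp (ae_and uU1 uU2) => x [<- <-]; case: (u x).
- split.
  + by apply: L1_ae l2v1; [exact: measurable_funX|apply: ae_imp vV1 => x ->].
  + by apply: L1_ae l2v2; [exact: measurable_funX|apply: ae_imp vV2 => x ->].
Qed.

End solution.
End weak.

(** * Reduction of the given data to the real system, and conclusion *)

Section clamp.
Context {R : realType}.
Notation mu := (@lebesgue_measure R).

(* Truncation turns an almost everywhere bound into an everywhere bound. *)
Definition clamp (b x : R) : R := Num.max (- b) (Num.min x b).

Lemma clamp_le (b x : R) : 0 <= b -> `|clamp b x| <= b.
Proof.
move=> b0; rewrite ler_norml /clamp le_max lexx /= ge_max ge_min lexx orbT andbT.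
lra.
Qed.

Lemma clamp_id (b x : R) : `|x| <= b -> clamp b x = x.
Proof. by rewrite ler_norml /clamp => /andP[h1 h2]; rewrite min_l// max_r. Qed.

Lemma clamp_measurable (b f : R -> R) : measurable_fun [set: R] b -> measurable_fun [set: R] f ->
  measurable_fun [set: R] (fun x => clamp (b x) (f x)).
Proof.
move=> mb mf; apply: measurable_maxr; first exact: measurable_funN.
exact: measurable_minr.
Qed.

End clamp.

Lemma eta_real (R : realType) (u : R -> R[i]) x :
  eta u x = (1 - Re (u x) ^+ 2 - Im (u x) ^+ 2)%:C.
Proof.
rewrite /eta -add_Re2_Im2; apply/eqP; rewrite eq_complex /=.
by apply/andP; split; apply/eqP; ring.
Qed.

Theorem theorem5p12 (R : realType) (W : (R -> R[i]) -> R[i]) (What : R -> R[i])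
    (sigma kappa c : R) (u : R -> R[i])
    (W_tempered : tempered_distribution W)
    (W_real : real_distribution W)
    (W_even : even_distribution W)
    (What_Linfty : Linfty What)
    (What_fourier : has_fourier W What)
    (sigma_gt0 : 0 < sigma) (sigma_le1 : sigma <= 1)
    (kappa_ge0 : 0 <= kappa) (kappa_le : kappa <= 2^-1)
    (* the order on R[i] makes What xi real *)
    (What_ge : {ae @lebesgue_measure R, forall xi : R,
                  (sigma - kappa * xi ^+ 2)%:C <= What xi})
    (What_weak : exists What' : R -> R[i], weak_derivative What What' /\
       exists C : R, 0 < C /\
         {ae @lebesgue_measure R, forall xi : R,
            `|What' xi| <= (C * (`|xi| + 1))%:C})
    (c_ge0 : 0 <= c) (c_lt : c < Num.sqrt (2 * sigma))
    (u_energy : energy_space u)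
    (u_sol : solution W c u) :
  (exists r : R, 0 < r /\
     analytic_extension r (eta u) /\ analytic_extension r u) /\
  (0 < c -> real_analytic u).
Proof.
have [_ leta [v [uv lv]]] := u_energy.
have [g [[what [fhat [[lw Ww] [lm Fm] lg Fg]]] sol]] := u_sol.
pose w1 x := Re (what x); pose w2 x := Im (what x).
pose m1 x := Re (fhat x); pose m2 x := Im (fhat x).
have [mw1 [M1 M10 w1M]] := Lfun_oo_bounded lw.1.
have [mw2 [M2 M20 w2M]] := Lfun_oo_bounded lw.2.
have [mm1 lm1] := Lfun2_sqr lm.1; have [mm2 lm2] := Lfun2_sqr lm.2.
have [me1 le1] := Lfun2_sqr leta.1; have [me2 le2] := Lfun2_sqr leta.2.
have [mg1 lg1] := Lfun2_sqr lg.1; have [mg2 lg2] := Lfun2_sqr lg.2.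
have CE (F : R -> R[i]) x : F x = Re (F x) +i* Im (F x) by case: (F x).
have tame_bounded (w : R -> R) (M : R) : measurable_fun [set: R] w -> 0 <= M ->
    {ae lebesgue_measure, forall x, `|w x| <= M} -> tame w.
  move=> mw M0 wM; apply: (@tame_ae _ (fun x => clamp M (w x))) => //.
    by apply: ae_imp wM => x; exact: clamp_id.
  apply/slow_tame/(slow_bounded (M := M)); first exact: clamp_measurable.
  by move=> x; exact: clamp_le.
have tm1 := sqr_tame mm1 lm1; have tm2 := sqr_tame mm2 lm2.
have hw := real_distribution_hermitian W_real Ww (CE what)
  (tame_bounded _ _ mw1 M10 w1M) (tame_bounded _ _ mw2 M20 w2M).
have Feta : FP (fun x => Re (eta u x)) m1 m2.
  apply: (has_fourier_FP (CE (eta u)) (CE fhat) (sqr_tame me1 le1) (sqr_tame me2 le2) tm1 tm2 Fm).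
  by move=> x; rewrite eta_real.
have hm := FP_hermitian Feta.
pose p1 x := w1 x * m1 x - w2 x * m2 x; pose p2 x := w1 x * m2 x + w2 x * m1 x.
pose n x := `|m1 x| + `|m2 x|; pose M := M1 + M2.
have M0 : 0 <= M by rewrite addr_ge0.
have n0 x : 0 <= n x by rewrite addr_ge0.
have Mn0 x : 0 <= M * n x by rewrite mulr_ge0.
have mn : measurable_fun [set: R] n.
  by apply: measurable_funD; apply: measurableT_comp => //; exact: normr_measurable.
have mMn : measurable_fun [set: R] (fun x => M * n x) by exact: measurable_funM.
have mp1 : measurable_fun [set: R] p1 by apply: measurable_funB; exact: measurable_funM.
have mp2 : measurable_fun [set: R] p2 by apply: measurable_funD; exact: measurable_funM.
have pM : {ae lebesgue_measure, forall x, `|p1 x| <= M * n x /\ `|p2 x| <= M * n x}.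
  apply: ae_imp (ae_and w1M w2M) => x [h1 h2].
  have k1 := normr_ge0 (m1 x); have k2 := normr_ge0 (m2 x).
  have b (a a' : R) : `|w1 x * a| + `|w2 x * a'| <= M1 * `|a| + M2 * `|a'|.
    by rewrite !normrM; apply: lerD; apply: ler_wpM2r.
  split.
  - apply: (le_trans (ler_normB _ _)); apply: (le_trans (b _ _)).
    by rewrite /M /n; nra.
  - apply: (le_trans (ler_normD _ _)); apply: (le_trans (b _ _)).
    by rewrite /M /n; nra.
(* The estimates on the system ask for |transform of g| <= M n at every point, while the bound on
   [what] holds almost everywhere; only a null set is changed. *)
pose q1 x := clamp (M * n x) (p1 x); pose q2 x := clamp (M * n x) (p2 x).
have mq1 : measurable_fun [set: R] q1 by exact: clamp_measurable.
have mq2 : measurable_fun [set: R] q2 by exact: clamp_measurable.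
have q1M x : `|q1 x| <= M * n x by exact: clamp_le.
have q2M x : `|q2 x| <= M * n x by exact: clamp_le.
have pq : {ae lebesgue_measure, forall x, p1 x = q1 x /\ p2 x = q2 x}.
  by apply: ae_imp pM => x [h1 h2]; rewrite /q1 /q2 !clamp_id.
have ln2 : L1 (fun x => n x ^+ 2).
  apply: (L1_sqrZ_bounded (a := m1) (b := m2) (M := 1)) => // x.
  by rewrite mul1r ger0_norm.
have tp1 : tame p1.
  apply: (tame_ae mp1 _ (sqr_tame mq1 (L1_sqr_dom mq1 q1M ln2))).
  by apply: ae_imp pq => x [].
have tp2 : tame p2.
  apply: (tame_ae mp2 _ (sqr_tame mq2 (L1_sqr_dom mq2 q2M ln2))).
  by apply: ae_imp pq => x [].
have pE x : what x * fhat x = p1 x +i* p2 x.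
  rewrite /p1 /p2 /w1 /w2 /m1 /m2; case: (what x) (fhat x) => [a b] [a' b'].
  by apply/eqP; rewrite eq_complex /=; apply/andP; split; apply/eqP; ring.
(* The product of two hermitian transforms is hermitian, which makes [g] real. *)
have hp : {ae lebesgue_measure, forall x, p1 x = p1 (- x) /\ p2 x = - p2 (- x)}.
  apply: ae_imp (ae_and hw hm) => x [[e1 e2] [e3 e4]].
  by rewrite /p1 /p2 /w1 /w2 e1 e2 e3 e4; split; ring.
have [g_real Fg1] := has_fourier_hermitian (CE g) pE (sqr_tame mg1 lg1) (sqr_tame mg2 lg2) tp1 tp2 Fg hp.
have {}Fg1 := FP_aeh mq1 mq2 pq Fg1.
have [U1 [U2 [V1 [V2 [[aU1 aU2 aV1 aV2] uU [lV1 lV2]]]]]] := weak_solution_AC uv lv lg g_real sol.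
pose e x := 1 - U1 x ^+ 2 - U2 x ^+ 2.
have me : measurable_fun [set: R] e.
  apply: measurable_funB; [apply: measurable_funB => //|]; apply: measurable_funX.
  - exact: AC_measurable aU1.
  - exact: AC_measurable aU2.
have etaE : {ae lebesgue_measure, forall x, Re (eta u x) = e x}.
  by apply: ae_imp uU => x ux; rewrite eta_real ux.
have le : L1 (fun x => e x ^+ 2).
  by apply: L1_ae le1; [exact: measurable_funX|apply: ae_imp etaE => x ->].
have Fe := FP_aef me etaE Feta.
have [N UN] := system_bounded aU1 aU2 aV1 aV2 mg1 lg1 lV1 lV2 le.
have [A [B [A0 B1 mom]]] := system_moments aU1 aU2 aV1 aV2 mg1 lg1 lV1 lV2 le Fe Fg1 lm1 lm2 M0 q1M q2M.
have eE := eta_trigint aU1 aU2 aV1 aV2 mg1 lg1 lV1 lV2 le Fe Fg1 lm1 lm2 M0 q1M q2M.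
have gE := g_trigint aU1 aU2 aV1 aV2 mg1 lg1 lV1 lV2 le Fe Fg1 lm1 lm2 M0 q1M q2M.
have B0 : 0 < B by exact: lt_le_trans B1.
have [de [tde de0]] : exists de, taylor_seq de A B /\ de 0%N = trigint m1 m2.
  by have [d td d0] := trigint_taylor mm1 mm2 mom; exists d.
have momq k : L1 (fun x => `|x| ^+ k * (`|q1 x| + `|q2 x|)) /\
    Int (fun x => `|x| ^+ k * (`|q1 x| + `|q2 x|)) <= (2 * M * A) * B ^+ k * k`!%:R.
  have [l b] := mom k.
  have dom x : `|x| ^+ k * (`|q1 x| + `|q2 x|) <= 2 * M * (`|x| ^+ k * n x).
    rewrite mulrCA ler_wpM2l ?exprn_ge0//; have := q1M x; have := q2M x; lra.
  have lq : L1 (fun x => `|x| ^+ k * (`|q1 x| + `|q2 x|)).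
    apply: (L1_le _ _ (L1Z (2 * M) l)).
      apply: measurable_funM; first by apply: measurable_funX; exact: normr_measurable.
      by apply: measurable_funD; apply: measurableT_comp => //; exact: normr_measurable.
    by move=> x; rewrite ger0_norm ?mulr_ge0 ?addr_ge0 ?exprn_ge0.
  split=> //; apply: (le_trans (le_Int lq (L1Z (2 * M) l) dom)); rewrite (IntZ _ l).
  by rewrite -!(mulrA (2 * M)) ler_wpM2l// mulr_ge0.
have [h [th h0]] : exists h, taylor_seq h (2 * M * A) B /\ h 0%N = trigint q1 q2.
  by have [d td d0] := trigint_taylor mq1 mq2 momq; exists d.
have cV1 := AC_continuous aV1; have cV2 := AC_continuous aV2.
have cU1 := AC_continuous aU1; have cU2 := AC_continuous aU2.
have ch : continuous (h 0%N) by exact: (derivative_continuous (th.1 0%N)).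
have mh : measurable_fun [set: R] (h 0%N) by exact: continuous_measurable.
(* [g] is only known up to a null set; its continuous representative [h 0] upgrades the integral
   equations to derivatives at every point. *)
have dV (V V' U : R -> R) (b : R) : continuous V' -> continuous U ->
    AC V (fun x => b * V' x - U x * Re (g x)) ->
    forall x : R, is_derive x 1 V (b * V' x - U x * h 0%N x).
  move=> cV' cU aV x.
  have cf : continuous (fun x => b * V' x - U x * h 0%N x).
    by move=> y; apply: cvgB; apply: cvgM; [exact: cvg_cst|exact: cV'|exact: cU|exact: ch].
  apply: (AC_is_derive x _ cf); apply: AC_ae aV; first exact: continuous_measurable.
  by apply: ae_imp gE => y ->; rewrite h0.
have [td te] := ode_taylor th.1 (fun x => AC_is_derive x aU1 cV1) (fun x => AC_is_derive x aU2 cV2)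
  (dV _ _ _ _ cV2 cU1 aV1) (dV _ _ _ _ cV1 cU2 aV2) th.2 B1 c_ge0 UN erefl.
set d1 := taylor_coeff U1 in td; set d2 := taylor_coeff U2 in te.
set B' := B + c + _ in td te.
have B'0 : 0 < B'.
  by rewrite /B' -addrA ltr_pwDl// addr_ge0// !mulr_ge0.
split; last first.
  move=> _; exists (fun x => U1 x +i* U2 x); split=> // x; split.
  - exact: taylor_real_analytic B'0 td x.
  - exact: taylor_real_analytic B'0 te x.
(* The imaginary part of eta, which is real. *)
have t0 : taylor_seq (fun _ _ => 0) A B.
  split=> k x; first by rewrite mulr0; exact: der_cst.
  by rewrite normr0 mulr_ge0// exprn_ge0// ltW.
have [r1 r10 [F1 [aF1 F1E]]] := strip_extension B'0 td te.
have [r2 r20 [F2 [aF2 F2E]]] := strip_extension B0 tde t0.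
exists (Num.min r1 r2); split; first by rewrite lt_min r10.
split.
- exists F2; split=> [z|]; first by rewrite lt_min => /andP[_]; exact: aF2.
  apply: ae_imp (ae_and uU eE) => x [ux ex]; rewrite F2E de0 -ex eta_real ux /=.
  by apply/eqP; rewrite eq_complex /= !eqxx.
- exists F1; split=> [z|]; first by rewrite lt_min => /andP[+ _]; exact: aF1.
  by apply: ae_imp uU => x ux; rewrite F1E.
Qed.
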